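(* Assume that each $f_i:\mathbb{R}^d\to\mathbb{R}$ ($i=1,\dots,N$) is three times continuously differentiable with bounded third derivative and is $L$-smooth, and that $\sigma_*^2:=\sup_{x\in\mathbb{R}^d}\|\sigma_{\mathrm{MB}}(x)\sigma_{\mathrm{MB}}(x)^T\|_S<\infty$. Let $\{X(t)\}_{t\ge 0}$ be the solution to the MB-PGF equation $$dX(t)=-\psi(t)\nabla f(X(t))\,dt+\psi(t)\sqrt{h/b(t)}\,\sigma_{\mathrm{MB}}(X(t))\,dB(t),\qquad X(0)=x_0 .$$ Let $t>0$ and let $\tilde t\in[0,t]$ be a random time point (drawn independently of the process $X$) with probability density $s\mapsto \psi(s)/\varphi(t)$ on $[0,t]$ (and $0$ otherwise). Then $$\mathbb{E}\left[\|\nabla f(X(\tilde t))\|^2\right]\le \frac{f(x_0)-f(x^\star)}{\varphi(t)}+\frac{h\,d\,L\,\sigma_*^2}{2\,\varphi(t)}\int_0^t\frac{\psi(s)^2}{b(s)}\,ds .$$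
   Context: $f_1,\dots,f_N:\mathbb{R}^d\to\mathbb{R}$, $f:=\frac1N\sum_{i=1}^N f_i$, and $x^\star\in\mathbb{R}^d$ is a global minimizer of $f$. A differentiable function $g$ is $L$-smooth if $\|\nabla g(x)-\nabla g(y)\|\le L\|x-y\|$ for all $x,y$. $\|\cdot\|$ is the Euclidean norm and $\|\cdot\|_S$ the spectral norm. The constant $h>0$ is the discretization stepsize. The adjustment function $\psi:[0,\infty)\to[0,1]$ is continuously differentiable, non-increasing, with $\psi(0)=1$; $\varphi(t):=\int_0^t\psi(s)\,ds$. The mini-batch size function $b:[0,\infty)\to(0,\infty)$ is continuously differentiable with $b(t)\ge 1$. The volatility $\sigma_{\mathrm{MB}}(x):=\Sigma_{\mathrm{MB}}(x)^{1/2}$ is the principal (positive semidefinite) square root of $$\Sigma_{\mathrm{MB}}(x):=\frac1N\sum_{i=1}^N(\nabla f(x)-\nabla f_i(x))(\nabla f(x)-\nabla f_i(x))^T .$$ $\{B(t)\}_{t\ge0}$ is a $d$-dimensional Brownian motion on a filtered probability space, and $x_0\in\mathbb{R}^d$ is a deterministic initial condition. *)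

(* Defs.v *)
From mathcomp Require Import all_boot all_order all_algebra.
From mathcomp Require Import all_classical all_reals all_analysis.

Set Implicit Arguments.
Unset Strict Implicit.
Unset Printing Implicit Defensive.

Import Order.TTheory GRing.Theory Num.Theory.
Import numFieldNormedType.Exports.

Local Open Scope classical_set_scope.
Local Open Scope ring_scope.

(* Vectors of R^d are column vectors 'cV[R]_d; time is
   R, and functions of time are only ever constrained on [0, +oo[. *)

(* The library norm `|x| on matrices is the sup norm; enorm is the Euclidean
   norm on column vectors and the Frobenius norm on matrices. *)
Definition enorm {R : realType} {m n : nat} (A : 'M[R]_(m, n)) : R :=
  Num.sqrt (\sum_i \sum_j A i j ^+ 2).

Definition spectral_norm {R : realType} {m n : nat} (A : 'M[R]_(m, n)) : R :=
  sup [set enorm (A *m x) | x in [set x : 'cV[R]_n | enorm x <= 1]].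

Definition is_psd {R : realType} {d : nat} (A : 'M[R]_d) : Prop :=
  A^T = A /\ forall x : 'cV[R]_d, 0 <= (x^T *m A *m x) 0 0.

(* For A positive semidefinite the set below is a singleton. *)
Definition principal_sqrt {R : realType} {d : nat} (A : 'M[R]_d) : 'M[R]_d :=
  xget 0 [set S | is_psd S /\ S *m S = A].

Section calculus.
Context {R : realType} {d : nat}.
Implicit Types f : 'cV[R]_d -> R.

Definition partial (i : 'I_d) f : 'cV[R]_d -> R :=
  fun x => 'D_(delta_mx i 0 : 'cV[R]_d) f x.

Definition grad f (x : 'cV[R]_d) : 'cV[R]_d := \col_i partial i f x.

Fixpoint is_Ck (k : nat) f : Prop :=
  if k is k'.+1 then
    (forall x, differentiable f x) /\ (forall i, is_Ck k' (partial i f))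
  else continuous f.

Definition bounded_third_derivative f : Prop :=
  exists M : R, forall (i j k : 'I_d) (x : 'cV[R]_d),
    `|partial i (partial j (partial k f)) x| <= M.

Definition L_smooth (L : R) f : Prop :=
  (forall x, differentiable f x) /\
  (forall x y, enorm (grad f x - grad f y) <= L * enorm (x - y)).

End calculus.

(* Continuously differentiable on the closed half-line [0, +oo[, with the
   one-sided derivative at 0. *)
Definition C1_halfline {R : realType} (g : R -> R) : Prop :=
  exists g' : R -> R,
    {within `[0, +oo[%classic, continuous g'} /\
    forall t : R, 0 <= t ->
      (fun s => (g s - g t) / (s - t)) @ within `[0, +oo[%classic (t^')
        --> g' t.

Section finite_sum.
Context {R : realType} {d N : nat}.
Variable fs : 'I_N -> 'cV[R]_d -> R.

Definition average (x : 'cV[R]_d) : R := N%:R^-1 * \sum_(i < N) fs i x.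

Definition SigmaMB (x : 'cV[R]_d) : 'M[R]_d :=
  N%:R^-1 *: \sum_(i < N)
    (grad average x - grad (fs i) x) *m (grad average x - grad (fs i) x)^T.

Definition sigmaMB (x : 'cV[R]_d) : 'M[R]_d := principal_sqrt (SigmaMB x).

Definition sigma_star2 : \bar R :=
  ereal_sup [set (spectral_norm (sigmaMB x *m (sigmaMB x)^T))%:E
            | x in [set: 'cV[R]_d]].

End finite_sum.

Section stochastic.
Context {R : realType} {d : nat} {disp : measure_display}
  {T : measurableType disp}.
Variable P : probability T R.
Implicit Types (F : R -> set (set T)) (B X : R -> T -> 'cV[R]_d)
  (H : R -> T -> 'M[R]_d).

Definition is_filtration F : Prop :=
  [/\ forall s : R, 0 <= s -> sigma_algebra [set: T] (F s),
      forall s : R, 0 <= s -> F s `<=` measurable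
    & forall s t : R, 0 <= s -> s <= t -> F s `<=` F t].

Definition measurable_wrt {m n : nat} (G : set (set T)) (Y : T -> 'M[R]_(m, n))
    : Prop :=
  forall i j (U : set R), measurable U -> G ((fun w => Y w i j) @^-1` U).

Definition adapted {m n : nat} F (Y : R -> T -> 'M[R]_(m, n)) : Prop :=
  forall s : R, 0 <= s -> measurable_wrt (F s) (Y s).

Definition continuous_paths {m n : nat} (Y : R -> T -> 'M[R]_(m, n)) : Prop :=
  forall w, {within `[0, +oo[%classic, continuous (fun s => Y s w)}.

(* The last clause says at once that B t - B s is independent of F s and that
   it has the law N(0, (t - s) I_d), i.e. independent centered normal
   coordinates with standard deviation sqrt (t - s): the boxes
   U_0 x ... x U_(d-1) form a pi-system generating the Borel sets of R^d. *)
Definition brownian_motion F B : Prop :=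
  [/\ adapted F B,
      continuous_paths B,
      {ae P, forall w, B 0 w = 0}
    & forall (s t : R) (A : set T) (U : 'I_d -> set R),
        0 <= s -> s < t -> F s A -> (forall i, measurable (U i)) ->
        P (A `&` [set w | forall i, U i (B t w i 0 - B s w i 0)]) =
        (P A * \prod_(i < d) normal_prob 0%R (Num.sqrt (t - s)%R) (U i))%E].

(* The elementary process equal to [evalue k] on
   [etime k, etime k.+1[ for k < esize. *)
Record elementary : Type := Elementary {
  esize : nat;
  etime : nat -> R;
  evalue : nat -> T -> 'M[R]_d }.

Definition elementary_on F (t : R) (phi : elementary) : Prop :=
  [/\ etime phi 0 = 0 /\ etime phi (esize phi) = t,
      forall k, (k < esize phi)%N -> etime phi k <= etime phi k.+1,
      forall k, (k < esize phi)%N ->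
        measurable_wrt (F (etime phi k)) (evalue phi k)
    & exists M : R, forall k w, (k < esize phi)%N ->
        enorm (evalue phi k w) <= M].

Definition elementary_process (phi : elementary) : R -> T -> 'M[R]_d :=
  fun s w => \sum_(k < esize phi)
    (if etime phi k <= s < etime phi k.+1 then evalue phi k w else 0).

Definition elementary_integral B (phi : elementary) : T -> 'cV[R]_d :=
  fun w => \sum_(k < esize phi)
    evalue phi k w *m (B (etime phi k.+1) w - B (etime phi k) w).

(* [is_ito_integral F B t H I]: H is a (jointly) measurable adapted process
   with E int_0^t |H|^2 ds < oo, and I is a version of its Ito integral
   int_0^t H dB, i.e. the L^2(P)-limit of the integrals of elementary
   processes converging to H in L^2([0, t] x T). By the Ito isometry I is
   unique up to a P-null set and does not depend on the approximation. *)
Definition is_ito_integral F B (t : R) H (I : T -> 'cV[R]_d) : Prop :=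
  [/\ forall i j, measurable_fun (`[0, t]%classic `*` [set: T])
        (fun z : R * T => H z.1 z.2 i j),
      adapted F H,
      (\int[P]_w \int[lebesgue_measure]_(s in `[0%R, t])
         ((enorm (H s w) ^+ 2)%R)%:E < +oo)%E,
      forall i, measurable_fun [set: T] (fun w => I w i 0)
    & exists phi : nat -> elementary,
      [/\ forall n, elementary_on F t (phi n),
          (fun n => \int[P]_w \int[lebesgue_measure]_(s in `[0%R, t])
             ((enorm (H s w - elementary_process (phi n) s w) ^+ 2)%R)%:E)%E
             @ \oo --> 0%E
        & (fun n => \int[P]_w
             ((enorm (I w - elementary_integral B (phi n) w) ^+ 2)%R)%:E)%E
             @ \oo --> 0%E]].

(* X solves dX(t) = a(t, X(t)) dt + sg(t, X(t)) dB(t), X(0) = x0. *)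
Definition is_sde_solution F B (a : R -> 'cV[R]_d -> 'cV[R]_d)
    (sg : R -> 'cV[R]_d -> 'M[R]_d) (x0 : 'cV[R]_d) X : Prop :=
  [/\ adapted F X,
      continuous_paths X,
      {ae P, forall w, X 0 w = x0},
      forall t : R, 0 <= t -> {ae P, forall w, forall i,
        lebesgue_measure.-integrable `[0, t]
          (fun s => (a s (X s w) i 0)%:E)}
    & forall t : R, 0 <= t -> exists I : T -> 'cV[R]_d,
        is_ito_integral F B t (fun s w => sg s (X s w)) I /\
        {ae P, forall w, X t w =
          x0 + \col_i (\int[lebesgue_measure]_(s in `[0, t]) a s (X s w) i 0)
             + I w}].

Definition process_sigma_algebra X : set (set T) :=
  <<s [set A | exists (s : R) (i : 'I_d) (U : set R),
        [/\ 0 <= s, measurable U & A = (fun w => X s w i 0) @^-1` U] ]>>.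

Definition independent_of_process (tau : T -> R) X : Prop :=
  forall (A : set T) (U : set R),
    process_sigma_algebra X A -> measurable U ->
    P (A `&` tau @^-1` U) = (P A * P (tau @^-1` U))%E.

End stochastic.

Definition time_integral {R : realType} (g : R -> R) (t : R) : R :=
  \int[lebesgue_measure]_(s in `[0, t]) g s.

(* Main.v *)
Require Import Defs.
From mathcomp Require Import all_boot all_order all_algebra.
From mathcomp Require Import all_classical all_reals all_analysis.
From mathcomp Require Import measurable_realfun ring lra.
Import Order.TTheory GRing.Theory Num.Theory.
Import numFieldNormedType.Exports.
Local Open Scope classical_set_scope.
Local Open Scope ring_scope.
Set Implicit Arguments.
Unset Strict Implicit.
Unset Printing Implicit Defensive.

(** Write [f] for the average of the [f_i], [G] for its gradient, [phi] for the
    integral of [psi] over [[0, t]], and [M] for the martingale part of [X], so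
    that the increments of [X] are those of [M] minus the integral of [psi G(X)].

    The theorem is an energy estimate obtained by summing the descent lemma
      [f y <= f x + <G x, y - x> + L / 2 |y - x|^2],
    which follows from the Lipschitz continuity of [G], along the path of [X]
    sampled on a grid of mesh [t / n].  In expectation, one step of the grid
    ([energy_step]) contributes three things.
    - The linear term gives minus [E|G(X u)|^2] times the integral of [psi] over
      [[u, v]]: the increment of [M] is orthogonal to [G(X u)], which is known
      at time [u], and [G(X s)] is close to [G(X u)] for [s] in [[u, v]].
    - The quadratic term gives at most [L / 2 E|M v - M u|^2], which the isometry
      bounds by [L / 2] times the integral of [h d sigma_*^2 psi^2 / b], because
      the squared Frobenius norm of [sigma_MB] is at most [d sigma_*^2].  This is
      exactly the noise term of the theorem: the descent lemma already carries
      the right constant.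
    - Everything else is of the order of [(v - u) (e + (v - u) / e)], where [e]
      is the parameter of Young's inequality.  This uses the bounds
      [E|G(X s)|^2 <= C] and [E|X v - X u|^2 <= C (v - u)] of [moment_bounds],
      which come from Gronwall's lemma applied path by path.

    Summing over the grid and using [f xstar <= f (X t)] gives
    [energy_dissipation], with a total error of [C (e + t / (n e))].

    Rounding the random time down to the grid and using its independence of [X]
    turns the expected squared gradient into the left-hand side of that
    inequality divided by [phi].  Fatou's lemma lets [n] go to infinity
    ([random_time_mean_le]), and then [e] goes to [0].

    The stochastic integral enters through three properties of its increments:
    [ito_increment_msq], [ito_increment_sq_integrable] and
    [ito_increment_orthogonal].  For simple processes they are [simple_isometry]
    and [simple_int_orthogonal], which reduce to the first two moments of
    Brownian increments and their independence of the past.  The passage to the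
    limit needs some care, because the integrals up to [u] and up to [v] are
    limits along unrelated sequences of elementary processes: the approximants
    of the second one, cut at time [u], are compared with those of the first one
    in [ito_increment_approx]. *)

(** * Measurability of composite functions *)

(** A countable union over the value of the index [K x]; this is how functions
    discretized on a grid are shown to be measurable. *)
Lemma measurable_fun_countable_index d (T : measurableType d) (R : realType)
    (C : countType) (K : T -> C) (G : C -> T -> R) :
  (forall c, measurable (K @^-1` [set c])) ->
  (forall c, measurable_fun [set: T] (G c)) ->
  measurable_fun [set: T] (fun x => G (K x) x).
Proof.
move=> mK mG _ Y mY; rewrite setTI.
have -> : (fun x => G (K x) x) @^-1` Y =
    \bigcup_c ((K @^-1` [set c]) `&` (G c @^-1` Y)).
  apply/seteqP; split => [x /= Yx|x [c _ [/= <-]]//].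
  by exists (K x).
apply: countable_bigcupT_measurable => [|c]; first exact: countableP.
apply: measurableI => //; rewrite -[X in measurable X]setTI; exact: mG.
Qed.

Lemma measurable_floor_preimage d (T : measurableType d) (R : realType)
    (f : T -> R) (k : int) : measurable_fun [set: T] f ->
  measurable ((fun x => Num.floor (f x)) @^-1` [set k]).
Proof.
move=> mf.
have -> : (fun x => Num.floor (f x)) @^-1` [set k] =
    f @^-1` `[k%:~R, (k + 1)%:~R[%classic.
  apply/seteqP; split => x /=.
    by move=> <-; rewrite in_itv/= floor_itv.
  by rewrite in_itv/= => H; exact: floor_def.
by rewrite -[X in measurable X]setTI; apply: mf => //; exact: measurable_itv.
Qed.

Definition grid_approx (R : realType) (n : nat) (x : R) : R :=
  (Num.floor (n.+1%:R * x))%:~R / n.+1%:R.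

Lemma grid_approx_bound (R : realType) (n : nat) (x : R) :
  `|grid_approx n x - x| <= n.+1%:R^-1.
Proof.
have n0 : 0 < n.+1%:R :> R by rewrite ltr0n.
have /andP[h1 h2] := floor_itv (n.+1%:R * x).
rewrite /grid_approx -[X in _ - X](mulKf (lt0r_neq0 n0)) [_^-1 * _]mulrC -mulrBl.
rewrite intrD in h2.
have h : `|(Num.floor (n.+1%:R * x))%:~R - n.+1%:R * x| <= 1.
  by rewrite ler_norml; apply/andP; split; lra.
rewrite normrM [X in _ * X <= _]gtr0_norm ?invr_gt0//.
by apply: ler_piMl => //; rewrite invr_ge0 ltW.
Qed.

Lemma cvg_grid_approx (R : realType) (x : R) :
  grid_approx n x @[n --> \oo] --> x.
Proof.
apply/cvgrPdist_le => e e0; near=> n.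
rewrite distrC (le_trans (grid_approx_bound _ _))// ltW//.
near: n; exact: near_infty_natSinv_lt (PosNum e0).
Unshelve. all: by end_near. Qed.

(** Rounding the time to a grid leaves a countable index, and continuity in time
    recovers [Y] in the limit. *)
Lemma measurable_fun_caratheodory d (T : measurableType d) (R : realType)
    (Y : R -> T -> R) :
  (forall s, measurable_fun [set: T] (Y s)) ->
  (forall w, continuous (Y ^~ w)) ->
  measurable_fun [set: R * T] (fun z => Y z.1 z.2).
Proof.
move=> mY cY.
apply: (@measurable_fun_cvg _ _ _ _
  (fun n (z : R * T) => Y (grid_approx n z.1) z.2)); last first.
  move=> [s w] _ /=; apply: (@cvg_comp _ _ _ (fun n => grid_approx n s) (Y ^~ w)).
    exact: cvg_grid_approx.
  exact: cY.
move=> n; apply: (@measurable_fun_countable_index _ _ _ int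
  (fun z : R * T => Num.floor (n.+1%:R * z.1))
  (fun k (z : R * T) => Y (k%:~R / n.+1%:R) z.2)) => k.
  apply: measurable_floor_preimage.
  exact: measurable_funM.
exact: measurableT_comp (mY _) measurable_snd.
Qed.

Lemma mx_norm_le (R : realType) m n (x : 'M[R]_(m, n)) (e : R) : 0 <= e ->
  (forall i j, `|x i j| <= e) -> `|x| <= e.
Proof.
move=> e0 xe; rewrite [X in X <= _]mx_normrE; by apply/bigmax_leP; split => //= -[i j] _; exact: xe.
Qed.

(** The Borel sets of ['cV_n] are never mentioned: the coordinates are rounded to a
    grid, where [g] takes countably many values, and continuity of [g] passes to the
    limit. *)
Lemma measurable_fun_continuous_coords d (T : measurableType d) (R : realType)
    (n : nat) (g : 'cV[R]_n -> R) (X : T -> 'cV[R]_n) :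
  continuous g -> (forall i, measurable_fun [set: T] (fun w => X w i 0)) ->
  measurable_fun [set: T] (fun w => g (X w)).
Proof.
move=> cg mX.
apply: (@measurable_fun_cvg _ _ _ _
  (fun p w => g (\col_i grid_approx p (X w i 0)))); last first.
  move=> w _ /=; apply: (@cvg_comp _ _ _
    (fun p => \col_i grid_approx p (X w i 0)) g); last exact: cg.
  apply/cvgrPdist_le => e e0; near=> p.
  apply: mx_norm_le => [|i j]; first exact: ltW.
  rewrite !mxE (ord1 j) distrC (le_trans (grid_approx_bound _ _))// ltW//.
  near: p; exact: near_infty_natSinv_lt (PosNum e0).
move=> p; pose K w : 'cV[int]_n := \col_i Num.floor (p.+1%:R * X w i 0).
rewrite (_ : (fun w => _) = (fun w => g (\col_i ((K w i 0)%:~R / p.+1%:R)))).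
  apply: (@measurable_fun_countable_index _ _ _ 'cV[int]_n K
    (fun (k : 'cV[int]_n) _ => g (\col_i ((k i 0)%:~R / p.+1%:R)))) => [k|k] //.
  have -> : K @^-1` [set k] = \bigcap_(i in [set: 'I_n])
      ((fun w => Num.floor (p.+1%:R * X w i 0)) @^-1` [set k i 0]).
    apply/seteqP; split => w /=.
      by move=> /colP kE i _; have := kE i; rewrite mxE.
    by move=> h; apply/colP => i; rewrite mxE; exact: h.
  apply: fin_bigcap_measurable => // i _; apply: measurable_floor_preimage.
  exact: measurable_funM.
by apply/funext => w; congr g; apply/colP => i; rewrite !mxE.
Unshelve. all: by end_near. Qed.

Lemma continuous_maxr0 (R : realType) : continuous (fun s : R => Num.max s 0).
Proof.
move=> s.
exact: (@continuous_max R R id (fun=> 0) s (fun A h => h) (@cst_continuous R R^o 0 s)).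
Qed.

(** Functions of time are continuous on the half-line only.  Freezing them at their
    value at [0] for negative times gives functions that are continuous on the whole
    line, to which the calculus lemmas apply directly. *)
Lemma continuous_extend_halfline (R : realType) (U : topologicalType)
    (f : R -> U) : {within `[0, +oo[%classic, continuous f} ->
  continuous (fun s : R => f (Num.max s 0)).
Proof.
move=> /subspace_continuousP cf s.
have m0 : `[0, +oo[%classic (Num.max s 0) by rewrite /= in_itv/= andbT le_max lexx orbT.
apply: (@cvg_comp _ _ _ (fun s : R => Num.max s 0) f); last exact: (cf _ m0).
move=> A /= wA; apply: (@filterS R (nbhs s) _ _ _ _ (continuous_maxr0 wA)) => r.
by apply; rewrite /= in_itv/= andbT le_max lexx orbT.
Qed.

(** * Moments of the centered normal law *)

(** The normal law is defined by its density, so the Radon-Nikodym derivative agrees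
    with the density almost everywhere. *)
Lemma ge0_integral_normal_prob (R : realType) (m s : R) (f : R -> R) :
  measurable_fun [set: R] f -> (forall x, 0 <= f x) ->
  (\int[normal_prob m s]_x (f x)%:E =
   \int[lebesgue_measure]_x (f x * normal_pdf m s x)%:E)%E.
Proof.
move=> mf f0; have dom := normal_prob_dominates m s.
have mfE : measurable_fun [set: R] (EFin \o f) by exact/measurable_EFinP.
have mrn : measurable_fun [set: R]
    (Radon_Nikodym_SigmaFinite.f (normal_prob m s) lebesgue_measure).
  exact: (measurable_int _ (Radon_Nikodym_SigmaFinite.f_integrable dom)).
have mpdf : measurable_fun [set: R] (EFin \o normal_pdf m s).
  by apply/measurable_EFinP; exact: measurable_normal_pdf.
rewrite -(Radon_Nikodym_SigmaFinite.change_of_variables dom)//; last first.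
apply: ge0_ae_eq_integral => //.
- exact: emeasurable_funM.
- by apply/measurable_EFinP; apply: measurable_funM => //; exact: measurable_normal_pdf.
- by move=> x _; rewrite mule_ge0 ?lee_fin//; exact: Radon_Nikodym_SigmaFinite.f_ge0.
- by move=> x _; rewrite lee_fin mulr_ge0 ?normal_pdf_ge0.
under [X in ae_eq _ _ _ X]eq_fun do rewrite EFinM.
apply: ae_eqe_mul2l; apply: integral_ae_eq => //.
  exact: Radon_Nikodym_SigmaFinite.f_integrable.
by move=> E _ mE; rewrite -(Radon_Nikodym_SigmaFinite.f_integral dom).
Qed.

Section normal_moments.
Context {R : realType}.
Variable s : R.
Hypothesis s0 : 0 < s.
Local Notation N := (normal_prob 0 s).

Let normal_total : fine (N [set: R]) = 1.
Proof. by rewrite /normal_prob integral_normal_pdf. Qed.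

(** The integrand is the ratio of the densities of the laws of mean [m] and [0]. *)
Lemma integral_normal_shift (m : R) :
  (\int[N]_x (expR ((2 * x * m - m ^+ 2) / (2 * s ^+ 2)))%:E = 1)%E.
Proof.
rewrite ge0_integral_normal_prob; last 2 first.
- apply: measurableT_comp => //; apply: measurable_funM => //.
  by apply: measurable_funB => //; apply: measurable_funM => //; exact: measurable_funM.
- by move=> x; exact: expR_ge0.
rewrite -(integral_normal_pdf m s); apply: eq_integral => x _; congr EFin.
rewrite /normal_pdf (gt_eqF s0) mulrCA; congr (_ * _).
rewrite /normal_fun -expRD; congr expR.
by rewrite -mulr_natl; field; rewrite ?(gt_eqF s0).
Qed.

(** Up to the factor [r], the integrand is the ratio of the densities of the
    centered laws of deviation [r * s] and [s]. *)
Lemma integral_normal_dilation (r : R) : 0 < r ->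
  (\int[N]_x (expR ((1 - r ^- 2) / (2 * s ^+ 2) * x ^+ 2))%:E = r%:E)%E.
Proof.
move=> r0; rewrite ge0_integral_normal_prob; last 2 first.
- by apply: measurableT_comp => //; apply: measurable_funM.
- by move=> x; exact: expR_ge0.
have rs0 : 0 < r * s by exact: mulr_gt0.
rewrite -[RHS]mule1 -(integral_normal_pdf 0 (r * s)).
rewrite -ge0_integralZl_EFin; last 4 first.
- exact: measurableT.
- by move=> x _; rewrite lee_fin normal_pdf_ge0.
- by apply/measurable_EFinP; exact: measurable_normal_pdf.
- exact: ltW.
apply: eq_integral => x _; rewrite -EFinM; congr EFin.
rewrite /normal_pdf (gt_eqF s0) (gt_eqF rs0) [LHS]mulrCA [RHS]mulrA.
congr (_ * _).
  rewrite /normal_peak -(mulrnAr (s ^+ 2)) -(mulrnAr ((r * s) ^+ 2)).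
  rewrite exprMn -(mulrA (r ^+ 2)) [X in _ = _ / X]sqrtrM ?sqr_ge0//.
  by rewrite sqrtr_sqr gtr0_norm// invfM mulrA divff ?mul1r// gt_eqF.
rewrite /normal_fun -expRD; congr expR.
by rewrite -(mulr_natl (s ^+ 2)) -(mulr_natl ((r * s) ^+ 2)); field; rewrite ?(gt_eqF s0) ?(gt_eqF r0).
Qed.

(** The square is dominated by a multiple of the exponential moment of
    [integral_normal_dilation] for [r = 2]. *)
Lemma integrable_normal_sqr : N.-integrable [set: R] (EFin \o (fun x : R => x ^+ 2)).
Proof.
pose c := (1 - 2 ^- 2) / (2 * s ^+ 2) : R.
have c0 : 0 < c by rewrite /c divr_gt0 ?mulr_gt0 ?exprn_gt0//; lra.
have mc : measurable_fun [set: R] (fun x : R => expR (c * x ^+ 2)).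
  by apply: measurableT_comp => //; apply: measurable_funM.
have : N.-integrable [set: R] (fun x => (c^-1)%:E * (expR (c * x ^+ 2))%:E)%E.
  apply: integrableZl => //; apply/integrableP; split; first exact/measurable_EFinP.
  under eq_integral do rewrite gee0_abs ?lee_fin ?expR_ge0//.
  by rewrite integral_normal_dilation// ltry.
apply: le_integrable => //; first exact/measurable_EFinP.
move=> x _; rewrite -EFinM !abse_EFin lee_fin !ger0_norm ?sqr_ge0//; last first.
  by rewrite mulr_ge0 ?expR_ge0 ?invr_ge0 ?ltW.
rewrite ler_pdivlMl// (le_trans _ (expR_ge1Dx _))//; lra.
Qed.

Lemma integrable_normal_id : N.-integrable [set: R] (EFin \o (fun x : R => x)).
Proof.
have h : N.-integrable [set: R] (fun x => (1 + x ^+ 2)%:E).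
  have i1 : N.-integrable [set: R] (EFin \o (fun=> 1)).
    exact: finite_measure_integrable_cst.
  exact: (integrableD measurableT i1 integrable_normal_sqr).
apply: le_integrable h => //; first exact/measurable_EFinP.
move=> x _; rewrite /= lee_fin [leRHS]ger0_norm ?addr_ge0 ?sqr_ge0//.
by rewrite ler_norml; apply/andP; split; nra.
Qed.

(** Bounding the exponential in [integral_normal_shift] below by its tangent gives
    [2 m M <= m^2] for every [m], where [M] is the mean; small [m] of both signs
    force [M = 0]. *)
Lemma normal_mean : \int[N]_x x = 0.
Proof.
set M := (X in X = 0).
have iid := integrable_normal_id.
have key m : 2 * m * M <= m ^+ 2.
  have ie : N.-integrable [set: R]
      (EFin \o (fun x => expR ((2 * x * m - m ^+ 2) / (2 * s ^+ 2)))).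
    apply/integrableP; split.
      apply/measurable_EFinP; apply: measurableT_comp => //.
      apply: measurable_funM => //; apply: measurable_funB => //.
      by apply: measurable_funM => //; exact: measurable_funM.
    under eq_integral do rewrite gee0_abs ?lee_fin ?expR_ge0//.
    by rewrite integral_normal_shift ltry.
  have ix : N.-integrable [set: R] (EFin \o (fun x => m / s ^+ 2 * x)).
    exact: (integrableZl measurableT (m / s ^+ 2) iid).
  have ic : N.-integrable [set: R] (EFin \o (fun=> 1 - m ^+ 2 / (2 * s ^+ 2))).
    exact: finite_measure_integrable_cst.
  have : \int[N]_x (m / s ^+ 2 * x + (1 - m ^+ 2 / (2 * s ^+ 2))) <=
         \int[N]_x (expR ((2 * x * m - m ^+ 2) / (2 * s ^+ 2))).
    apply: le_Rintegral => //.
      exact: (integrableD measurableT ix ic).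
    move=> x _; apply: le_trans (expR_ge1Dx _).
    by rewrite le_eqVlt; apply/orP; left; apply/eqP; field; rewrite ?(gt_eqF s0).
  rewrite RintegralD// RintegralZl// Rintegral_cst// normal_total mulr1 -/M.
  rewrite [leRHS]/Rintegral integral_normal_shift /=.
  have -> : m / s ^+ 2 * M + (1 - m ^+ 2 / (2 * s ^+ 2)) =
    1 + (2 * m * M - m ^+ 2) / (2 * s ^+ 2).
    by field; rewrite ?(gt_eqF s0).
  by rewrite gerDl pmulr_lle0 ?invr_gt0 ?mulr_gt0 ?exprn_gt0// subr_le0.
have := key M; nra.
Qed.

(** As for the mean, with the tangent bound in [integral_normal_dilation]: the
    resulting inequality holds for [r] on both sides of [1], and [r] tending to [1]
    pins the second moment from above and from below. *)
Lemma normal_second_moment : \int[N]_x x ^+ 2 = s ^+ 2.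
Proof.
set V := (X in X = _).
have isq := integrable_normal_sqr.
have s20 : 0 < s ^+ 2 by exact: exprn_gt0.
have key r : 0 < r -> V / s ^+ 2 * (r ^+ 2 - 1) <= 2 * r ^+ 2 * (r - 1).
  move=> r0; set c := (1 - r ^- 2) / (2 * s ^+ 2).
  have ie : N.-integrable [set: R] (EFin \o (fun x => expR (c * x ^+ 2))).
    apply/integrableP; split.
      by apply/measurable_EFinP; apply: measurableT_comp => //; apply: measurable_funM.
    under eq_integral do rewrite gee0_abs ?lee_fin ?expR_ge0//.
    by rewrite integral_normal_dilation// ltry.
  have ix : N.-integrable [set: R] (EFin \o (fun x => c * x ^+ 2)).
    exact: (integrableZl measurableT c isq).
  have ic : N.-integrable [set: R] (EFin \o (fun=> 1)).
    exact: finite_measure_integrable_cst.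
  have : \int[N]_x (1 + c * x ^+ 2) <= \int[N]_x (expR (c * x ^+ 2)).
    apply: le_Rintegral => //; first exact: (integrableD measurableT ic ix).
    by move=> x _; exact: expR_ge1Dx.
  rewrite RintegralD// RintegralZl// Rintegral_cst// normal_total mul1r -/V.
  rewrite [leRHS]/Rintegral integral_normal_dilation //=.
  have -> : 1 + c * V = 1 + V / s ^+ 2 * (r ^+ 2 - 1) / (2 * r ^+ 2).
    by rewrite /c; field; rewrite ?(gt_eqF s0) ?(gt_eqF r0).
  rewrite -lerBrDl ler_pdivrMr ?mulr_gt0 ?exprn_gt0//; lra.
suff : V / s ^+ 2 = 1 by move=> /divr1_eq.
apply/eqP; rewrite eq_le; apply/andP; split; apply/ler_addgt0Pl => e e0.
  have := key (1 + e / 2) ltac:(lra).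
  set q := V / _.
  have -> : (1 + e / 2) ^+ 2 - 1 = (e / 2) * (2 + e / 2) by ring.
  have -> : 2 * (1 + e / 2) ^+ 2 * (1 + e / 2 - 1) =
    (e / 2) * (2 * (1 + e / 2) ^+ 2) by ring.
  rewrite mulrCA ler_pM2l; last by lra.
  nra.
wlog e1 : e e0 / e < 1.
  move=> hw; have [/hw|e1] := ltP e 1; first exact.
  apply: (le_trans (hw 2^-1 _ _)); [lra|lra|].
  by rewrite lerD2r; lra.
have := key (1 - e / 2) ltac:(lra).
set q := V / _.
have -> : (1 - e / 2) ^+ 2 - 1 = - ((e / 2) * (2 - e / 2)) by ring.
have -> : 2 * (1 - e / 2) ^+ 2 * (1 - e / 2 - 1) =
  - ((e / 2) * (2 * (1 - e / 2) ^+ 2)) by ring.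
rewrite mulrN lerN2 [q * _]mulrCA ler_pM2l; last by lra.
nra.
Qed.

End normal_moments.

(** * Independent random variables *)

Section independent_pair.
Context d (T : measurableType d) (R : realType) (P : probability T R).

Definition independent_pair d1 d2 (T1 : measurableType d1)
    (T2 : measurableType d2) (U : T -> T1) (V : T -> T2) : Prop :=
  forall A B, measurable A -> measurable B ->
    P ((U @^-1` A) `&` (V @^-1` B)) = (P (U @^-1` A) * P (V @^-1` B))%E.

Section joint_law.
Context d1 d2 (T1 : measurableType d1) (T2 : measurableType d2).
Variables (U : {mfun T >-> T1}) (V : {mfun T >-> T2}).
Variable UV : {mfun T >-> (T1 * T2)%type}.
Hypothesis UVE : forall w, UV w = (U w, V w).
Hypothesis indep : independent_pair U V.

Lemma joint_law_product X : measurable X ->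
  (distribution P U \x distribution P V)%E X = distribution P UV X.
Proof.
apply: product_measure_unique => A B mA mB.
rewrite /distribution /pushforward /= -indep//; congr (P _).
by apply/seteqP; split => w /=; rewrite UVE.
Qed.

Lemma ge0_integral_joint_law (f : T1 * T2 -> \bar R) :
  measurable_fun [set: T1 * T2] f -> (forall z, 0 <= f z)%E ->
  (\int[P]_w f (UV w) =
   \int[distribution P U]_x \int[distribution P V]_y f (x, y))%E.
Proof.
move=> mf f0; rewrite -ge0_integral_distribution//.
rewrite -(fubini_tonelli1 f mf f0).
by apply: eq_measure_integral => A mA _; apply/esym; exact: joint_law_product.
Qed.

End joint_law.

(** The joint law is the product law, so Fubini applies to the product. *)
Lemma independent_expectation (U V : T -> R) :
  measurable_fun [set: T] U -> measurable_fun [set: T] V ->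
  P.-integrable [set: T] (EFin \o U) -> P.-integrable [set: T] (EFin \o V) ->
  independent_pair U V ->
  P.-integrable [set: T] (EFin \o (fun w => U w * V w)) /\
  \int[P]_w (U w * V w) = (\int[P]_w U w) * (\int[P]_w V w).
Proof.
move=> mU mV iU iV indep.
have mUV : measurable_fun [set: T] (fun w => (U w, V w)).
  exact: measurable_fun_pair.
pose U' : {mfun T >-> R} := mfun_Sub (mem_set mU).
pose V' : {mfun T >-> R} := mfun_Sub (mem_set mV).
pose UV' : {mfun T >-> (R * R)%type} :=
  mfun_Sub (mem_set mUV).
have UVE w : UV' w = (U' w, V' w) by [].
pose g (z : R * R) : R := z.1 * z.2.
have mg : measurable_fun setT g by exact: measurable_funM.
have indep' : independent_pair U' V' by [].
have mabs : measurable_fun [set: R] (fun x : R => `|x|%:E).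
  by apply/measurable_EFinP; exact: normr_measurable.
have finUV : (\int[distribution P U']_x \int[distribution P V']_y
    `|(g (x, y))%:E| < +oo)%E.
  have -> : (\int[distribution P U']_x \int[distribution P V']_y `|(g (x, y))%:E| =
     (\int[distribution P U']_x `|x%:E|) * (\int[distribution P V']_x `|x%:E|))%E.
    under eq_integral => x _.
      under eq_integral => y _ do rewrite /g/= normrM EFinM.
      rewrite ge0_integralZl//=.
      over.
    rewrite ge0_integralZr//=.
    by apply: integral_ge0 => y _; rewrite lee_fin.
  rewrite !ge0_integral_distribution//=.
  move/integrableP : iU => [_ iU]; move/integrableP : iV => [_ iV].
  apply: lte_mul_pinfty => //; first exact: integral_ge0.
  by rewrite ge0_fin_numE//; exact: integral_ge0.
have mgE : measurable_fun setT (EFin \o g) by exact/measurable_EFinP.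
have iUV : P.-integrable [set: T] (EFin \o (fun w => U w * V w)).
  apply/integrableP; split.
    by apply/measurable_EFinP; exact: measurable_funM.
  rewrite (ge0_integral_joint_law UVE indep' (f := fun z => `|(g z)%:E|%E))//.
  exact: measurableT_comp.
have ig : (distribution P U' \x distribution P V')%E.-integrable setT (EFin \o g).
  exact/integrable12ltyP.
have mid : measurable_fun [set: R] (EFin \o (fun x : R => x)) by exact/measurable_EFinP.
have meanU : (\int[distribution P U']_x x%:E = \int[P]_w (U w)%:E)%E.
  exact: (@integral_distribution _ _ _ _ _ P U' (EFin \o (fun x : R => x))).
have meanV : (\int[distribution P V']_x x%:E = \int[P]_w (V w)%:E)%E.
  exact: (@integral_distribution _ _ _ _ _ P V' (EFin \o (fun x : R => x))).
have idU : (distribution P U').-integrable setT (EFin \o (fun x : R => x)).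
  exact: (@integrable_pushforward _ _ _ _ _ _ mU).
have idV : (distribution P V').-integrable setT (EFin \o (fun x : R => x)).
  exact: (@integrable_pushforward _ _ _ _ _ _ mV).
split=> //; rewrite /Rintegral.
have -> : (\int[P]_w (U w * V w)%:E = \int[P]_w ((EFin \o g) (UV' w)))%E by [].
rewrite -(@integral_distribution _ _ _ _ _ P UV' (EFin \o g))//.
have -> : (\int[distribution P UV']_y (EFin \o g) y =
    \int[(distribution P U' \x distribution P V')%E]_y (EFin \o g) y)%E.
  by apply: eq_measure_integral => A mA _; apply/esym; exact: joint_law_product.
rewrite -integral12_prod_meas1// /fubini_F /=.
under eq_integral => x _.
  under eq_integral => y _ do rewrite EFinM.
  rewrite integralZl// meanV -(fineK (integrable_fin_num measurableT iV)).
  over.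
by rewrite integralZr// meanU fineM//; exact: (integrable_fin_num measurableT iU).
Qed.

Lemma rectangle_measure_unique d1 d2 (T1 : measurableType d1)
    (T2 : measurableType d2) (m1 m2 : {measure set (T1 * T2) -> \bar R}) :
  (m1 setT < +oo)%E ->
  (forall A B, measurable A -> measurable B -> m1 (A `*` B) = m2 (A `*` B)) ->
  forall X, measurable X -> m1 X = m2 X.
Proof.
move=> fin m12; pose G := [set A `*` B | A in @measurable _ T1 & B in @measurable _ T2].
apply: (@measure_unique _ _ _ G (fun=> setT)) => //.
- exact: measurable_prod_measurableType.
- move=> _ _ [A1 mA1 [B1 mB1 <-]] [A2 mA2 [B2 mB2 <-]].
  exists (A1 `&` A2); first exact: measurableI.
  exists (B1 `&` B2); first exact: measurableI.
  by rewrite setXI.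
- by move=> _; exists setT => //; exists setT => //; rewrite setXTT.
- by rewrite bigcup_const.
- by move=> _ [A mA [B mB <-]]; exact: m12.
Qed.

(** For fixed [C], both sides of the independence relation are finite measures of
    the pair [(Y, V)] that agree on rectangles, hence on the preimage of any set
    under multiplication. *)
Lemma independent_pair_mul (Y V W : T -> R) :
  measurable_fun [set: T] Y -> measurable_fun [set: T] V ->
  measurable_fun [set: T] W ->
  (forall A B C, measurable A -> measurable B -> measurable C ->
    P ((Y @^-1` A) `&` (V @^-1` B) `&` (W @^-1` C)) =
    (P ((Y @^-1` A) `&` (V @^-1` B)) * P (W @^-1` C))%E) ->
  independent_pair (fun w => Y w * V w) W.
Proof.
move=> mY mV mW h A C mA mC.
have mYV : measurable_fun [set: T] (fun w => (Y w, V w)) by exact: measurable_fun_pair.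
have mWC : measurable (W @^-1` C) by rewrite -[X in measurable X]setTI; exact: mW.
have pW0 : 0 <= fine (P (W @^-1` C)) by exact: fine_ge0.
pose YV : {mfun T >-> (R * R)%type} := mfun_Sub (mem_set mYV).
pose m1 := mscale (NngNum (@ler01 R)) (pushforward (mrestr P mWC) YV).
pose m2 := mscale (NngNum pW0) (pushforward P YV).
have mX : measurable [set z : R * R | A (z.1 * z.2)].
  have mm : measurable_fun [set: R * R] (fun z : R * R => z.1 * z.2).
    exact: measurable_funM.
  by rewrite -[X in measurable X]setTI; exact: mm.
have fin : (m1 mYV setT < +oo)%E.
  rewrite /m1 /mscale /= mul1e /pushforward /mrestr preimage_setT setTI.
  by rewrite (le_lt_trans (probability_le1 P mWC))// ltry.
have e A1 B1 : measurable A1 -> measurable B1 -> m1 mYV (A1 `*` B1) = m2 mYV (A1 `*` B1).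
  move=> mA1 mB1; rewrite /m1 /m2 /pushforward /mrestr /mscale /=.
  rewrite fineK ?fin_num_measure//.
  rewrite mul1e [LHS](h A1 B1 C)// muleC; congr (_ * P _)%E.
have /= := @rectangle_measure_unique _ _ R R (m1 mYV) (m2 mYV) fin e _ mX.
rewrite /m1 /m2 /mscale /= mul1e fineK ?fin_num_measure// muleC.
by [].
Qed.

End independent_pair.

(** * Square integrable variables and Brownian increments *)

Section square_integrable.
Context d (T : measurableType d) (R : realType) (P : probability T R).
Implicit Types f g : T -> R.

Definition sq_integrable f : Prop :=
  measurable_fun [set: T] f /\
  P.-integrable [set: T] (EFin \o (fun w => f w ^+ 2)).

Lemma integrable_le (f g : T -> R) : measurable_fun [set: T] f ->
  P.-integrable [set: T] (EFin \o g) -> (forall w, `|f w| <= g w) ->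
  P.-integrable [set: T] (EFin \o f).
Proof.
move=> mf ig fg; apply: le_integrable ig => //; first exact/measurable_EFinP.
by move=> w _ /=; rewrite lee_fin (le_trans (fg w))// ler_norm.
Qed.

Lemma integrable_add (f g : T -> R) : P.-integrable [set: T] (EFin \o f) ->
  P.-integrable [set: T] (EFin \o g) ->
  P.-integrable [set: T] (EFin \o (fun w => f w + g w)).
Proof. by move=> If Ig; exact: (integrableD measurableT If Ig). Qed.

Lemma integrable_scale (c : R) (f : T -> R) : P.-integrable [set: T] (EFin \o f) ->
  P.-integrable [set: T] (EFin \o (fun w => c * f w)).
Proof. by move=> If; exact: (integrableZl measurableT c If). Qed.

Lemma sq_integrable_measurable f : sq_integrable f -> measurable_fun [set: T] f.
Proof. by case. Qed.

Lemma sq_integrable_mul f g : sq_integrable f -> sq_integrable g ->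
  P.-integrable [set: T] (EFin \o (fun w => f w * g w)).
Proof.
move=> [mf If] [mg Ig]; apply: (integrable_le _ (integrable_add If Ig)).
  exact: measurable_funM.
move=> w; have := sqr_ge0 (f w - g w); have := sqr_ge0 (f w + g w).
by rewrite ler_norml => ? ?; apply/andP; split; nra.
Qed.

Lemma sq_integrable_add f g : sq_integrable f -> sq_integrable g ->
  sq_integrable (fun w => f w + g w).
Proof.
move=> sf sg; have [mf If] := sf; have [mg Ig] := sg.
split; first exact: measurable_funD.
apply: (integrable_le _ (integrable_add (integrable_scale 2 If) (integrable_scale 2 Ig))).
  by apply: measurable_funX; exact: measurable_funD.
by move=> w; rewrite ger0_norm ?sqr_ge0//; have := sqr_ge0 (f w - g w); nra.
Qed.

Lemma sq_integrable_mul_bounded f g (M : R) : sq_integrable f ->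
  measurable_fun [set: T] g -> (forall w, `|g w| <= M) ->
  sq_integrable (fun w => g w * f w).
Proof.
move=> [mf If] mg gM; split; first exact: measurable_funM.
apply: (integrable_le _ (integrable_scale (M ^+ 2) If)).
  by apply: measurable_funX; exact: measurable_funM.
move=> w; rewrite ger0_norm ?sqr_ge0// exprMn ler_wpM2r ?sqr_ge0//.
by have := gM w; rewrite ler_norml => /andP[]; nra.
Qed.

Lemma sq_integrable_scale (c : R) f : sq_integrable f ->
  sq_integrable (fun w => c * f w).
Proof.
by move=> sf; apply: (@sq_integrable_mul_bounded f (fun=> c) `|c|).
Qed.

Lemma sq_integrable_sub f g : sq_integrable f -> sq_integrable g ->
  sq_integrable (fun w => f w - g w).
Proof.
move=> sf /(sq_integrable_scale (-1)) sg.
have := sq_integrable_add sf sg.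
by under [X in sq_integrable X -> _]eq_fun do rewrite mulN1r.
Qed.

Lemma sq_integrable_bounded f (M : R) : measurable_fun [set: T] f ->
  (forall w, `|f w| <= M) -> sq_integrable f.
Proof.
move=> mf fM.
have s1 : sq_integrable (fun=> 1).
  by split=> //; under eq_fun do rewrite expr1n; exact: finite_measure_integrable_cst.
have := sq_integrable_mul_bounded s1 mf fM.
by under [X in sq_integrable X -> _]eq_fun do rewrite mulr1.
Qed.

Lemma sq_integrable_sum (I : Type) (s : seq I) (f : I -> T -> R) :
  (forall i, sq_integrable (f i)) -> sq_integrable (fun w => \sum_(i <- s) f i w).
Proof.
move=> sf; elim: s => [|i s ih].
  under eq_fun do rewrite big_nil.
  by apply: (@sq_integrable_bounded _ 0) => // w; rewrite normr0.
under eq_fun do rewrite big_cons.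
exact: sq_integrable_add.
Qed.

Lemma sq_integrable_integrable f : sq_integrable f ->
  P.-integrable [set: T] (EFin \o f).
Proof.
move=> sf; have s1 : sq_integrable (fun=> 1).
  by apply: (@sq_integrable_bounded _ 1) => // w; rewrite normr1.
have := sq_integrable_mul sf s1.
by under [X in P.-integrable setT (EFin \o X) -> _]eq_fun do rewrite mulr1.
Qed.

Lemma sq_integrableP f : measurable_fun [set: T] f ->
  (\int[P]_w (f w ^+ 2)%:E < +oo)%E -> sq_integrable f.
Proof.
move=> mf foo; split=> //; apply/integrableP; split.
  by apply/measurable_EFinP; exact: measurable_funX.
by under eq_integral do rewrite gee0_abs ?lee_fin ?sqr_ge0//.
Qed.

End square_integrable.

Section measurability_at.
Context d (T : measurableType d) (R : realType).
Variable G : set (set T).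
Hypothesis sG : sigma_algebra [set: T] G.

(** This is the scalar form of [measurable_wrt]; [measurable_inP] identifies it with
    measurability on the space generated by [G]. *)
Definition measurable_in (f : T -> R) : Prop :=
  forall U : set R, measurable U -> G (f @^-1` U).

(** This transfers the closure properties of measurable functions to
    sub-sigma-algebras. *)
Lemma measurable_inP (f : T -> R) :
  measurable_in f <-> measurable_fun [set: g_sigma_algebraType G] (f : g_sigma_algebraType G -> R).
Proof.
split=> [h _ U mU|h U mU].
  by rewrite setTI; apply: sub_sigma_algebra; exact: h.
have := h measurableT _ mU.
by rewrite setTI /measurable/= (sigma_algebra_id sG).
Qed.

Lemma measurable_in_mul (f g : T -> R) : measurable_in f -> measurable_in g ->
  measurable_in (fun w => f w * g w).
Proof.
by move=> /measurable_inP mf /measurable_inP mg; apply/measurable_inP; exact: measurable_funM.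
Qed.

Lemma measurable_in_sub (f g : T -> R) : measurable_in f -> measurable_in g ->
  measurable_in (fun w => f w - g w).
Proof.
by move=> /measurable_inP mf /measurable_inP mg; apply/measurable_inP; exact: measurable_funB.
Qed.

Lemma measurable_in_cst (c : R) : measurable_in (fun=> c).
Proof. by apply/measurable_inP; exact: measurable_cst. Qed.

Lemma measurable_in_continuous_coords (n : nat) (g : 'cV[R]_n -> R)
    (X : T -> 'cV[R]_n) : continuous g ->
  (forall i, measurable_in (fun w => X w i 0)) -> measurable_in (fun w => g (X w)).
Proof.
move=> cg mX; apply/measurable_inP.
apply: (@measurable_fun_continuous_coords _ (g_sigma_algebraType G)) => // i.
exact/measurable_inP.
Qed.

End measurability_at.

Section brownian_increments.
Context (R : realType) (dim : nat) (disp : measure_display)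
  (T : measurableType disp) (P : probability T R).
Variables (F : R -> set (set T)) (B : R -> T -> 'cV[R]_dim).
Hypothesis hF : is_filtration F.
Hypothesis hB : brownian_motion P F B.

Let sF s : 0 <= s -> sigma_algebra [set: T] (F s).
Proof. by case: hF => h _ _; exact: h. Qed.

Lemma filtration_measurable s (f : T -> R) : 0 <= s -> measurable_in (F s) f ->
  measurable_fun [set: T] f.
Proof.
move=> s0 mf _ U mU; rewrite setTI.
by case: hF => _ h _; apply: (h s) => //; exact: mf.
Qed.

Lemma filtration_le s t (f : T -> R) : 0 <= s -> s <= t ->
  measurable_in (F s) f -> measurable_in (F t) f.
Proof.
by move=> s0 st mf U mU; case: hF => _ _ h; apply: (h s t s0 st); exact: mf.
Qed.

Definition incr s t (i : 'I_dim) : T -> R := fun w => B t w i 0 - B s w i 0.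

Lemma incr_measurable_in s t i : 0 <= s -> s <= t -> measurable_in (F t) (incr s t i).
Proof.
move=> s0 st; have t0 := le_trans s0 st; case: hB => ad _ _ _.
apply: (measurable_in_sub (sF t0)).
  by move=> U mU; exact: (ad _ t0 i 0).
by apply: (filtration_le s0 st) => U mU; exact: (ad _ s0 i 0).
Qed.

Lemma incr_measurable s t i : 0 <= s -> s <= t -> measurable_fun [set: T] (incr s t i).
Proof.
by move=> s0 st; apply: (filtration_measurable (le_trans s0 st)); exact: incr_measurable_in.
Qed.

Let normalT (s : R) : (normal_prob 0 s [set: R] = 1)%E.
Proof. exact: probability_setT. Qed.

Let FT s : 0 <= s -> F s [set: T].
Proof.
move=> s0; have [h0 hD _] := sF s0.
by have := hD _ h0; rewrite setD0.
Qed.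

(** Only the [i]-th side of the box is not the whole line. *)
Lemma incr_law1 s t i (A : set T) (U : set R) : 0 <= s -> s < t -> F s A ->
  measurable U ->
  P (A `&` (incr s t i @^-1` U)) = (P A * normal_prob 0 (Num.sqrt (t - s)) U)%E.
Proof.
move=> s0 st FA mU; case: hB => _ _ _ h.
have := h s t A (fun k => if k == i then U else setT) s0 st FA _.
rewrite (bigD1 i)//= eqxx big1 ?mule1; last first.
  by move=> j /negbTE ->; rewrite normalT.
move=> <-; last by move=> k; case: ifP.
congr (P (_ `&` _)); apply/seteqP; split => w /=.
  by move=> wU k; case: ifP => // /eqP ->.
by move=> /(_ i); rewrite eqxx.
Qed.

Lemma incr_law2 s t i j (A : set T) (U V : set R) : i != j -> 0 <= s -> s < t ->
  F s A -> measurable U -> measurable V ->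
  P (A `&` (incr s t i @^-1` U) `&` (incr s t j @^-1` V)) =
  (P A * normal_prob 0 (Num.sqrt (t - s)) U * normal_prob 0 (Num.sqrt (t - s)) V)%E.
Proof.
move=> ij s0 st FA mU mV; case: hB => _ _ _ h.
have := h s t A (fun k => if k == i then U else if k == j then V else setT) s0 st FA _.
have ji : j != i by rewrite eq_sym.
rewrite (bigD1 i)//= (bigD1 j)//= !eqxx (negbTE ji) big1 ?mule1; last first.
  by move=> k /andP[/negbTE -> /negbTE ->]; rewrite normalT.
rewrite muleA => <-; last by move=> k; do 2 case: ifP => //.
rewrite -setIA; congr (P (_ `&` _)); apply/seteqP; split => w /=.
  by move=> [wU wV] k; case: ifP => [/eqP -> //|_]; case: ifP => // /eqP ->.
move=> wk; have := wk i; have := wk j; rewrite !eqxx (negbTE ji).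
by [].
Qed.

End brownian_increments.

(** * Moments of Brownian increments against the past *)

Section increment_moments.
Context (R : realType) (dim : nat) (disp : measure_display)
  (T : measurableType disp) (P : probability T R).
Variables (F : R -> set (set T)) (B : R -> T -> 'cV[R]_dim).
Hypothesis hF : is_filtration F.
Hypothesis hB : brownian_motion P F B.
Local Notation incr := (incr B).

Let sF s : 0 <= s -> sigma_algebra [set: T] (F s).
Proof. by case: hF => h _ _; exact: h. Qed.

Let FT s : 0 <= s -> F s [set: T].
Proof.
move=> s0; have [h0 hD _] := sF s0.
by have := hD _ h0; rewrite setD0.
Qed.

Let sqrtp (s t : R) : s < t -> 0 < Num.sqrt (t - s).
Proof. by move=> st; rewrite sqrtr_gt0 subr_gt0. Qed.

Lemma incr_law s t i (U : set R) : 0 <= s -> s < t -> measurable U ->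
  P (incr s t i @^-1` U) = normal_prob 0 (Num.sqrt (t - s)) U.
Proof.
move=> s0 st mU; have := incr_law1 hB i s0 st (FT s0) mU.
by rewrite setTI probability_setT mul1e.
Qed.

(** Change of variables: the law of the increment is normal. *)
Lemma integral_incr s t i (f : R -> R) : 0 <= s -> s < t ->
  (normal_prob 0 (Num.sqrt (t - s))).-integrable [set: R] (EFin \o f) ->
  P.-integrable [set: T] (EFin \o (f \o incr s t i)) /\
  \int[P]_w f (incr s t i w) = \int[normal_prob 0 (Num.sqrt (t - s))]_x f x.
Proof.
move=> s0 st If.
have mi : measurable_fun [set: T] (incr s t i) by exact: (incr_measurable hF hB i s0 (ltW st)).
pose V : {mfun T >-> measurableTypeR R} :=
  @mfun_Sub _ _ T (measurableTypeR R) (incr s t i) (mem_set mi).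
have VN (A : set R) : measurable A ->
    distribution P V A = normal_prob 0 (Num.sqrt (t - s)) A.
  exact: incr_law.
have mf := measurable_int _ If.
have iP : P.-integrable [set: T] (EFin \o (f \o incr s t i)).
  apply/integrableP; split; first exact: (measurableT_comp mf mi).
  have := @ge0_integral_distribution _ _ _ _ _ P V (fun x => `|(EFin \o f) x|%E).
  move=> <- //; last exact: measurableT_comp.
  move/integrableP : If => [_]; apply: le_lt_trans; rewrite le_eqVlt.
  apply/orP; left; apply/eqP.
  by apply: eq_measure_integral => A mA _; exact: VN.
split=> //; rewrite /Rintegral.
rewrite -[X in fine X = _](@integral_distribution _ _ _ _ _ P V (EFin \o f))//.
by congr fine; apply: eq_measure_integral => A mA _; exact: VN.
Qed.

Lemma incr_sq_integrable s t i : 0 <= s -> s <= t -> sq_integrable P (incr s t i).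
Proof.
move=> s0; rewrite le_eqVlt => /predU1P[<-|st].
  apply: (@sq_integrable_bounded _ _ _ _ _ 0); first exact: (incr_measurable hF hB i s0).
  by move=> w; rewrite /incr subrr normr0.
split; first exact: (incr_measurable hF hB i s0 (ltW st)).
exact: (integral_incr i s0 st (integrable_normal_sqr (sqrtp st))).1.
Qed.

Lemma incr_mean s t i : 0 <= s -> s < t -> \int[P]_w incr s t i w = 0.
Proof.
move=> s0 st.
rewrite (integral_incr i s0 st (integrable_normal_id (sqrtp st))).2.
exact: (normal_mean (sqrtp st)).
Qed.

Lemma incr_variance s t i : 0 <= s -> s < t -> \int[P]_w incr s t i w ^+ 2 = t - s.
Proof.
move=> s0 st.
rewrite (integral_incr i s0 st (integrable_normal_sqr (sqrtp st))).2.
by rewrite (normal_second_moment (sqrtp st)) sqr_sqrtr// subr_ge0 ltW.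
Qed.

Lemma incr_independent s t i (Y : T -> R) : 0 <= s -> s < t ->
  measurable_in (F s) Y -> independent_pair P Y (incr s t i).
Proof.
move=> s0 st mY A C mA mC.
rewrite (incr_law1 hB i s0 st (mY _ mA) mC).
by rewrite incr_law.
Qed.

Section products.
Variables (s t : R) (Y : T -> R).
Hypotheses (s0 : 0 <= s) (st : s <= t) (mY : measurable_in (F s) Y)
  (IY : P.-integrable [set: T] (EFin \o Y)).

Let mTY : measurable_fun [set: T] Y.
Proof. exact: (filtration_measurable hF s0). Qed.

(** [Y] is independent of the increment, which has mean zero. *)
Lemma incr_mul i : P.-integrable [set: T] (EFin \o (fun w => Y w * incr s t i w)) /\
  \int[P]_w (Y w * incr s t i w) = 0.
Proof.
move: st; rewrite le_eqVlt => /predU1P[<-|lt_st].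
  have -> : (fun w => Y w * incr s s i w) = (fun=> 0).
    by apply/funext => w; rewrite /incr subrr mulr0.
  by split; [exact: finite_measure_integrable_cst|rewrite Rintegral_cst// mul0r].
have mi : measurable_fun [set: T] (incr s t i) by exact: (incr_measurable hF hB i s0 st).
have ii := sq_integrable_integrable (incr_sq_integrable i s0 st).
have [Iu ->] := independent_expectation mTY mi IY ii (incr_independent i s0 lt_st mY).
by rewrite incr_mean// mulr0.
Qed.

(** For distinct coordinates, [incr_law2] makes the [j]-th increment independent of
    the product of [Y] and the [i]-th one; for equal coordinates, the variance of
    the increment appears. *)
Lemma incr_mul_mul i j :
  P.-integrable [set: T] (EFin \o (fun w => Y w * incr s t i w * incr s t j w)) /\
  \int[P]_w (Y w * incr s t i w * incr s t j w) =
    (i == j)%:R * (t - s) * \int[P]_w Y w.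
Proof.
move: st; rewrite le_eqVlt => /predU1P[<-|lt_st].
  have -> : (fun w => Y w * incr s s i w * incr s s j w) = (fun=> 0).
    by apply/funext => w; rewrite /incr !subrr mulr0.
  split; first exact: finite_measure_integrable_cst.
  by rewrite Rintegral_cst// subrr mulr0 !mul0r.
have mi k : measurable_fun [set: T] (incr s t k) by exact: (incr_measurable hF hB k s0 st).
have ii k := sq_integrable_integrable (incr_sq_integrable k s0 st).
have [<-|ij] := eqVneq i j.
  have mi2 : measurable_fun [set: T] (fun w => incr s t i w ^+ 2).
    by apply: measurable_funX; exact: mi.
  have [_ ii2] := incr_sq_integrable i s0 st.
  have indep : independent_pair P Y (fun w => incr s t i w ^+ 2).
    move=> A C mA mC.
    have mC2 : measurable ((fun x : R => x ^+ 2) @^-1` C).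
      by rewrite -[X in measurable X]setTI; exact: (@exprn_measurable _ setT 2).
    exact: (incr_independent i s0 lt_st mY mA mC2).
  have [Iu E] := independent_expectation mTY mi2 IY ii2 indep.
  have -> : (fun w => Y w * incr s t i w * incr s t i w) =
      (fun w => Y w * incr s t i w ^+ 2).
    by apply/funext => w; rewrite -mulrA.
  by split=> //; rewrite E incr_variance// mul1r mulrC.
have [IYi EYi] := incr_mul i.
have mYi : measurable_fun [set: T] (fun w => Y w * incr s t i w).
  exact: measurable_funM.
have indep : independent_pair P (fun w => Y w * incr s t i w) (incr s t j).
  apply: independent_pair_mul => // A C D mA mC mD.
  rewrite (incr_law2 hB ij s0 lt_st (mY mA) mC mD).
  rewrite (incr_law1 hB i s0 lt_st (mY mA) mC).
  by rewrite incr_law.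
have [Iu ->] := independent_expectation mYi (mi j) IYi (ii j) indep.
by split=> //; rewrite EYi !mul0r.
Qed.

End products.

Lemma incr_split s u t i w : incr s t i w = incr s u i w + incr u t i w.
Proof. by rewrite /incr [RHS]addrC addrA subrK. Qed.

(** The longer increment is split at the end of the shorter one; its second part is
    orthogonal to everything known at that time. *)
Lemma incr_mul_common_start c b e (Y : T -> R) i j : 0 <= c -> c <= b -> c <= e ->
  measurable_in (F c) Y -> P.-integrable [set: T] (EFin \o Y) ->
  P.-integrable [set: T] (EFin \o (fun w => Y w * incr c b i w * incr c e j w)) /\
  \int[P]_w (Y w * incr c b i w * incr c e j w) =
    (i == j)%:R * (Num.min b e - c) * \int[P]_w Y w.
Proof.
wlog be : b e i j / b <= e.
  move=> hw c0 cb ce mY IY; have /orP[be|eb] := le_total b e; first exact: hw.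
  have [Iu E] := hw e b j i eb c0 ce cb mY IY.
  have -> : (fun w => Y w * incr c b i w * incr c e j w) =
            (fun w => Y w * incr c e j w * incr c b i w).
    by apply/funext => w; rewrite mulrAC.
  by split=> //; rewrite E eq_sym (min_l eb) (min_r eb).
move=> c0 cb ce mY IY; rewrite (min_l be).
have [I1 E1] := incr_mul_mul c0 cb mY IY i j.
have b0 := le_trans c0 cb.
have mYb : measurable_in (F b) (fun w => Y w * incr c b i w).
  apply: (measurable_in_mul (sF b0)); first exact: (filtration_le hF c0 cb).
  exact: (incr_measurable_in hF hB).
have [I2 E2] := incr_mul b0 be mYb (incr_mul c0 cb mY IY i).1 j.
have -> : (fun w => Y w * incr c b i w * incr c e j w) =
  (fun w => Y w * incr c b i w * incr c b j w + Y w * incr c b i w * incr b e j w).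
  by apply/funext => w; rewrite (incr_split c b e) mulrDr.
split; first exact: integrable_add.
by rewrite RintegralD// E1 E2 addr0.
Qed.

End increment_moments.

(** * Stochastic integrals of simple processes *)

Lemma measurable_segment (R : realType) (u v : R) :
  @measurable _ (measurableTypeR R) `[u, v]%classic.
Proof. exact: measurable_itv. Qed.

Section Rintegral_finite_sums.
Context d (T : measurableType d) (R : realType) (mu : {measure set T -> \bar R}).
Variables (D : set T).
Hypothesis mD : measurable D.

Lemma EFin_Rintegral (f : T -> R) : mu.-integrable D (EFin \o f) ->
  ((\int[mu]_(x in D) f x)%:E = \int[mu]_(x in D) (f x)%:E)%E.
Proof. by move=> If; rewrite /Rintegral fineK//; exact: integrable_fin_num. Qed.

Lemma integrable_bigsum (I : Type) (s : seq I) (f : I -> T -> R) :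
  (forall i, mu.-integrable D (EFin \o f i)) ->
  mu.-integrable D (EFin \o (fun x => \sum_(i <- s) f i x)).
Proof.
move=> If; have := integrable_sum mD s (P := xpredT) (fun i _ => If i).
congr (integrable _ _ _); apply/funext => x /=.
by rewrite -sumEFin.
Qed.

Lemma Rintegral_bigsum (I : Type) (s : seq I) (f : I -> T -> R) :
  (forall i, mu.-integrable D (EFin \o f i)) ->
  \int[mu]_(x in D) (\sum_(i <- s) f i x) = \sum_(i <- s) \int[mu]_(x in D) f i x.
Proof.
move=> If; elim: s => [|i s ih].
  by under eq_Rintegral do rewrite big_nil; rewrite big_nil Rintegral_cst// mul0r.
under eq_Rintegral do rewrite big_cons.
rewrite RintegralD//; last exact: integrable_bigsum.
by rewrite ih big_cons.
Qed.

End Rintegral_finite_sums.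

Section simple_processes.
Context (R : realType) (dim : nat) (disp : measure_display)
  (T : measurableType disp) (P : probability T R).
Variables (F : R -> set (set T)) (B : R -> T -> 'cV[R]_dim).
Hypothesis hF : is_filtration F.
Hypothesis hB : brownian_motion P F B.
Local Notation incr := (incr B).

Let sF s : 0 <= s -> sigma_algebra [set: T] (F s).
Proof. by case: hF => h _ _; exact: h. Qed.

(** The process equal to [pvalue] in the coordinate [pcoord] during [[pstart,
    pstop[].  A simple process is a finite family of pieces whose time intervals may
    overlap: this makes sums, differences and restrictions of elementary processes
    simple processes again, with no refinement of subdivisions. *)
Record piece : Type := Piece {
  pstart : R; pstop : R; pcoord : 'I_dim; pvalue : T -> R }.
Implicit Types p q : piece.

Definition admissible p : Prop :=
  [/\ 0 <= pstart p, pstart p <= pstop p,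
      measurable_in (F (pstart p)) (pvalue p)
    & exists M, forall w, `|pvalue p w| <= M].

Definition piece_int p : T -> R :=
  fun w => pvalue p w * incr (pstart p) (pstop p) (pcoord p) w.

Definition piece_ind p (s : R) : R := (nat_of_bool (pstart p <= s < pstop p)%R)%:R.

Definition piece_proc p (s : R) (w : T) (j : 'I_dim) : R :=
  pvalue p w * piece_ind p s * (j == pcoord p)%:R.

(** The length of the common time interval of the two pieces. *)
Definition overlap p q : R :=
  Num.max 0 (Num.min (pstop p) (pstop q) - Num.max (pstart p) (pstart q)).

Lemma pvalue_sq_integrable p : admissible p -> sq_integrable P (pvalue p).
Proof.
move=> [a0 ab ma [M Mp]]; apply: sq_integrable_bounded Mp.
exact: (filtration_measurable hF a0).
Qed.

Lemma piece_int_sq_integrable p : admissible p -> sq_integrable P (piece_int p).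
Proof.
move=> [a0 ab ma [M Mp]]; apply: sq_integrable_mul_bounded Mp.
  exact: (incr_sq_integrable hF hB).
exact: (filtration_measurable hF a0).
Qed.

Lemma piece_int_measurable_in p : admissible p -> measurable_in (F (pstop p)) (piece_int p).
Proof.
move=> [a0 ab ma _]; apply: (measurable_in_mul (sF (le_trans a0 ab))).
  exact: (filtration_le hF a0 ab).
exact: (incr_measurable_in hF hB).
Qed.

(** Times the value of the piece, the factor is still known when the piece starts,
    so [incr_mul] applies. *)
Lemma piece_int_orthogonal_past p u (Z : T -> R) : admissible p -> 0 <= u ->
  u <= pstart p -> measurable_in (F u) Z -> sq_integrable P Z ->
  \int[P]_w (Z w * piece_int p w) = 0.
Proof.
move=> ap u0 ua mZ sZ; have [a0 ab ma _] := ap.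
have mY : measurable_in (F (pstart p)) (fun w => Z w * pvalue p w).
  by apply: (measurable_in_mul (sF a0)) => //; exact: (filtration_le hF u0 ua).
have IY := sq_integrable_mul sZ (pvalue_sq_integrable ap).
have [_ <-] := incr_mul hF hB a0 ab mY IY (pcoord p).
by apply: eq_Rintegral => w _; rewrite mulrA.
Qed.

(** Of the piece that starts first, the part preceding the other piece is orthogonal
    to the latter.  What remains are two increments with a common start, for which
    [incr_mul_common_start] gives the overlap. *)
Lemma piece_int_mul p q : admissible p -> admissible q ->
  \int[P]_w (piece_int p w * piece_int q w) =
  (pcoord p == pcoord q)%:R * overlap p q * \int[P]_w (pvalue p w * pvalue q w).
Proof.
wlog pq : p q / pstart p <= pstart q.
  move=> hw ap aq; have /orP[pq|qp] := le_total (pstart p) (pstart q).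
    exact: hw.
  under eq_Rintegral do rewrite mulrC.
  rewrite hw// eq_sym /overlap minC (maxC (pstart q)); congr (_ * _).
  by apply: eq_Rintegral => w _; rewrite mulrC.
move=> ap aq; rewrite /overlap (max_r pq).
have [a0 ab ma _] := ap; have [c0 ce mc _] := aq.
have [bc|/ltW cb] := leP (pstop p) (pstart q).
  rewrite max_l; last by rewrite subr_le0 ge_min bc.
  rewrite mulr0 mul0r; apply: (piece_int_orthogonal_past aq _ bc).
  - exact: le_trans a0 ab.
  - exact: piece_int_measurable_in.
  - exact: piece_int_sq_integrable.
rewrite max_r; last by rewrite subr_ge0 le_min cb.
have smm := sq_integrable_mul (pvalue_sq_integrable ap) (pvalue_sq_integrable aq).
have mm : measurable_in (F (pstart q)) (fun w => pvalue p w * pvalue q w).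
  by apply: (measurable_in_mul (sF c0)) => //; exact: (filtration_le hF a0 pq).
have [I2 E2] := incr_mul_common_start hF hB (pcoord p) (pcoord q) c0 cb ce mm smm.
pose p1 := Piece (pstart p) (pstart q) (pcoord p) (pvalue p).
have ap1 : admissible p1 by case: ap.
have E1 : \int[P]_w (piece_int p1 w * piece_int q w) = 0.
  apply: (piece_int_orthogonal_past aq c0 (lexx _)).
  - exact: (piece_int_measurable_in ap1).
  - exact: piece_int_sq_integrable.
have I1 := sq_integrable_mul (piece_int_sq_integrable ap1) (piece_int_sq_integrable aq).
rewrite -E2 -[RHS]add0r -E1 -RintegralD//; apply: eq_Rintegral => w _.
by rewrite /piece_int /= (incr_split _ _ (pstart q)); ring.
Qed.

Section families.
Variables (I : finType) (pc : I -> piece).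
Hypothesis apc : forall i, admissible (pc i).

Definition simple_int (w : T) : R := \sum_i piece_int (pc i) w.

Definition simple_proc (s : R) (w : T) (j : 'I_dim) : R := \sum_i piece_proc (pc i) s w j.

(** The isometry holds because both the square of the integral and the time integral
    of the squared process have the expectation of this Gram sum. *)
Definition simple_gram (w : T) : R := \sum_i \sum_j
  (pcoord (pc i) == pcoord (pc j))%:R * overlap (pc i) (pc j) *
  (pvalue (pc i) w * pvalue (pc j) w).

Lemma simple_int_sq_integrable : sq_integrable P simple_int.
Proof. by apply: sq_integrable_sum => i; exact: piece_int_sq_integrable. Qed.

Let integrable_gram_term i j (c : R) :
  P.-integrable [set: T] (EFin \o (fun w => c * (pvalue (pc i) w * pvalue (pc j) w))).
Proof.
apply: integrable_scale; apply: sq_integrable_mul; exact: pvalue_sq_integrable.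
Qed.

Lemma integrable_simple_gram : P.-integrable [set: T] (EFin \o simple_gram).
Proof.
rewrite /simple_gram; apply: integrable_bigsum => // i.
by apply: integrable_bigsum => // j.
Qed.

(** Expanding the square reduces the claim to [piece_int_mul]. *)
Lemma simple_int_gram : \int[P]_w (simple_int w ^+ 2) = \int[P]_w simple_gram w.
Proof.
have Im i j := sq_integrable_mul (piece_int_sq_integrable (apc i)) (piece_int_sq_integrable (apc j)).
transitivity (\int[P]_w (\sum_i \sum_j (piece_int (pc i) w * piece_int (pc j) w))).
  apply: eq_Rintegral => w _; rewrite expr2 /simple_int big_distrl /=.
  by apply: eq_bigr => i _; rewrite big_distrr.
rewrite /simple_gram !Rintegral_bigsum//; last 2 first.
- by move=> i; apply: integrable_bigsum.
- by move=> i; apply: integrable_bigsum.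
apply: eq_bigr => i _; rewrite !Rintegral_bigsum//.
apply: eq_bigr => j _; rewrite piece_int_mul// RintegralZl//.
by apply: sq_integrable_mul; exact: pvalue_sq_integrable.
Qed.

Section time_integral.
Variables (u v : R).
Hypothesis pu : forall i, u <= pstart (pc i).
Hypothesis pv : forall i, pstop (pc i) <= v.

Let piece_ind_mul i j s : piece_ind (pc i) s * piece_ind (pc j) s =
  \1_`[Num.max (pstart (pc i)) (pstart (pc j)),
       Num.min (pstop (pc i)) (pstop (pc j))[ s.
Proof.
rewrite indicE mem_setE in_itv/= ge_max lt_min /piece_ind -natrM mulnb; congr (_%:R).
by congr nat_of_bool; rewrite -!andbA; congr (_ && _); rewrite andbCA.
Qed.

Lemma integral_piece_ind_mul i j :
  lebesgue_measure.-integrable `[u, v] (EFin \o (fun s => piece_ind (pc i) s * piece_ind (pc j) s)) /\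
  \int[lebesgue_measure]_(s in `[u, v]) (piece_ind (pc i) s * piece_ind (pc j) s) =
  overlap (pc i) (pc j).
Proof.
set a := Num.max (pstart (pc i)) (pstart (pc j)).
set b := Num.min (pstop (pc i)) (pstop (pc j)).
have -> : (fun s => piece_ind (pc i) s * piece_ind (pc j) s) = \1_`[a, b[.
  by apply/funext => s; exact: piece_ind_mul.
split.
  apply: (integrableS measurableT) => //.
  exact: integrable_indic_itv.
rewrite /Rintegral integral_indic//.
rewrite setIidl; last first.
  move=> s /=; rewrite !in_itv/= => /andP[as_ sb]; apply/andP; split.
    by apply: le_trans as_; rewrite le_max pu.
  by apply: ltW (lt_le_trans sb _); rewrite ge_min pv.
rewrite /= lebesgue_measure_itv/= lte_fin /overlap -/a -/b.
case: ifPn => [ab|]; first by rewrite -EFinB/= max_r// subr_ge0 ltW.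
by rewrite -leNgt => ba; rewrite max_l// subr_le0.
Qed.

Lemma simple_proc_sqr s w : \sum_j simple_proc s w j ^+ 2 =
  \sum_i \sum_j (pcoord (pc i) == pcoord (pc j))%:R *
    (pvalue (pc i) w * pvalue (pc j) w) * (piece_ind (pc i) s * piece_ind (pc j) s).
Proof.
transitivity (\sum_k \sum_i \sum_j piece_proc (pc i) s w k * piece_proc (pc j) s w k).
  apply: eq_bigr => k _; rewrite expr2 /simple_proc big_distrl /=.
  by apply: eq_bigr => i _; rewrite big_distrr.
rewrite exchange_big/=; apply: eq_bigr => i _.
rewrite exchange_big/=; apply: eq_bigr => j _.
rewrite (bigD1 (pcoord (pc i)))//= big1 ?addr0; last first.
  by move=> k /negbTE ki; rewrite /piece_proc ki mulr0 mul0r.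
by rewrite /piece_proc eqxx /=; ring.
Qed.

Lemma simple_proc_gram w :
  \int[lebesgue_measure]_(s in `[u, v]) (\sum_j simple_proc s w j ^+ 2) = simple_gram w /\
  lebesgue_measure.-integrable `[u, v] (EFin \o (fun s => \sum_j simple_proc s w j ^+ 2)).
Proof.
under [X in \int[_]_(s in _) X s]eq_fun do rewrite simple_proc_sqr.
under [X in EFin \o X]eq_fun do rewrite simple_proc_sqr.
have It i j : lebesgue_measure.-integrable `[u, v] (EFin \o (fun s =>
    (pcoord (pc i) == pcoord (pc j))%:R *
    (pvalue (pc i) w * pvalue (pc j) w) * (piece_ind (pc i) s * piece_ind (pc j) s))).
  have := integrableZl (measurable_segment u v) ((pcoord (pc i) == pcoord (pc j))%:R *
    (pvalue (pc i) w * pvalue (pc j) w)) (integral_piece_ind_mul i j).1.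
  exact.
have mitv := measurable_segment u v.
split.
  rewrite Rintegral_bigsum//; last by move=> i; exact: integrable_bigsum.
  apply: eq_bigr => i _; rewrite Rintegral_bigsum//.
  apply: eq_bigr => j _; rewrite RintegralZl//; last exact: (integral_piece_ind_mul i j).1.
  by rewrite (integral_piece_ind_mul i j).2; ring.
by apply: integrable_bigsum => // i; exact: integrable_bigsum.
Qed.

(** The Ito isometry for simple processes; the time window [[u, v]] is any interval
    containing all the pieces. *)
Theorem simple_isometry :
  (\int[P]_w (simple_int w ^+ 2)%:E =
   \int[P]_w \int[lebesgue_measure]_(s in `[u, v])
     (\sum_j simple_proc s w j ^+ 2)%:E)%E.
Proof.
rewrite -EFin_Rintegral//; last by case: simple_int_sq_integrable.
rewrite simple_int_gram EFin_Rintegral//; last exact: integrable_simple_gram.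
apply: eq_integral => w _; have [<- h] := simple_proc_gram w.
by rewrite EFin_Rintegral.
Qed.

End time_integral.

Lemma simple_int_orthogonal u (Z : T -> R) : 0 <= u ->
  (forall i, u <= pstart (pc i)) -> measurable_in (F u) Z -> sq_integrable P Z ->
  \int[P]_w (Z w * simple_int w) = 0.
Proof.
move=> u0 pu mZ sZ.
have -> : (fun w => Z w * simple_int w) = (fun w => \sum_i Z w * piece_int (pc i) w).
  by apply/funext => w; rewrite /simple_int big_distrr.
rewrite Rintegral_bigsum//; last first.
  by move=> i; apply: sq_integrable_mul => //; exact: piece_int_sq_integrable.
by rewrite big1// => i _; exact: (piece_int_orthogonal_past (apc i) u0).
Qed.

End families.
End simple_processes.

(** * Integrals over time and the probability space *)

Section time_omega_integrals.
Context (R : realType) (disp : measure_display) (T : measurableType disp)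
  (P : probability T R).
Implicit Types (D : set R) (f g : R -> T -> R).

Definition jointly_measurable D f : Prop :=
  measurable_fun (D `*` [set: T]) (fun z : R * T => f z.1 z.2).

(** The expectation is outside, as in the definition of the stochastic integral. *)
Definition dint D f : \bar R :=
  (\int[P]_w \int[lebesgue_measure]_(s in D) (f s w)%:E)%E.

Variable D : set R.
Hypothesis mD : measurable D.

Let mD' : @measurable _ (measurableTypeR R) D.
Proof. exact: mD. Qed.

Lemma jointly_measurable_section f w : jointly_measurable D f ->
  measurable_fun (D : set (measurableTypeR R)) (fun s => f s w).
Proof.
move=> mf; have mDT : measurable (D `*` [set: T]) by exact: measurableX.
apply: (@measurable_comp _ _ _ _ _ _ (D `*` [set: T]) (fun z : R * T => f z.1 z.2)
  D (fun s => (s, w))) => //.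
- by move=> _ [s Ds <-].
- apply: measurable_funTS; apply: measurable_fun_pair.
    exact: measurable_id.
  exact: measurable_cst.
Qed.

Let restricted f (z : measurableTypeR R * T) : \bar R :=
  (((fun z : R * T => f z.1 z.2) \_ (D `*` [set: T])) z)%:E.

Let restricted_section f w :
  (\int[lebesgue_measure]_(s in D) (f s w)%:E =
   \int[lebesgue_measure]_s restricted f (s, w))%E.
Proof.
rewrite integral_mkcond; apply: eq_integral => s _; rewrite /restricted !patchE.
have -> : ((s, w) \in D `*` [set: T]) = (s \in D).
  by apply/idP/idP; rewrite !inE //= => -[].
by case: ifP.
Qed.

Let measurable_restricted f : jointly_measurable D f ->
  measurable_fun [set: measurableTypeR R * T] (restricted f).
Proof.
move=> mf; have mDT : measurable (D `*` [set: T]) by exact: measurableX.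
by apply/measurable_EFinP; exact: ((measurable_restrictT _ mDT).1 mf).
Qed.

Lemma measurable_time_integral f : jointly_measurable D f ->
  (forall s w, 0 <= f s w) ->
  measurable_fun [set: T] (fun w => \int[lebesgue_measure]_(s in D) (f s w)%:E)%E.
Proof.
move=> mf f0; under eq_fun do rewrite restricted_section.
apply: (measurable_fun_fubini_tonelli_G (m1 := lebesgue_measure) (restricted f)).
  exact: measurable_restricted.
by move=> z; rewrite /restricted lee_fin patchE; case: ifP.
Qed.

Lemma dint_le_cst f (c : R) : jointly_measurable D f -> (forall s w, 0 <= f s w) ->
  0 <= c -> (forall s, D s -> \int[P]_w (f s w)%:E <= c%:E)%E ->
  (dint D f <= c%:E * lebesgue_measure D)%E.
Proof.
move=> mf f0 c0 hc; rewrite -integral_cst// [leRHS]integral_mkcond /dint.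
under [leLHS]eq_integral do rewrite restricted_section.
have mr := measurable_restricted mf.
have r0 z : (0 <= restricted f z)%E.
  by rewrite /restricted lee_fin patchE; case: ifP.
rewrite -(@fubini_tonelli _ _ _ _ _ lebesgue_measure P (restricted f))//.
apply: ge0_le_integral => //.
- by move=> s _; apply: integral_ge0.
- exact: (measurable_fun_fubini_tonelli_F (restricted f)).
- apply: ((measurable_restrictT _ mD').1 _); exact: measurable_cst.
move=> s _; rewrite patchE; case: ifPn => Ds.
  rewrite inE in Ds; apply: le_trans (hc s Ds).
  rewrite le_eqVlt; apply/orP; left; apply/eqP; apply: eq_integral => w _.
  by rewrite /restricted patchE ifT// inE.
rewrite integral0_eq// => w _; rewrite /restricted patchE.
by case: ifPn => //; rewrite inE => -[/= Ds']; rewrite notin_setE in Ds.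
Qed.

Lemma dint_ge0 f : (forall s w, 0 <= f s w) -> (0 <= dint D f)%E.
Proof.
move=> f0; apply: integral_ge0 => w _; apply: integral_ge0 => s _.
by rewrite lee_fin.
Qed.

Lemma le_dint f g : jointly_measurable D f -> jointly_measurable D g ->
  (forall s w, 0 <= f s w) -> (forall s w, D s -> f s w <= g s w) ->
  (forall s w, 0 <= g s w) ->
  (dint D f <= dint D g)%E.
Proof.
move=> mf mg f0 fg g0; apply: ge0_le_integral => //.
- by move=> w _; apply: integral_ge0 => s _; rewrite lee_fin.
- exact: measurable_time_integral.
- exact: measurable_time_integral.
move=> w _; apply: ge0_le_integral => //.
- by move=> s _; rewrite lee_fin.
- by apply/measurable_EFinP; exact: jointly_measurable_section.
- by apply/measurable_EFinP; exact: jointly_measurable_section.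
- by move=> s Ds; rewrite lee_fin; exact: fg.
Qed.

Lemma dintD f g : jointly_measurable D f -> jointly_measurable D g ->
  (forall s w, 0 <= f s w) -> (forall s w, 0 <= g s w) ->
  (dint D (fun s w => f s w + g s w)%R = dint D f + dint D g)%E.
Proof.
move=> mf mg f0 g0; rewrite /dint -ge0_integralD//; last 4 first.
- by move=> w _; apply: integral_ge0 => s _; rewrite lee_fin.
- exact: measurable_time_integral.
- by move=> w _; apply: integral_ge0 => s _; rewrite lee_fin.
- exact: measurable_time_integral.
apply: eq_integral => w _; under eq_integral do rewrite EFinD.
rewrite ge0_integralD//.
- by move=> s _; rewrite lee_fin.
- by apply/measurable_EFinP; exact: jointly_measurable_section.
- by move=> s _; rewrite lee_fin.
- by apply/measurable_EFinP; exact: jointly_measurable_section.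
Qed.

Lemma dintZ (c : R) f : 0 <= c -> jointly_measurable D f ->
  (forall s w, 0 <= f s w) ->
  (dint D (fun s w => c * f s w)%R = c%:E * dint D f)%E.
Proof.
move=> c0 mf f0; rewrite /dint -ge0_integralZl_EFin; last 4 first.
- exact: measurableT.
- by move=> w _; apply: integral_ge0 => s _; rewrite lee_fin.
- exact: measurable_time_integral.
- exact: c0.
apply: eq_integral => w _; under eq_integral do rewrite EFinM.
rewrite ge0_integralZl_EFin//.
- by move=> s _; rewrite lee_fin.
- by apply/measurable_EFinP; exact: jointly_measurable_section.
Qed.

Lemma jointly_measurableD f g : jointly_measurable D f -> jointly_measurable D g ->
  jointly_measurable D (fun s w => f s w + g s w).
Proof. by move=> mf mg; exact: measurable_funD. Qed.

Lemma jointly_measurableB f g : jointly_measurable D f -> jointly_measurable D g ->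
  jointly_measurable D (fun s w => f s w - g s w).
Proof. by move=> mf mg; exact: measurable_funB. Qed.

Lemma jointly_measurableM f g : jointly_measurable D f -> jointly_measurable D g ->
  jointly_measurable D (fun s w => f s w * g s w).
Proof. by move=> mf mg; exact: measurable_funM. Qed.

Lemma jointly_measurableZ (c : R) f : jointly_measurable D f ->
  jointly_measurable D (fun s w => c * f s w).
Proof. by move=> mf; exact: measurable_funM. Qed.

Lemma jointly_measurableX n f : jointly_measurable D f ->
  jointly_measurable D (fun s w => f s w ^+ n).
Proof. by move=> mf; exact: measurable_funX. Qed.

Lemma jointly_measurable_sum (I : Type) (s : seq I) (f : I -> R -> T -> R) :
  (forall i, jointly_measurable D (f i)) ->
  jointly_measurable D (fun r w => \sum_(i <- s) f i r w).
Proof. by move=> mf; apply: measurable_sum => i; exact: mf. Qed.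

Lemma jointly_measurable_time (g : R -> R) : measurable_fun [set: R] g ->
  jointly_measurable D (fun s _ => g s).
Proof.
move=> mg; apply: measurable_funTS.
exact: (measurableT_comp mg measurable_fst).
Qed.

Lemma jointly_measurable_omega (g : T -> R) : measurable_fun [set: T] g ->
  jointly_measurable D (fun _ w => g w).
Proof.
move=> mg; apply: measurable_funTS.
exact: (measurableT_comp mg measurable_snd).
Qed.

End time_omega_integrals.

Lemma jointly_measurableS (R : realType) (disp : measure_display)
    (T : measurableType disp) (D D' : set R) (f : R -> T -> R) :
  measurable D' -> D `<=` D' -> jointly_measurable D' f -> jointly_measurable D f.
Proof.
move=> mD' DD' mf; apply: measurable_funS mf; first exact: measurableX.
by move=> z [/= Dz _]; split => //; exact: DD'.
Qed.

Lemma dint_subset (R : realType) (disp : measure_display)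
    (T : measurableType disp) (P : probability T R) (D D' : set R) (f : R -> T -> R) :
  measurable D -> measurable D' -> D `<=` D' -> jointly_measurable D' f ->
  (forall s w, 0 <= f s w) -> (dint P D f <= dint P D' f)%E.
Proof.
move=> mD mD' DD' mf f0; apply: ge0_le_integral => //.
- by move=> w _; apply: integral_ge0 => s _; rewrite lee_fin.
- by apply: measurable_time_integral => //; exact: jointly_measurableS mf.
- exact: measurable_time_integral.
move=> w _; apply: ge0_subset_integral => //.
- by apply/measurable_EFinP; exact: jointly_measurable_section.
- by move=> s _; rewrite lee_fin.
Qed.

(** Time is replaced by its positive part before applying
    [measurable_fun_caratheodory], because the process is only known to be
    measurable at nonnegative times. *)
Lemma jointly_measurable_continuous (R : realType) (disp : measure_display)
    (T : measurableType disp) (u v : R) (f : R -> T -> R) : 0 <= u ->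
  (forall s, 0 <= s -> measurable_fun [set: T] (f s)) ->
  (forall w, continuous (f ^~ w)) -> jointly_measurable `[u, v] f.
Proof.
move=> u0 mf cf.
have mext : measurable_fun [set: R * T] (fun z : R * T => f (Num.max z.1 0) z.2).
  apply: (@measurable_fun_caratheodory _ _ _ (fun s w => f (Num.max s 0) w)).
    by move=> s; apply: mf; rewrite le_max lexx orbT.
  move=> w s; apply: (@cvg_comp _ _ _ (fun s : R => Num.max s 0) (f ^~ w)).
    exact: continuous_maxr0.
  exact: cf.
apply: (@eq_measurable_fun _ _ _ _ _ (fun z : R * T => f (Num.max z.1 0) z.2)).
  move=> [s w]; rewrite inE /= => -[]; rewrite in_itv/= => /andP[us _] _.
  by rewrite max_l// (le_trans u0).
exact: measurable_funTS.
Qed.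

(** * Restricting elementary processes to a time interval *)

Lemma enorm_sqr (R : realType) m n (A : 'M[R]_(m, n)) :
  enorm A ^+ 2 = \sum_i \sum_j A i j ^+ 2.
Proof.
by rewrite sqr_sqrtr// sumr_ge0// => i _; rewrite sumr_ge0// => j _; exact: sqr_ge0.
Qed.

Lemma row_sqr_le_enorm (R : realType) m n (A : 'M[R]_(m, n)) i :
  \sum_j A i j ^+ 2 <= enorm A ^+ 2.
Proof.
rewrite enorm_sqr (bigD1 i)//= lerDl sumr_ge0// => k _.
by rewrite sumr_ge0// => j _; exact: sqr_ge0.
Qed.

Lemma entry_sqr_le_enorm (R : realType) m n (A : 'M[R]_(m, n)) i j :
  A i j ^+ 2 <= enorm A ^+ 2.
Proof.
apply: le_trans (row_sqr_le_enorm A i).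
by rewrite (bigD1 j)//= lerDl sumr_ge0// => k _; exact: sqr_ge0.
Qed.

Section clamp.
Context {R : realType}.
Implicit Types a b c s x y : R.

(** Clamping the end points of an interval to [[a, b]] intersects the interval with
    [[a, b]]; an interval outside [[a, b]] becomes empty. *)
Definition clamp a b x : R := Num.min (Num.max x a) b.

Lemma clamp_ge a b x : a <= b -> a <= clamp a b x.
Proof. by move=> ab; rewrite /clamp le_min ab le_max lexx orbT. Qed.

Lemma clamp_le a b x : clamp a b x <= b.
Proof. by rewrite /clamp ge_min lexx orbT. Qed.

Lemma clamp_mono a b x y : x <= y -> clamp a b x <= clamp a b y.
Proof.
move=> xy; rewrite /clamp le_min !ge_min lexx orbT andbT.
by rewrite ge_max !le_max xy lexx !orbT.
Qed.

Lemma clamp_id a b x : a <= x -> x <= b -> clamp a b x = x.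
Proof. by move=> ax xb; rewrite /clamp max_l// min_l. Qed.

Lemma clamp_above a b x : a <= b -> b <= x -> clamp a b x = b.
Proof. by move=> ab bx; rewrite /clamp min_r// le_max bx. Qed.

Lemma clamp_itv a b x y s : a <= s -> s < b ->
  (clamp a b x <= s < clamp a b y) = (x <= s < y).
Proof.
move=> as_ sb; rewrite /clamp ge_min ge_max lt_min lt_max as_ sb.
by rewrite (leNgt b) sb (ltNge s a) as_ /= orbF andbT orbF andbT.
Qed.

Lemma clamp_itv_out a b x y s : a <= b -> ~~ (a <= s < b) ->
  (clamp a b x <= s < clamp a b y) = false.
Proof.
move=> ab; apply: contraNF => /andP[xs sy].
by rewrite (le_trans (clamp_ge x ab) xs) (lt_le_trans sy)// clamp_le.
Qed.

(** Additivity of increments over adjacent windows. *)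
Lemma clamp_chasles (V : zmodType) (f : R -> V) a b c x : a <= b -> b <= c ->
  f (clamp a b x) + f (clamp b c x) = f (clamp a c x) + f b.
Proof.
move=> ab bc; have [xb|/ltW bx] := leP x b.
  rewrite /clamp (max_r xb) (min_l bc) !min_l// ge_max.
    by rewrite (le_trans xb bc) (le_trans ab bc).
  by rewrite xb ab.
by rewrite (clamp_above ab bx) addrC /clamp (max_l bx) (max_l (le_trans ab bx)).
Qed.

End clamp.

Section clipped_elementary.
Context (R : realType) (dim : nat) (disp : measure_display)
  (T : measurableType disp) (P : probability T R).
Variables (F : R -> set (set T)) (B : R -> T -> 'cV[R]_dim).
Hypothesis hF : is_filtration F.
Hypothesis hB : brownian_motion P F B.
Variables (t : R) (phi : elementary (R := R) (d := dim) (T := T)).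
Hypothesis ephi : elementary_on F t phi.
Variable r : 'I_dim.

Let sF s : 0 <= s -> sigma_algebra [set: T] (F s).
Proof. by case: hF => h _ _; exact: h. Qed.

Lemma etime_ge0 k : (k <= esize phi)%N -> 0 <= etime phi k.
Proof.
case: ephi => -[t0 _] mono _ _; elim: k => [|k ih] kn; first by rewrite t0.
by rewrite (le_trans (ih (ltnW kn)))// mono.
Qed.

Lemma etime_le k : (k <= esize phi)%N -> etime phi k <= t.
Proof.
move=> kn; have [[_ tn] mono _ _] := ephi.
have H m : (k + m <= esize phi)%N -> etime phi k <= etime phi (k + m).
  elim: m => [|m ih]; first by rewrite addn0.
  by rewrite addnS => km; rewrite (le_trans (ih (ltnW km)))// mono.
by have := H (esize phi - k)%N; rewrite subnKC// tn; exact.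
Qed.

(** The [r]-th row of the elementary process, restricted to the time window [[a,
    b]].  The value is replaced by [0] when its interval starts after [b], since the
    clamped piece would start at [b], when that value is not yet known. *)
Definition clip (a b : R) (i : 'I_(esize phi) * 'I_dim) : piece R dim T :=
  Piece (clamp a b (etime phi i.1)) (clamp a b (etime phi i.1.+1)) i.2
    (fun w => if etime phi i.1 <= b then evalue phi i.1 w r i.2 else 0).

Lemma clip_admissible a b i : 0 <= a -> a <= b -> admissible F (clip a b i).
Proof.
move=> a0 ab; have [_ mono mval [M Mval]] := ephi.
case: i => k j; have kn := ltn_ord k; rewrite /clip.
have tk0 := etime_ge0 (ltnW kn).
split => /=.
- by rewrite (le_trans a0)// clamp_ge.
- by apply: clamp_mono; exact: mono.
- have [tb|tb] := boolP (etime phi k <= b); last first.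
    have s0 : 0 <= clamp a b (etime phi k) by rewrite (le_trans a0)// clamp_ge.
    exact: (measurable_in_cst (sF s0) 0).
  apply: (filtration_le hF tk0); first by rewrite /clamp le_min tb le_max lexx.
  by move=> U mU; exact: (mval _ kn r j U mU).
- exists M => w; have M0 := le_trans (sqrtr_ge0 _) (Mval k w kn).
  case: ifP => _; last by rewrite normr0.
  apply: le_trans (Mval k w kn).
  rewrite -ler_sqr ?nnegrE ?normr_ge0 ?sqrtr_ge0// real_normK ?num_real//.
  exact: entry_sqr_le_enorm.
Qed.

Lemma clip_piece_int a b i w : a <= b -> piece_int B (clip a b i) w =
  evalue phi i.1 w r i.2 *
  incr B (clamp a b (etime phi i.1)) (clamp a b (etime phi i.1.+1)) i.2 w.
Proof.
move=> ab; have [_ mono _ _] := ephi.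
rewrite /piece_int/=; case: ifPn => //; rewrite -ltNge => /ltW bt.
rewrite (clamp_above ab bt) clamp_above//; first by rewrite /incr subrr !mulr0.
by rewrite (le_trans bt)// mono.
Qed.

(** This allows the integral over [[a, c]] to be cut at [b], which may fall inside
    an interval of the elementary process. *)
Lemma clip_int_chasles a b c w : a <= b -> b <= c ->
  simple_int B (clip a b) w + simple_int B (clip b c) w = simple_int B (clip a c) w.
Proof.
move=> ab bc; rewrite /simple_int -big_split; apply: eq_bigr => i _ /=.
rewrite !clip_piece_int// ?(le_trans ab bc)// -mulrDr; congr (_ * _).
have h x := clamp_chasles (fun s => B s w i.2 0) x ab bc.
have := h (etime phi i.1); have := h (etime phi i.1.+1); rewrite /incr; lra.
Qed.

Lemma clip_int_full w : simple_int B (clip 0 t) w = elementary_integral B phi w r 0.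
Proof.
have [[t0 tt] mono _ _] := ephi.
have tpos : 0 <= t by rewrite -tt etime_ge0.
rewrite /simple_int /elementary_integral summxE.
rewrite -(pair_bigA _ (fun k j => piece_int B (clip 0 t (k, j)) w)) /=.
apply: eq_bigr => k _; rewrite mxE; apply: eq_bigr => j _.
have kn := ltn_ord k.
rewrite clip_piece_int//= !mxE; congr (_ * _).
rewrite /incr !clamp_id//; do ?[exact: etime_ge0|exact: etime_le].
  by apply: etime_ge0; exact: ltnW.
by apply: etime_le; exact: ltnW.
Qed.

Lemma clip_proc a b s w j : a <= b -> simple_proc (clip a b) s w j =
  if a <= s < b then elementary_process phi s w r j else 0.
Proof.
move=> ab; rewrite /simple_proc /elementary_process summxE.
rewrite -(pair_bigA _ (fun k l => piece_proc (clip a b (k, l)) s w j)) /=.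
have out : ~~ (a <= s < b) -> \sum_k \sum_l piece_proc (clip a b (k, l)) s w j = 0.
  move=> sab; rewrite big1// => k _; rewrite big1// => l _.
  by rewrite /piece_proc /piece_ind /= clamp_itv_out// mulr0 mul0r.
case: ifPn => [/andP[as_ sb]|/out ->]; last by [].
apply: eq_bigr => k _; rewrite (bigD1 j)//= big1 ?addr0; last first.
  by move=> l lj; rewrite /piece_proc/= eq_sym (negbTE lj) mulr0.
rewrite /piece_proc /piece_ind /= eqxx mulr1 clamp_itv//.
case: ifPn => tb; case: ifPn => [/andP[ts st]|_]; rewrite ?mulr1 ?mulr0 ?mxE//.
by rewrite (le_trans ts (ltW sb)) in tb.
Qed.

End clipped_elementary.

Arguments clip {R dim disp T} phi r a b i.

(** * Approximating the increments of a stochastic integral *)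

Section mean_square.
Context d (T : measurableType d) (R : realType) (P : probability T R).
Implicit Types f g : T -> R.

Definition msq f : \bar R := (\int[P]_w (f w ^+ 2)%:E)%E.

Lemma msq_ge0 f : (0 <= msq f)%E.
Proof. by apply: integral_ge0 => w _; rewrite lee_fin sqr_ge0. Qed.

(** Young's inequality for the cross term.  As [e] tends to [0], the coefficient of
    the main term tends to [1], which keeps the constants sharp. *)
Lemma young_sqr (e x y : R) : 0 < e ->
  (x + y) ^+ 2 <= (1 + e) * x ^+ 2 + (1 + e^-1) * y ^+ 2.
Proof.
move=> e0; have : 0 <= (Num.sqrt e * x - (Num.sqrt e)^-1 * y) ^+ 2 by exact: sqr_ge0.
have se : Num.sqrt e ^+ 2 = e by rewrite sqr_sqrtr// ltW.
have se0 : Num.sqrt e != 0 by rewrite gt_eqF// sqrtr_gt0.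
have -> : (Num.sqrt e * x - (Num.sqrt e)^-1 * y) ^+ 2 =
    Num.sqrt e ^+ 2 * x ^+ 2 - 2 * x * y + (Num.sqrt e ^+ 2)^-1 * y ^+ 2.
  by field.
rewrite se; lra.
Qed.

Lemma msq_young (e : R) f g : 0 < e ->
  measurable_fun [set: T] f -> measurable_fun [set: T] g ->
  (msq (fun w => f w + g w)%R <= (1 + e)%:E * msq f + (1 + e^-1)%:E * msq g)%E.
Proof.
move=> e0 mf mg.
have c1 : 0 <= 1 + e by rewrite addr_ge0// ltW.
have c2 : 0 <= 1 + e^-1 by rewrite addr_ge0// invr_ge0 ltW.
have mX (k : T -> R) : measurable_fun [set: T] k ->
    measurable_fun [set: T] (fun w => (k w ^+ 2)%:E).
  by move=> mk; apply/measurable_EFinP; exact: measurable_funX.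
rewrite /msq -!ge0_integralZl_EFin//; do ?[by move=> w _; rewrite lee_fin sqr_ge0|exact: mX].
rewrite -ge0_integralD//; last 4 first.
- by move=> w _; rewrite -EFinM lee_fin mulr_ge0 ?sqr_ge0.
- by apply: measurable_funeM; exact: mX.
- by move=> w _; rewrite -EFinM lee_fin mulr_ge0 ?sqr_ge0.
- by apply: measurable_funeM; exact: mX.
apply: ge0_le_integral => //.
- by move=> w _; rewrite lee_fin sqr_ge0.
- by apply: mX; exact: measurable_funD.
- by apply: emeasurable_funD; apply: measurable_funeM; exact: mX.
- by move=> w _; rewrite -!EFinM -EFinD lee_fin; exact: young_sqr.
Qed.

Lemma msqN f : msq (fun w => - f w)%R = msq f.
Proof. by apply: eq_integral => w _; rewrite sqrrN. Qed.

Lemma msq_add2 f g (a b : R) :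
  measurable_fun [set: T] f -> measurable_fun [set: T] g ->
  (msq f <= a%:E)%E -> (msq g <= b%:E)%E ->
  (msq (fun w => f w + g w)%R <= (2 * a + 2 * b)%:E)%E.
Proof.
move=> mf mg fa gb; apply: le_trans (msq_young (@ltr01 R) mf mg) _.
rewrite invr1 (EFinD (2 * a)) (EFinM 2 a) (EFinM 2 b).
by apply: leeD; apply: lee_wpmul2l => //; rewrite lee_fin.
Qed.

End mean_square.

Lemma jointly_measurable_enorm_sqr (R : realType) (disp : measure_display)
    (T : measurableType disp) m n (D : set R) (A : R -> T -> 'M[R]_(m, n)) :
  measurable D -> (forall i j, jointly_measurable D (fun s w => A s w i j)) ->
  jointly_measurable D (fun s w => enorm (A s w) ^+ 2).
Proof.
move=> mD mA.
have -> : (fun s w => enorm (A s w) ^+ 2) = (fun s w => \sum_i \sum_j A s w i j ^+ 2).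
  by apply/funext => s; apply/funext => w; exact: enorm_sqr.
apply: jointly_measurable_sum => i; apply: jointly_measurable_sum => j.
exact: jointly_measurableX.
Qed.

Section clipped_norms.
Context (R : realType) (dim : nat) (disp : measure_display)
  (T : measurableType disp) (P : probability T R).
Variables (F : R -> set (set T)) (B : R -> T -> 'cV[R]_dim).
Hypothesis hF : is_filtration F.
Hypothesis hB : brownian_motion P F B.

Lemma elementary_process_jointly_measurable (t : R)
    (phi : elementary (R := R) (d := dim) (T := T)) (D : set R) i j :
  measurable D -> elementary_on F t phi ->
  jointly_measurable D (fun s w => elementary_process phi s w i j).
Proof.
move=> mD ephi; have [_ _ mval _] := ephi.
have -> : (fun s w => elementary_process phi s w i j) = (fun s w =>
    \sum_(k < esize phi) \1_(`[etime phi k, etime phi k.+1[%classic) s * evalue phi k w i j).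
  apply/funext => s; apply/funext => w.
  rewrite /elementary_process summxE; apply: eq_bigr => k _.
  rewrite indicE mem_setE in_itv/=; case: ifP => _; rewrite ?mul1r ?mul0r ?mxE//.
apply: jointly_measurable_sum => k; apply: jointly_measurableM.
  by apply: jointly_measurable_time => //; exact: measurable_indic.
apply: jointly_measurable_omega => //.
have kn := ltn_ord k.
apply: (filtration_measurable hF (etime_ge0 ephi (ltnW kn))) => U mU.
exact: mval.
Qed.

Lemma simple_proc_jointly_measurable (I : finType) (pc : I -> piece R dim T)
    (D : set R) j : measurable D -> (forall i, admissible F (pc i)) ->
  jointly_measurable D (fun s w => simple_proc pc s w j).
Proof.
move=> mD adm; apply: jointly_measurable_sum => i; apply: jointly_measurableM.
  apply: jointly_measurableM.
    apply: jointly_measurable_omega => //.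
    by have [a0 _ mp _] := adm i; exact: (filtration_measurable hF a0).
  apply: jointly_measurable_time => //.
  have -> : piece_ind (pc i) = \1_(`[pstart (pc i), pstop (pc i)[%classic).
    by apply/funext => s; rewrite indicE mem_setE in_itv.
  exact: measurable_indic.
by apply: jointly_measurable_time.
Qed.

Lemma simple_int_msq_le (I : finType) (pc : I -> piece R dim T) (a b : R)
    (g : R -> T -> R) : (forall i, admissible F (pc i)) ->
  (forall i, a <= pstart (pc i)) -> (forall i, pstop (pc i) <= b) ->
  jointly_measurable `[a, b] g -> (forall s w, 0 <= g s w) ->
  (forall s w, a <= s <= b -> \sum_j simple_proc pc s w j ^+ 2 <= g s w) ->
  (msq P (simple_int B pc) <= dint P `[a, b] g)%E.
Proof.
move=> adm pa pb mg g0 le_g; rewrite /msq (simple_isometry hF hB adm pa pb).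
have mab : measurable (`[a, b]%classic : set R) by exact: measurable_itv.
apply: (@le_dint _ _ _ P _ mab (fun s w => \sum_j simple_proc pc s w j ^+ 2) g) => //.
- apply: jointly_measurable_sum => j; apply: jointly_measurableX.
  exact: simple_proc_jointly_measurable.
- by move=> s w; apply: sumr_ge0 => j _; exact: sqr_ge0.
Qed.

Lemma clip_norm (t : R) (phi : elementary (R := R) (d := dim) (T := T)) r (a b : R) :
  elementary_on F t phi -> 0 <= a -> a <= b ->
  (msq P (simple_int B (clip phi r a b)) <=
   dint P `[a, b] (fun s w => \sum_j elementary_process phi s w r j ^+ 2)%R)%E.
Proof.
move=> ephi a0 ab.
apply: simple_int_msq_le.
- by move=> i; exact: (clip_admissible hF ephi).
- by move=> i; exact: clamp_ge.
- by move=> i; exact: clamp_le.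
- apply: jointly_measurable_sum => j; apply: jointly_measurableX.
  by apply: elementary_process_jointly_measurable ephi.
- by move=> s w; apply: sumr_ge0 => j _; exact: sqr_ge0.
- move=> s w sab; apply: ler_sum => j _; rewrite clip_proc//.
  by case: ifP => // _; rewrite expr0n/= sqr_ge0.
Qed.

Definition piece_opp (p : piece R dim T) : piece R dim T :=
  Piece (pstart p) (pstop p) (pcoord p) (fun w => - pvalue p w).

Lemma piece_opp_admissible p : admissible F p -> admissible F (piece_opp p).
Proof.
move=> [a0 ab mp [M Mp]]; split => //=.
  have [h _ _] := hF; have sa := h _ a0.
  have := measurable_in_sub sa (measurable_in_cst sa 0) mp.
  by under [X in measurable_in _ X -> _]eq_fun do rewrite sub0r.
by exists M => w; rewrite normrN.
Qed.

(** The difference of two clipped processes is the simple process indexed by the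
    disjoint union of their pieces, so the isometry applies to it. *)
Lemma clip_difference_norm (t t' : R)
    (phi phi' : elementary (R := R) (d := dim) (T := T)) r (u : R) :
  elementary_on F t phi -> elementary_on F t' phi' -> 0 <= u ->
  (msq P (fun w => simple_int B (clip phi r 0 u) w - simple_int B (clip phi' r 0 u) w)%R <=
   dint P `[0%R, u] (fun s w => \sum_j
     (elementary_process phi s w r j - elementary_process phi' s w r j) ^+ 2)%R)%E.
Proof.
move=> ephi ephi' u0.
pose pc x := match x with
  | inl i => clip phi r 0 u i | inr i => piece_opp (clip phi' r 0 u i) end.
have -> : (fun w => simple_int B (clip phi r 0 u) w - simple_int B (clip phi' r 0 u) w) =
    simple_int B pc.
  apply/funext => w; rewrite /simple_int big_sumType/=; congr (_ + _).
  by rewrite -sumrN; apply: eq_bigr => i _; rewrite /piece_int/= mulNr.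
apply: simple_int_msq_le.
- move=> [i|i]; first exact: (clip_admissible hF ephi).
  by apply: piece_opp_admissible; exact: (clip_admissible hF ephi').
- by move=> [i|i]; exact: clamp_ge.
- by move=> [i|i]; exact: clamp_le.
- apply: jointly_measurable_sum => j; apply: jointly_measurableX.
  apply: jointly_measurableB.
    by apply: elementary_process_jointly_measurable ephi.
  by apply: elementary_process_jointly_measurable ephi'.
- by move=> s w; apply: sumr_ge0 => j _; exact: sqr_ge0.
- move=> s w sab; apply: ler_sum => j _.
  have -> : simple_proc pc s w j =
      simple_proc (clip phi r 0 u) s w j - simple_proc (clip phi' r 0 u) s w j.
    rewrite /simple_proc big_sumType/=; congr (_ + _).
    by rewrite -sumrN; apply: eq_bigr => i _; rewrite /piece_proc/= !mulNr.
  rewrite !clip_proc//.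
  by case: ifP => // _; rewrite subr0 expr0n/= sqr_ge0.
Qed.

End clipped_norms.

Section ito_increments.
Context (R : realType) (dim : nat) (disp : measure_display)
  (T : measurableType disp) (P : probability T R).
Variables (F : R -> set (set T)) (B : R -> T -> 'cV[R]_dim).
Hypothesis hF : is_filtration F.
Hypothesis hB : brownian_motion P F B.
Variables (u v : R) (H : R -> T -> 'M[R]_dim) (Iu Iv : T -> 'cV[R]_dim).
Hypotheses (u0 : 0 <= u) (uv : u <= v).
Hypotheses (hIu : is_ito_integral P F B u H Iu) (hIv : is_ito_integral P F B v H Iv).
Variable r : 'I_dim.

Let v0 : 0 <= v. Proof. exact: le_trans uv. Qed.

Let energy : \bar R := dint P `[u, v] (fun s w => \sum_j H s w r j ^+ 2)%R.

Let mseg (a b : R) : measurable (`[a, b]%classic : set R).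
Proof. exact: measurable_itv. Qed.

Let jmH i j (D : set R) : measurable D -> D `<=` `[0, v]%classic ->
  jointly_measurable D (fun s w => H s w i j).
Proof.
move=> mD Dv; have [mH _ _ _ _] := hIv.
by apply: (jointly_measurableS (D' := `[0, v]%classic)) => //; exact: mH.
Qed.

Lemma ito_energy_fin : (energy < +oo)%E.
Proof.
have [mH _ fin _ _] := hIv.
apply: le_lt_trans fin.
have sub : `[u, v]%classic `<=` (`[0, v]%classic : set R).
  by move=> s /=; rewrite !in_itv/= => /andP[us ->]; rewrite (le_trans u0).
have jm : jointly_measurable `[0, v] (fun s w => \sum_j H s w r j ^+ 2).
  by apply: jointly_measurable_sum => j; apply: jointly_measurableX; exact: jmH.
apply: (@le_trans _ _ (dint P `[0%R, v] (fun s w => \sum_j H s w r j ^+ 2)%R)).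
  apply: dint_subset => //.
  by move=> s w; apply: sumr_ge0 => j _; exact: sqr_ge0.
apply: (@le_dint _ _ _ P `[0, v] _ _ (fun s w => enorm (H s w) ^+ 2)) => //.
- by apply: jointly_measurable_enorm_sqr => // i j; exact: jmH.
- by move=> s w; apply: sumr_ge0 => j _; exact: sqr_ge0.
- by move=> s w _; exact: row_sqr_le_enorm.
- by move=> s w; exact: sqr_ge0.
Qed.

Let err (t : R) (phi : elementary (R := R) (d := dim) (T := T)) : \bar R :=
  dint P `[0%R, t] (fun s w => enorm (H s w - elementary_process phi s w) ^+ 2)%R.

Let jm_err t phi (D : set R) : elementary_on F t phi -> measurable D ->
  D `<=` `[0, v]%classic ->
  jointly_measurable D (fun s w => enorm (H s w - elementary_process phi s w) ^+ 2).
Proof.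
move=> ephi mD Dv; apply: jointly_measurable_enorm_sqr => // i j.
have -> : (fun s w => (H s w - elementary_process phi s w) i j) =
    (fun s w => H s w i j - elementary_process phi s w i j).
  by apply/funext => s; apply/funext => w; rewrite !mxE.
apply: jointly_measurableB; first exact: jmH.
exact: (elementary_process_jointly_measurable hF _ _ mD ephi).
Qed.

(** The increment between [u] and [v] is approximated by the integral [J] of an
    elementary approximant of the second integral, restricted to [[u, v]].  Its
    restriction to [[0, u]] is close to [Iu], because it is close in mean square to
    the approximant that defines [Iu]: both integrands approximate [H] on [[0, u]]. *)
Lemma ito_increment_approx (eta : R) : 0 < eta -> exists J : T -> R,
  [/\ sq_integrable P J,
     (msq P (fun w => Iv w r 0 - Iu w r 0 - J w)%R <= eta%:E)%E,
     forall Z, measurable_in (F u) Z -> sq_integrable P Z ->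
       \int[P]_w (Z w * J w) = 0
   & forall e : R, 0 < e ->
       (msq P J <= (1 + e)%:E * energy + ((1 + e^-1) * eta)%:E)%E].
Proof.
(* the errors below add up to 2 (2 c + 2 c) + 2 (4 c) = 16 c *)
move=> eta0; pose c := eta / 16.
have c0 : 0 < c by rewrite divr_gt0.
have [_ _ _ mIv [phi [ephi cvg_phi cvg_Jphi]]] := hIv.
have [_ _ _ mIu [phi' [ephi' cvg_phi' cvg_Jphi']]] := hIu.
have near_le (a : nat -> \bar R) : a @ \oo --> 0%E ->
    \forall n \near \oo, (a n <= c%:E)%E.
  move=> /fine_cvgP[afin /cvgrPdist_le /(_ _ c0)].
  apply: filterS2 afin => n an; rewrite sub0r normrN -[a n]fineK// lee_fin.
  by apply: le_trans; exact: ler_norm.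
(* one index for which all four approximations are good *)
have [n [en en' rn rn']] : exists n, [/\ (err v (phi n) <= c%:E)%E,
    (err u (phi' n) <= c%:E)%E,
    (\int[P]_w ((enorm (Iv w - elementary_integral B (phi n) w) ^+ 2)%R)%:E <= c%:E)%E
  & (\int[P]_w ((enorm (Iu w - elementary_integral B (phi' n) w) ^+ 2)%R)%:E <= c%:E)%E].
  have h1 := near_le _ cvg_phi; have h2 := near_le _ cvg_phi'.
  have h3 := near_le _ cvg_Jphi; have h4 := near_le _ cvg_Jphi'.
  near \oo => n; exists n; split.
  - exact: (near h1 n).
  - exact: (near h2 n).
  - exact: (near h3 n).
  - exact: (near h4 n).
have ep := ephi n; have ep' := ephi' n.
have admh i := clip_admissible hF ep r i u0 uv.
pose J := simple_int B (clip (phi n) r u v).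
pose Jlow := simple_int B (clip (phi n) r 0 u).
pose Jlow' := simple_int B (clip (phi' n) r 0 u).
have sJ : sq_integrable P J by exact: (simple_int_sq_integrable hF hB).
have sJlow : sq_integrable P Jlow.
  by apply: (simple_int_sq_integrable hF hB) => i; exact: (clip_admissible hF ep).
have sJlow' : sq_integrable P Jlow'.
  by apply: (simple_int_sq_integrable hF hB) => i; exact: (clip_admissible hF ep').
have subv (a b : R) : 0 <= a -> b <= v -> `[a, b]%classic `<=` (`[0, v]%classic : set R).
  move=> a0 bv s /=; rewrite !in_itv/= => /andP[as_ sb].
  by rewrite (le_trans a0 as_) (le_trans sb bv).
exists J; split => //.
(* up to time u, both approximants are close to H, hence to each other *)
- have low : (msq P (fun w => Jlow w - Jlow' w)%R <= (4 * c)%:E)%E.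
    have jm1 := jm_err ep (mseg 0 u) (subv 0 u (lexx 0) uv).
    have jm2 := jm_err ep' (mseg 0 u) (subv 0 u (lexx 0) uv).
    apply: (le_trans (clip_difference_norm hF hB r ep ep' u0)).
    apply: (@le_trans _ _ (dint P `[0%R, u] (fun s w =>
        2 * enorm (H s w - elementary_process (phi n) s w) ^+ 2 +
        2 * enorm (H s w - elementary_process (phi' n) s w) ^+ 2)%R)).
      apply: le_dint => //.
      + apply: jointly_measurable_sum => j; apply: jointly_measurableX.
        apply: jointly_measurableB.
          exact: (elementary_process_jointly_measurable hF _ _ (mseg 0 u) ep).
        exact: (elementary_process_jointly_measurable hF _ _ (mseg 0 u) ep').
      + by apply: jointly_measurableD; apply: jointly_measurableZ;
          [exact: jm1|exact: jm2].
      + by move=> s w; apply: sumr_ge0 => j _; exact: sqr_ge0.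
      + move=> s w _; have := row_sqr_le_enorm (H s w - elementary_process (phi n) s w) r.
        have := row_sqr_le_enorm (H s w - elementary_process (phi' n) s w) r.
        move=> h1 h2; apply: le_trans (lerD (ler_wpM2l _ h2) (ler_wpM2l _ h1)) => //.
        rewrite !mulr_sumr -big_split /=; apply: ler_sum => j _; rewrite !mxE.
        set x := elementary_process _ _ _ _ _; set y := elementary_process _ _ _ _ _.
        have := sqr_ge0 ((H s w r j - x) + (H s w r j - y)); nra.
      + by move=> s w; rewrite addr_ge0// mulr_ge0 ?sqr_ge0.
    rewrite dintD//; last 4 first.
    + exact: jointly_measurableZ.
    + exact: jointly_measurableZ.
    + by move=> s w; rewrite mulr_ge0 ?sqr_ge0.
    + by move=> s w; rewrite mulr_ge0 ?sqr_ge0.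
    rewrite !dintZ//; do ?[by move=> s w; exact: sqr_ge0].
    have -> : (4 * c)%:E = (2%:E * c%:E + 2%:E * c%:E)%E.
      by rewrite -!EFinM -EFinD; congr EFin; ring.
    have two0 : (0 <= 2%:E :> \bar R)%E by rewrite lee_fin.
    apply: leeD; apply: lee_wpmul2l; [exact: two0| |exact: two0|exact: en'].
    apply: le_trans en; apply: dint_subset => //; last by move=> s w; exact: sqr_ge0.
      exact: subv.
    exact: (jm_err ep (mseg 0 v)).
  have errJ (I : T -> 'cV[R]_dim) t ph : (forall i, measurable_fun [set: T] (fun w => I w i 0)) ->
      elementary_on F t ph -> 0 <= t ->
      (\int[P]_w ((enorm (I w - elementary_integral B ph w) ^+ 2)%R)%:E <= c%:E)%E ->
      sq_integrable P (simple_int B (clip ph r 0 t)) ->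
      (msq P (fun w => I w r 0 - simple_int B (clip ph r 0 t) w)%R <= c%:E)%E.
    move=> mI eph t0 + [mS _]; apply: le_trans; apply: ge0_le_integral => //.
    + by move=> w _; rewrite lee_fin sqr_ge0.
    + by apply/measurable_EFinP; apply: measurable_funX; exact: measurable_funB.
    + apply/measurable_EFinP.
      have -> : (fun w => enorm (I w - elementary_integral B ph w) ^+ 2) =
          (fun w => \sum_i (I w i 0 - simple_int B (clip ph i 0 t) w) ^+ 2).
        apply/funext => w; rewrite enorm_sqr; apply: eq_bigr => i _.
        by rewrite big_ord1 !mxE (clip_int_full B eph).
      apply: measurable_sum => i; apply: measurable_funX.
      apply: measurable_funB => //; apply: (@sq_integrable_measurable _ _ _ P).
      by apply: (simple_int_sq_integrable hF hB) => k; exact: (clip_admissible hF eph).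
    + move=> w _; rewrite lee_fin (clip_int_full B eph).
      by have := entry_sqr_le_enorm (I w - elementary_integral B ph w) r 0; rewrite !mxE.
  pose Jv := simple_int B (clip (phi n) r 0 v).
  have sJv : sq_integrable P Jv.
    by apply: (simple_int_sq_integrable hF hB) => i; exact: (clip_admissible hF ep).
  have ev := errJ Iv v (phi n) mIv ep v0 rn sJv.
  have eu := errJ Iu u (phi' n) mIu ep' u0 rn' sJlow'.
  rewrite -msqN in eu.
  have mv : measurable_fun [set: T] (fun w => Iv w r 0 - Jv w).
    by apply: measurable_funB => //; case: sJv.
  have mu : measurable_fun [set: T] (fun w => - (Iu w r 0 - Jlow' w)).
    by apply: measurable_funN; apply: measurable_funB => //; case: sJlow'.
  have ml : measurable_fun [set: T] (fun w => Jlow w - Jlow' w).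
    by apply: measurable_funB; [case: sJlow|case: sJlow'].
  have mvu : measurable_fun [set: T] (fun w => Iv w r 0 - Jv w - (Iu w r 0 - Jlow' w)).
    exact: measurable_funD.
  have := msq_add2 mvu ml (msq_add2 mv mu ev eu) low.
  have -> : 2 * (2 * c + 2 * c) + 2 * (4 * c) = eta by rewrite /c; field.
  congr (msq P _ <= _)%E; apply/funext => w.
  have := clip_int_chasles B ep r w u0 uv; rewrite -/J -/Jlow -/Jv => <-.
  by ring.
- move=> Z mZ sZ; apply: (simple_int_orthogonal hF hB admh u0) => // i.
  exact: clamp_ge.
- move=> e e0; apply: (le_trans (clip_norm hF hB r ep u0 uv)).
  have c1 : 0 <= 1 + e by rewrite addr_ge0// ltW.
  have c2 : 0 <= 1 + e^-1 by rewrite addr_ge0// invr_ge0 ltW.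
  have jm1 := jm_err ep (mseg u v) (subv u v u0 (lexx v)).
  have jmH2 : jointly_measurable `[u, v] (fun s w => \sum_j H s w r j ^+ 2).
    apply: jointly_measurable_sum => j; apply: jointly_measurableX.
    by apply: jmH => //; exact: subv.
  have posH s w : 0 <= \sum_j H s w r j ^+ 2 by apply: sumr_ge0 => j _; exact: sqr_ge0.
  apply: (@le_trans _ _ (dint P `[u, v] (fun s w =>
      (1 + e) * (\sum_j H s w r j ^+ 2) +
      (1 + e^-1) * enorm (H s w - elementary_process (phi n) s w) ^+ 2)%R)).
    apply: le_dint => //.
    + apply: jointly_measurable_sum => j; apply: jointly_measurableX.
      exact: (elementary_process_jointly_measurable hF _ _ (mseg u v) ep).
    + by apply: jointly_measurableD; exact: jointly_measurableZ.
    + by move=> s w; apply: sumr_ge0 => j _; exact: sqr_ge0.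
    + move=> s w _; have := row_sqr_le_enorm (H s w - elementary_process (phi n) s w) r.
      move=> h1; apply: le_trans (lerD (lexx _) (ler_wpM2l _ h1)) => //.
      rewrite !mulr_sumr -big_split /=; apply: ler_sum => j _; rewrite !mxE.
      set x := elementary_process _ _ _ _ _.
      have := young_sqr (H s w r j) (x - H s w r j) e0.
      rewrite (_ : H s w r j + (x - H s w r j) = x); last by ring.
      by rewrite -(sqrrN (x - _)) opprB.
    + by move=> s w; rewrite addr_ge0// mulr_ge0 ?sqr_ge0.
  rewrite dintD//; last 4 first.
  + exact: jointly_measurableZ.
  + exact: jointly_measurableZ.
  + by move=> s w; rewrite mulr_ge0.
  + by move=> s w; rewrite mulr_ge0 ?sqr_ge0.
  rewrite !dintZ//; last by move=> s w; exact: sqr_ge0.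
  rewrite EFinM; apply: leeD => //; apply: lee_wpmul2l; first by rewrite lee_fin.
  apply: (@le_trans _ _ c%:E); last by rewrite lee_fin /c; lra.
  apply: le_trans en; apply: dint_subset => //; last by move=> s w; exact: sqr_ge0.
    exact: subv.
  exact: (jm_err ep (mseg 0 v)).
Unshelve. all: by end_near.
Qed.

End ito_increments.

(** * Isometry bound and orthogonality for stochastic integrals *)

(** This removes the parameter of Young's inequality at the end of an estimate. *)
Lemma ler_small_slope (R : realType) (x y k : R) : 0 <= k ->
  (forall e, 0 < e -> e <= 1 -> x <= y + e * k) -> x <= y.
Proof.
move=> k0 h; apply/ler_addgt0Pr => e e0.
pose e' := Num.min 1 (e / (k + 1)).
have k1 : 0 < k + 1 by rewrite ltr_pwDr.
have e'0 : 0 < e' by rewrite lt_min ltr01 divr_gt0.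
apply: (le_trans (h e' e'0 _)); first by rewrite ge_min lexx.
rewrite lerD2l; apply: (@le_trans _ _ (e / (k + 1) * k)).
  by rewrite ler_wpM2r// ge_min lexx orbT.
by rewrite -mulrA ler_piMr ?(ltW e0)// mulrC ler_pdivrMr// mul1r lerDl.
Qed.

Section ito_moments.
Context (R : realType) (dim : nat) (disp : measure_display)
  (T : measurableType disp) (P : probability T R).
Variables (F : R -> set (set T)) (B : R -> T -> 'cV[R]_dim).
Hypothesis hF : is_filtration F.
Hypothesis hB : brownian_motion P F B.
Variables (u v : R) (H : R -> T -> 'M[R]_dim) (Iu Iv : T -> 'cV[R]_dim).
Hypotheses (u0 : 0 <= u) (uv : u <= v).
Hypotheses (hIu : is_ito_integral P F B u H Iu) (hIv : is_ito_integral P F B v H Iv).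
Variable r : 'I_dim.

Let mD : measurable_fun [set: T] (fun w => Iv w r 0 - Iu w r 0).
Proof.
have [_ _ _ mIu _] := hIu; have [_ _ _ mIv _] := hIv.
exact: measurable_funB.
Qed.

(** [ito_increment_approx] with error [e^2] and Young's inequality with parameter
    [e]: all the errors vanish with [e]. *)
Lemma ito_increment_msq :
  (msq P (fun w => Iv w r 0 - Iu w r 0)%R <=
   dint P `[u, v] (fun s w => \sum_j H s w r j ^+ 2)%R)%E.
Proof.
have fin := ito_energy_fin u0 hIv r.
set en := dint _ _ _ in fin *.
have en0 : (0 <= en)%E.
  by apply: dint_ge0 => s w; apply: sumr_ge0 => j _; exact: sqr_ge0.
have enE : en = (fine en)%:E by rewrite fineK// ge0_fin_numE.
have k0 : 0 <= fine en by exact: fine_ge0.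
have key e : 0 < e -> e <= 1 ->
    (msq P (fun w => Iv w r 0 - Iu w r 0)%R <= (fine en + e * (3 * fine en + 6))%:E)%E.
  move=> e0 e1; have e20 : 0 < e ^+ 2 by exact: exprn_gt0.
  have [J [sJ hX _ hJ]] := ito_increment_approx hF hB u0 uv hIu hIv r e20.
  have mJ := sq_integrable_measurable sJ.
  have mX : measurable_fun [set: T] (fun w => Iv w r 0 - Iu w r 0 - J w).
    exact: measurable_funB.
  have := msq_young P e0 mJ mX.
  rewrite (_ : (fun w => _) = (fun w => Iv w r 0 - Iu w r 0)); last first.
    by apply/funext => w; rewrite addrC subrK.
  move/le_trans; apply.
  have ep : 0 <= 1 + e by lra.
  have em : 0 <= 1 + e^-1 by rewrite addr_ge0// invr_ge0 ltW.
  apply: (@le_trans _ _ ((1 + e)%:E * ((1 + e)%:E * en + ((1 + e^-1) * e ^+ 2)%:E)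
      + (1 + e^-1)%:E * (e ^+ 2)%:E)%E).
    by apply: leeD; apply: lee_wpmul2l; [rewrite lee_fin|exact: hJ|rewrite lee_fin|].
  rewrite enE.
  change (((1 + e) * ((1 + e) * fine en + (1 + e^-1) * e ^+ 2) + (1 + e^-1) * e ^+ 2)%:E
    <= (fine en + e * (3 * fine en + 6))%:E)%E.
  rewrite lee_fin.
  have -> : (1 + e^-1) * e ^+ 2 = e ^+ 2 + e by field; rewrite gt_eqF.
  have h1 : e ^+ 2 <= e by rewrite expr2 ler_piMl// ltW.
  have h2 : e ^+ 2 * fine en <= e * fine en by rewrite ler_wpM2r.
  have h3 : e ^+ 3 <= e by rewrite exprS (le_trans (ler_piMl _ e1))// exprn_ge0// ltW.
  rewrite [X in X <= _](_ : _ = fine en + 2 * (e * fine en) + e ^+ 2 * fine en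
      + 3 * e ^+ 2 + e ^+ 3 + 2 * e); last by ring.
  lra.
have msqfin : (msq P (fun w => Iv w r 0 - Iu w r 0)%R < +oo)%E.
  by apply: le_lt_trans (key 1 ltr01 (lexx 1)) _; exact: ltry.
have msqE : (msq P (fun w => Iv w r 0 - Iu w r 0)%R =
    (fine (msq P (fun w => Iv w r 0 - Iu w r 0)%R))%:E)%E.
  by rewrite fineK// ge0_fin_numE// msq_ge0.
rewrite msqE enE lee_fin.
apply: (@ler_small_slope _ _ _ (3 * fine en + 6)); first by rewrite addr_ge0// mulr_ge0.
by move=> e e0 e1; rewrite -lee_fin -msqE; exact: key.
Qed.

Lemma ito_increment_sq_integrable : sq_integrable P (fun w => Iv w r 0 - Iu w r 0).
Proof.
apply: sq_integrableP => //; apply: le_lt_trans ito_increment_msq _.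
exact: (ito_energy_fin u0 hIv r).
Qed.

(** [Z] is orthogonal to the approximants [J], and the remaining error is controlled
    by Young's inequality. *)
Lemma ito_increment_orthogonal (Z : T -> R) :
  measurable_in (F u) Z -> sq_integrable P Z ->
  \int[P]_w (Z w * (Iv w r 0 - Iu w r 0)) = 0.
Proof.
move=> mZ sZ; apply/eqP; rewrite -normr_le0.
have [mZ' IZ2] := sZ.
set EZ2 := \int[P]_w (Z w ^+ 2).
have EZ20 : 0 <= EZ2 by apply: Rintegral_ge0 => w _; exact: sqr_ge0.
apply: (@ler_small_slope _ _ _ (EZ2 + 1)); first by rewrite addr_ge0.
move=> e e0 e1; have e20 : 0 < e ^+ 2 by exact: exprn_gt0.
have [J [sJ hX hO _]] := ito_increment_approx hF hB u0 uv hIu hIv r e20.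
have sX := sq_integrable_sub ito_increment_sq_integrable sJ.
have IZX := sq_integrable_mul sZ sX.
have -> : \int[P]_w (Z w * (Iv w r 0 - Iu w r 0)) =
    \int[P]_w (Z w * (Iv w r 0 - Iu w r 0 - J w)).
  rewrite -[RHS]addr0 -(hO Z mZ sZ) -RintegralD//; last exact: sq_integrable_mul.
  by apply: eq_Rintegral => w _; ring.
apply: (le_trans (le_normr_Rintegral measurableT IZX)).
have [mX IX2] := sX.
have e1pos : 0 <= e^-1 by rewrite invr_ge0 ltW.
have hint : P.-integrable [set: T] (EFin \o (fun w =>
    e * Z w ^+ 2 + e^-1 * (Iv w r 0 - Iu w r 0 - J w) ^+ 2)).
  by apply: integrable_add; exact: integrable_scale.
apply: (@le_trans _ _ (\int[P]_w (e * Z w ^+ 2 +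
    e^-1 * (Iv w r 0 - Iu w r 0 - J w) ^+ 2))).
  apply: le_Rintegral => //; first exact: integrable_norm.
  move=> w _; set z := Z w; set x := _ - J w.
  have se : Num.sqrt e ^+ 2 = e by rewrite sqr_sqrtr// ltW.
  have se0 : Num.sqrt e != 0 by rewrite gt_eqF// sqrtr_gt0.
  have h1 := sqr_ge0 (Num.sqrt e * `|z| - (Num.sqrt e)^-1 * `|x|).
  have E1 : (Num.sqrt e * `|z| - (Num.sqrt e)^-1 * `|x|) ^+ 2 =
     Num.sqrt e ^+ 2 * `|z| ^+ 2 - 2 * (`|z| * `|x|) + (Num.sqrt e ^+ 2)^-1 * `|x| ^+ 2.
    by field.
  rewrite E1 se !real_normK ?num_real// in h1.
  have h2 : 0 <= `|z| * `|x| by rewrite mulr_ge0.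
  rewrite normrM; lra.
rewrite RintegralD//; [|exact: integrable_scale|exact: integrable_scale].
rewrite !RintegralZl// -/EZ2 add0r mulrDr lerD2l mulr1.
rewrite mulrC ler_pdivrMr// -expr2 -lee_fin EFin_Rintegral//.
Qed.

End ito_moments.

(** * Gradients, the descent lemma and the spectral norm *)

Section gradient.
Context {R : realType} {d : nat}.
Implicit Types (f : 'cV[R]_d -> R) (x y v : 'cV[R]_d).

Lemma col_sum_delta v : v = \sum_i v i 0 *: delta_mx i 0.
Proof.
by rewrite {1}(matrix_sum_delta v); apply: eq_bigr => i _; rewrite big_ord1.
Qed.

Lemma derive_grad f x v : differentiable f x ->
  'D_v f x = \sum_i grad f x i 0 * v i 0.
Proof.
move=> df; rewrite deriveE// {1}(col_sum_delta v) linear_sum; apply: eq_bigr => i _.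
by rewrite linearZ /grad !mxE /partial deriveE// mulrC.
Qed.

Lemma is_derive_line f x v (s : R) : differentiable f (x + s *: v) ->
  is_derive s 1 (fun s : R => f (x + s *: v)) (\sum_i grad f (x + s *: v) i 0 * v i 0).
Proof.
move=> df; rewrite -derive_grad//.
have E : (fun h : R => h^-1 *: (((fun s : R => f (x + s *: v)) \o shift s) (h *: 1) -
      f (x + s *: v))) =
    (fun h : R => h^-1 *: ((f \o shift (x + s *: v)) (h *: v) - f (x + s *: v))).
  apply/funext => h /=; congr (_ *: (f _ - _)).
  by rewrite [h *: 1]mulr1 scalerDl addrCA.
by split; rewrite /derivable /derive E //; exact: (diff_derivable (v := v) df).
Qed.

(** Written as a sum rather than as the entry of a matrix product, to be manipulated
    termwise. *)
Definition dot x y : R := \sum_i x i 0 * y i 0.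

Lemma enorm_sqr_col x : enorm x ^+ 2 = \sum_i x i 0 ^+ 2.
Proof. by rewrite enorm_sqr; apply: eq_bigr => i _; rewrite big_ord1. Qed.

Lemma young_dot (e : R) x y : 0 < e ->
  2 * dot x y <= e * enorm x ^+ 2 + e^-1 * enorm y ^+ 2.
Proof.
move=> e0; rewrite !enorm_sqr_col /dot !mulr_sumr -big_split /=.
apply: ler_sum => i _.
have se : Num.sqrt e ^+ 2 = e by rewrite sqr_sqrtr// ltW.
have se0 : Num.sqrt e != 0 by rewrite gt_eqF// sqrtr_gt0.
have h1 := sqr_ge0 (Num.sqrt e * x i 0 - (Num.sqrt e)^-1 * y i 0).
have E1 : (Num.sqrt e * x i 0 - (Num.sqrt e)^-1 * y i 0) ^+ 2 =
   Num.sqrt e ^+ 2 * x i 0 ^+ 2 - 2 * (x i 0 * y i 0) + (Num.sqrt e ^+ 2)^-1 * y i 0 ^+ 2.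
  by field.
rewrite E1 se in h1; lra.
Qed.

Lemma enorm_sqr_scale (c : R) x : enorm (c *: x) ^+ 2 = c ^+ 2 * enorm x ^+ 2.
Proof.
by rewrite !enorm_sqr_col mulr_sumr; apply: eq_bigr => i _; rewrite mxE exprMn.
Qed.

Lemma enorm_sqr_add_le x y : enorm (x + y) ^+ 2 <= 2 * enorm x ^+ 2 + 2 * enorm y ^+ 2.
Proof.
rewrite !enorm_sqr_col !mulr_sumr -big_split /=; apply: ler_sum => i _; rewrite mxE.
have := sqr_ge0 (x i 0 - y i 0); nra.
Qed.

Lemma enorm_sqr_sub_sym x y : enorm (x - y) ^+ 2 = enorm (y - x) ^+ 2.
Proof. by rewrite -opprB -scaleN1r enorm_sqr_scale sqrrN expr1n mul1r. Qed.

(** Along the segment from [x] to [y], the derivative of [f] minus the proposed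
    upper bound is nonpositive, by the Lipschitz bound and Young's inequality. *)
Lemma descent_lemma (L : R) f x y : 0 <= L -> (forall z, differentiable f z) ->
  (forall z z', enorm (grad f z - grad f z') ^+ 2 <= L ^+ 2 * enorm (z - z') ^+ 2) ->
  f y <= f x + dot (grad f x) (y - x) + L / 2 * enorm (y - x) ^+ 2.
Proof.
move=> L0 df Lip; set v := y - x.
pose g (s : R) := f (x + s *: v) - s * dot (grad f x) v - L / 2 * s ^+ 2 * enorm v ^+ 2.
pose dg (s : R) := \sum_i grad f (x + s *: v) i 0 * v i 0 - dot (grad f x) v -
  L * s * enorm v ^+ 2.
have isd (s : R) : is_derive s 1 g (dg s).
  have h1 := is_derive_line (df (x + s *: v)).
  pose c1 : R := dot (grad f x) v; pose c2 : R := L / 2 * enorm v ^+ 2.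
  have -> : g = (fun s : R => f (x + s *: v)) - c1 *: (id : R -> R)
      - c2 *: ((id : R -> R) ^+ 2).
    by apply/funext => r; rewrite /g /c1 /c2 !fctE /= /GRing.scale /=; ring.
  apply: is_derive_eq.
  by rewrite /dg /c1 /c2 /GRing.scale /=; field.
have dg0 (s : R) : 0 < s -> dg s <= 0.
  move=> s0.
  have -> : dg s = dot (grad f (x + s *: v) - grad f x) v - L * s * enorm v ^+ 2.
    rewrite /dg /dot -sumrB; congr (_ - _); apply: eq_bigr => i _.
    by rewrite !mxE mulrBl.
  have := Lip (x + s *: v) x; rewrite [x + _ - x]addrAC subrr add0r enorm_sqr_scale.
  set a := grad f (x + s *: v) - grad f x => ha.
  rewrite subr_le0.
  have v2 : 0 <= enorm v ^+ 2 by exact: sqr_ge0.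
  apply: (@ler_small_slope _ _ _ (enorm v ^+ 2 / 2)); first by rewrite divr_ge0.
  move=> e e0 _.
  have Ls0 : 0 <= L * s by rewrite mulr_ge0// ltW.
  (* L s alone may vanish, hence the extra e in the parameter *)
  have q0 : 0 < (L * s + e)^-1 by rewrite invr_gt0 ltr_wpDl.
  have := young_dot a v q0; rewrite invrK => hy.
  have hb : (L * s + e)^-1 * enorm a ^+ 2 <= L * s * enorm v ^+ 2.
    rewrite ler_pdivrMl ?ltr_wpDl//; apply: (le_trans ha).
    have -> : L ^+ 2 * (s ^+ 2 * enorm v ^+ 2) = L * s * (L * s * enorm v ^+ 2) by ring.
    have h0 : 0 <= L * s * enorm v ^+ 2 by exact: mulr_ge0.
    by rewrite ler_wpM2r// lerDl ltW.
  lra.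
have cg : {within `[0, 1], continuous g}.
  by apply: derivable_within_continuous => s _; case: (isd s).
have [c c01 E] := MVT ltr01 (fun s _ => isd s) cg.
have c0 : 0 < c by move: c01; rewrite in_itv/= => /andP[].
have : g 1 <= g 0 by rewrite -subr_le0 E subr0 mulr1 dg0.
rewrite /g scale1r scale0r addr0 mul0r subr0 expr0n/= mulr0 mul0r subr0.
rewrite expr1n mulr1 mul1r (_ : x + v = y); last by rewrite addrC subrK.
lra.
Qed.

End gradient.

Section average_gradient.
Context {R : realType} {d N : nat}.
Hypothesis N0 : (0 < N)%N.
Variable fs : 'I_N -> 'cV[R]_d -> R.

Let NR : (0 : R) < N%:R. Proof. by rewrite ltr0n. Qed.

Let averageE : average fs = N%:R^-1 *: (\sum_(i < N) fs i).
Proof. by apply/funext => x; rewrite /average !fctE fct_sumE. Qed.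

Lemma differentiable_average x : (forall i, differentiable (fs i) x) ->
  differentiable (average fs) x.
Proof.
by move=> df; rewrite averageE; apply: differentiableZ; exact: differentiable_sum.
Qed.

Lemma grad_average x : (forall i, differentiable (fs i) x) ->
  grad (average fs) x = N%:R^-1 *: \sum_(i < N) grad (fs i) x.
Proof.
move=> df; apply/colP => k; rewrite !mxE summxE /partial averageE.
have dr i : derivable (fs i) x (delta_mx k 0) by exact: diff_derivable.
rewrite deriveZ; last exact: derivable_sum.
rewrite derive_sum//; congr (_ *: _).
by apply: eq_bigr => i _; rewrite mxE.
Qed.

(** The difference of the two sides is half the sum of the squares of all the
    differences [a i - a j]. *)
Lemma sum_sqr_le (n : nat) (a : 'I_n -> R) :
  (\sum_i a i) ^+ 2 <= n%:R * \sum_i a i ^+ 2.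
Proof.
have h : 0 <= \sum_i \sum_j (a i - a j) ^+ 2.
  by apply: sumr_ge0 => i _; apply: sumr_ge0 => j _; exact: sqr_ge0.
have E : \sum_i \sum_j (a i - a j) ^+ 2 =
    2 * (n%:R * \sum_i a i ^+ 2) - 2 * (\sum_i a i) ^+ 2.
  transitivity (\sum_i (n%:R * a i ^+ 2 - 2 * a i * (\sum_j a j) + \sum_j a j ^+ 2)).
    apply: eq_bigr => i _.
    rewrite mulr_sumr -sumrN.
    have -> : n%:R * a i ^+ 2 = \sum_(j < n) a i ^+ 2.
      by rewrite sumr_const card_ord mulr_natl.
    by rewrite -!big_split/=; apply: eq_bigr => j _; ring.
  rewrite !big_split/= sumrN -mulr_sumr -mulr_suml -mulr_sumr.
  by rewrite sumr_const card_ord -mulr_natl; ring.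
rewrite E in h; lra.
Qed.

(** The constant survives averaging because the squared norm is convex. *)
Lemma average_gradient_lipschitz (L : R) : 0 <= L -> (forall i, L_smooth L (fs i)) ->
  forall x y, enorm (grad (average fs) x - grad (average fs) y) ^+ 2 <=
    L ^+ 2 * enorm (x - y) ^+ 2.
Proof.
move=> L0 hL x y; have df i z : differentiable (fs i) z by case: (hL i).
rewrite !grad_average// -scalerBr -sumrB enorm_sqr_scale.
set g := fun i => grad (fs i) x - grad (fs i) y.
have h1 : enorm (\sum_i g i) ^+ 2 <= N%:R * \sum_i enorm (g i) ^+ 2.
  rewrite enorm_sqr_col.
  under [X in _ <= _ * X]eq_bigr do rewrite enorm_sqr_col.
  rewrite exchange_big/= mulr_sumr; apply: ler_sum => k _.
  by rewrite summxE; exact: sum_sqr_le.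
have h2 i : enorm (g i) ^+ 2 <= L ^+ 2 * enorm (x - y) ^+ 2.
  have [_ h] := hL i; rewrite -exprMn lerXn2r ?nnegrE ?mulr_ge0 ?sqrtr_ge0//.
  exact: h.
have h3 : \sum_i enorm (g i) ^+ 2 <= N%:R * (L ^+ 2 * enorm (x - y) ^+ 2).
  apply: (le_trans (ler_sum _ (fun i _ => h2 i))).
  by rewrite sumr_const card_ord mulr_natl.
rewrite exprVn ler_pdivrMl ?exprn_gt0//.
apply: (le_trans h1); rewrite expr2 -mulrA ler_wpM2l// ltW//.
Qed.

Lemma continuous_partial_average : (forall i, is_Ck 3 (fs i)) ->
  forall k, continuous (fun x => grad (average fs) x k 0).
Proof.
move=> hC k.
have df i z : differentiable (fs i) z by case: (hC i).
have -> : (fun x => grad (average fs) x k 0) =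
    N%:R^-1 *: (\sum_(i < N) (partial k (fs i))).
  apply/funext => x; rewrite grad_average// !mxE summxE !fctE fct_sumE.
  by congr (_ * _); apply: eq_bigr => i _; rewrite mxE.
move=> x; apply: differentiable_continuous; apply: differentiableZ.
apply: differentiable_sum => i.
by case: (hC i) => _ /(_ k) /= [].
Qed.

End average_gradient.

Section spectral.
Context {R : realType} {d : nat}.

Lemma spectral_norm_has_ubound (A : 'M[R]_d) :
  has_ubound [set enorm (A *m x) | x in [set x : 'cV[R]_d | enorm x <= 1]].
Proof.
exists (Num.sqrt (\sum_i (\sum_j `|A i j|) ^+ 2)) => _ [x /= x1 <-].
rewrite /enorm ler_wsqrtr//; apply: ler_sum => i _; rewrite big_ord1 mxE.
have h : `|\sum_j A i j * x j 0| <= \sum_j `|A i j|.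
  apply: (le_trans (ler_norm_sum _ _ _)); apply: ler_sum => j _.
  rewrite normrM ler_piMr//.
  apply: le_trans x1.
  rewrite -ler_sqr ?nnegrE ?sqrtr_ge0// real_normK ?num_real//.
  exact: entry_sqr_le_enorm.
by rewrite -[X in X <= _]real_normK ?num_real// lerXn2r ?nnegrE ?sumr_ge0.
Qed.

(** A diagonal entry is a coordinate of the image of a unit vector. *)
Lemma diag_le_spectral_norm (A : 'M[R]_d) i : A i i <= spectral_norm A.
Proof.
pose e : 'cV[R]_d := delta_mx i 0.
have e1 : enorm e <= 1.
  rewrite /enorm -[leRHS]sqrtr1 ler_wsqrtr// (bigD1 i)//= big_ord1 mxE !eqxx expr1n.
  rewrite big1 ?addr0// => j ji; rewrite big_ord1 mxE (negbTE ji)/= expr0n//.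
apply: (@le_trans _ _ (enorm (A *m e))); last first.
  by apply: ub_le_sup; [exact: spectral_norm_has_ubound|exists e].
have -> : A i i = (A *m e) i 0 by rewrite -colE mxE.
apply: le_trans (ler_norm _) _.
rewrite -ler_sqr ?nnegrE ?sqrtr_ge0// real_normK ?num_real//.
exact: entry_sqr_le_enorm.
Qed.

(** The squared Frobenius norm is the trace of [S S^T], each of whose [d] diagonal
    entries is at most its spectral norm.  This is where the dimension enters the
    theorem. *)
Lemma enorm_sqr_le_spectral_norm (S : 'M[R]_d) :
  enorm S ^+ 2 <= d%:R * spectral_norm (S *m S^T).
Proof.
rewrite enorm_sqr mulr_natl -[d in _ *+ d]card_ord -sumr_const.
apply: ler_sum => i _; apply: le_trans (diag_le_spectral_norm _ i).
by rewrite mxE; apply: ler_sum => j _; rewrite mxE expr2.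
Qed.

Lemma spectral_norm_ge0 (A : 'M[R]_d) : 0 <= spectral_norm A.
Proof.
apply: (@le_trans _ _ (enorm (A *m (0 : 'cV[R]_d)))); first exact: sqrtr_ge0.
apply: ub_le_sup; first exact: spectral_norm_has_ubound.
exists 0 => //=; rewrite /enorm big1 ?sqrtr0// => i _.
by rewrite big1// => j _; rewrite mxE expr0n.
Qed.

Lemma sigmaMB_norm N (fs : 'I_N -> 'cV[R]_d -> R) x :
  (sigma_star2 fs < +oo)%E ->
  0 <= fine (sigma_star2 fs) /\
  enorm (sigmaMB fs x) ^+ 2 <= d%:R * fine (sigma_star2 fs).
Proof.
move=> fin.
have le_sup y : ((spectral_norm (sigmaMB fs y *m (sigmaMB fs y)^T))%:E <= sigma_star2 fs)%E.
  by apply: ereal_sup_ubound; exists y.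
have s0 : (0 <= sigma_star2 fs)%E.
  by apply: le_trans (le_sup x); rewrite lee_fin spectral_norm_ge0.
split; first exact: fine_ge0.
apply: (le_trans (enorm_sqr_le_spectral_norm _)); rewrite ler_wpM2l//.
by rewrite -lee_fin fineK ?ge0_fin_numE.
Qed.

End spectral.

(** * The martingale part of the solution *)

(** Near [t], the difference quotient is within [1] of its limit, which makes the
    function Lipschitz at [t]. *)
Lemma C1_halfline_continuous (R : realType) (g : R -> R) : C1_halfline g ->
  {within `[0, +oo[%classic, continuous g}.
Proof.
move=> [g' [_ dg]]; apply/subspace_continuousP => t /= t0.
have t0' : 0 <= t by move: t0; rewrite in_itv/= andbT.
have := dg t t0' => /cvgrPdist_le /(_ 1 ltr01) h.
pose K := `|g' t| + 1.
have K0 : 0 < K by rewrite /K ltr_pwDr.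
apply/cvgrPdist_le => e e0.
have h2 : \forall s \near nbhs t, `|t - s| <= e / K.
  by apply: (@cvgr_dist_le _ R^o _ (nbhs t) _ id t) => //; exact: divr_gt0.
have h1 : \forall s \near nbhs t, s != t -> `[0, +oo[%classic s ->
    `|g' t - (g s - g t) / (s - t)| <= 1 by exact: h.
rewrite /within /=; apply: filterS2 h1 h2 => s h1 h2 As.
have [->|st] := eqVneq s t; first by rewrite subrr normr0 ltW.
have st0 : s - t != 0 by rewrite subr_eq0.
have q : `|(g s - g t) / (s - t)| <= K.
  rewrite -(subrK (g' t) (_ / _)) (le_trans (ler_normD _ _))// addrC lerD2l.
  by rewrite distrC h1.
have -> : g t - g s = - ((g s - g t) / (s - t)) * (s - t).
  by rewrite mulNr divfK// opprB.
rewrite normrM normrN (le_trans (ler_pM _ _ q (lexx _)))//.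
by rewrite -ler_pdivlMl// mulrC distrC.
Qed.

Lemma continuous_segment_integrable (R : realType) (g : R -> R) (u v : R) :
  continuous g -> lebesgue_measure.-integrable `[u, v] (EFin \o g).
Proof.
move=> cg; apply: continuous_compact_integrable; first exact: segment_compact.
exact: continuous_subspaceT.
Qed.

Lemma dint_sum (R : realType) (disp : measure_display) (T : measurableType disp)
    (P : probability T R) (D : set R) (I : Type) (s : seq I) (f : I -> R -> T -> R) :
  measurable D -> (forall i, jointly_measurable D (f i)) ->
  (forall i s w, 0 <= f i s w) ->
  (dint P D (fun r w => \sum_(i <- s) f i r w)%R = \sum_(i <- s) dint P D (f i))%E.
Proof.
move=> mD mf f0; elim: s => [|i s ih].
  rewrite big_nil /dint integral0_eq// => w _; rewrite integral0_eq// => r _.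
  by rewrite big_nil.
rewrite big_cons -ih -dintD; do ?[exact: mf|by move=> *; exact: f0|exact: mD].
- congr (dint P D _); apply/funext => r; apply/funext => w.
  by rewrite big_cons.
- exact: jointly_measurable_sum.
- by move=> r w; apply: sumr_ge0.
Qed.

(** A real integral is the difference of the integrals of two nonnegative functions,
    for which Tonelli's theorem gives measurability. *)
Lemma measurable_time_Rintegral (R : realType) (disp : measure_display)
    (T : measurableType disp) (D : set R) (f : R -> T -> R) :
  measurable D -> jointly_measurable D f ->
  (forall w, lebesgue_measure.-integrable D (EFin \o f ^~ w)) ->
  measurable_fun [set: T] (fun w => \int[lebesgue_measure]_(s in D) f s w).
Proof.
move=> mD mf If.
have mD' : @measurable _ (measurableTypeR R) D by exact: mD.
have mabs : jointly_measurable D (fun s w => `|f s w|).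
  by apply: measurableT_comp mf; exact: normr_measurable.
have Iabs w : lebesgue_measure.-integrable D (EFin \o (fun s => `|f s w|)).
  exact: integrable_norm (If w).
have Isum w : lebesgue_measure.-integrable D (EFin \o (fun s => f s w + `|f s w|)).
  exact: (integrableD mD' (If w) (Iabs w)).
have -> : (fun w => \int[lebesgue_measure]_(s in D) f s w) =
    (fun w => \int[lebesgue_measure]_(s in D) (f s w + `|f s w|) -
              \int[lebesgue_measure]_(s in D) `|f s w|).
  apply/funext => w; rewrite -(RintegralB mD' (Isum w) (Iabs w)).
  by apply: eq_Rintegral => s _; rewrite addrK.
have mfine (g : R -> T -> R) : jointly_measurable D g -> (forall s w, 0 <= g s w) ->
    measurable_fun [set: T] (fun w => \int[lebesgue_measure]_(s in D) g s w).
  move=> mg g0; apply: measurableT_comp; first exact: fine_measurable.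
  exact: measurable_time_integral.
apply: measurable_funB; apply: mfine => //.
  exact: jointly_measurableD.
by move=> s w; have := ler_norm (- f s w); rewrite normrN; lra.
Qed.

Section sde_decomposition.
Context (R : realType) (d N : nat) (hN : (0 < N)%N)
  (fs : 'I_N -> 'cV[R]_d -> R).
Hypothesis hC3 : forall i, is_Ck 3 (fs i).
Hypothesis hsigma : (sigma_star2 fs < +oo)%E.
Variables (h : R) (psi b : R -> R).
Hypotheses (hh : 0 < h) (cpsi : continuous psi) (cb : continuous b).
Hypothesis hpsi01 : forall s : R, 0 <= s -> 0 <= psi s <= 1.
Hypothesis hb1 : forall s : R, 1 <= b s.
Context (disp : measure_display) (T : measurableType disp) (P : probability T R).
Variables (F : R -> set (set T)) (B : R -> T -> 'cV[R]_d).
Hypotheses (hF : is_filtration F) (hB : brownian_motion P F B).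
Variables (x0 : 'cV[R]_d) (X : R -> T -> 'cV[R]_d).
Hypothesis cX : forall w, continuous (X ^~ w).
Variables (psi' b' : R -> R) (X' : R -> T -> 'cV[R]_d).
Hypothesis hX : is_sde_solution P F B
    (fun s x => - (psi' s *: grad (average fs) x))
    (fun s x => (psi' s * Num.sqrt (h / b' s)) *: sigmaMB fs x)
    x0 X'.
Hypotheses (psiE : forall s, 0 <= s -> psi' s = psi s)
  (bE : forall s, 0 <= s -> b' s = b s) (XE : forall s, 0 <= s -> X' s = X s).

Local Notation f := (average fs).

Definition drift (k : 'I_d) (s : R) (w : T) : R := psi s * grad f (X s w) k 0.

(** This bounds the squared Frobenius norm of the diffusion coefficient. *)
Definition kappa (s : R) : R := h * (d%:R * fine (sigma_star2 fs)) * (psi s ^+ 2 / b s).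

(** Defined path by path from [X] and its drift, so that the decomposition of [X]
    holds for every outcome; it agrees with the stochastic integral only almost
    surely, separately for each time. *)
Definition martingale_part (s : R) (w : T) : 'cV[R]_d :=
  X s w - x0 + \col_k (\int[lebesgue_measure]_(r in `[0, s]) drift k r w).

Lemma continuous_drift k w : continuous (drift k ^~ w).
Proof.
move=> s; apply: cvgM; first exact: cpsi.
apply: (@cvg_comp _ _ _ (X ^~ w) (fun x => grad f x k 0)); first exact: cX.
exact: (continuous_partial_average hC3).
Qed.

Lemma X_measurable_in s k : 0 <= s -> measurable_in (F s) (fun w => X s w k 0).
Proof. by move=> s0; case: hX => aX _ _ _ _ U mU; rewrite -XE//; exact: aX. Qed.

Lemma measurable_X s k : 0 <= s -> measurable_fun [set: T] (fun w => X s w k 0).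
Proof. by move=> s0; apply: (filtration_measurable hF s0); exact: X_measurable_in. Qed.

Lemma measurable_grad s k : 0 <= s -> measurable_fun [set: T] (fun w => grad f (X s w) k 0).
Proof.
move=> s0; apply: (@measurable_fun_continuous_coords _ _ _ _ (fun x => grad f x k 0)).
  exact: (continuous_partial_average hC3).
by move=> i; exact: measurable_X.
Qed.

Lemma drift_jointly_measurable k u v : 0 <= u ->
  jointly_measurable `[u, v] (fun s w => drift k s w).
Proof.
move=> u0; apply: jointly_measurable_continuous => // [s s0|w].
  by apply: measurable_funM; [exact: measurable_cst|exact: measurable_grad].
exact: continuous_drift.
Qed.

Lemma drift_integrable k u v w :
  lebesgue_measure.-integrable `[u, v] (EFin \o (fun s => drift k s w)).
Proof. by apply: continuous_segment_integrable; exact: continuous_drift. Qed.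

Lemma martingale_part_increment u v w : 0 <= u -> u <= v ->
  X v w = X u w - \col_k (\int[lebesgue_measure]_(r in `[u, v]) drift k r w) +
    (martingale_part v w - martingale_part u w).
Proof.
move=> u0 uv; apply/colP => k; rewrite !mxE.
have := @Rintegral_itvB _ (drift k ^~ w) (BLeft 0) (BRight v) u (drift_integrable k 0 v w).
rewrite !bnd_simp => /(_ u0 uv).
rewrite Rintegral_itv_obnd_cbnd; last first.
  by apply: integrableS (drift_integrable k u v w) => //; exact: subset_itv_oc_cc.
by move=> <-; ring.
Qed.

Lemma martingale_part_ae s : 0 <= s -> exists I : T -> 'cV[R]_d,
  is_ito_integral P F B s
    (fun s w => (psi' s * Num.sqrt (h / b' s)) *: sigmaMB fs (X' s w)) I /\
  {ae P, forall w, martingale_part s w = I w}.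
Proof.
move=> s0; have [_ _ _ _ /(_ s s0) [I [hI aeI]]] := hX.
exists I; split => //; apply: filterS aeI => w E.
rewrite /martingale_part -XE// {1}E; apply/colP => k; rewrite !mxE.
have -> : \int[lebesgue_measure]_(r in `[0, s]) (- (psi' r *: grad f (X' r w))) k 0 =
    - \int[lebesgue_measure]_(r in `[0, s]) drift k r w.
  rewrite -mulN1r -RintegralZl//; last exact: drift_integrable.
  apply: eq_Rintegral => r; rewrite inE /= in_itv/= => /andP[r0 _].
  by rewrite mxE mxE mulN1r psiE// XE.
by rewrite /drift; ring.
Qed.

Lemma measurable_martingale_part s k : 0 <= s ->
  measurable_fun [set: T] (fun w => martingale_part s w k 0).
Proof.
move=> s0.
have -> : (fun w => martingale_part s w k 0) = (fun w => X s w k 0 - x0 k 0 +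
    \int[lebesgue_measure]_(r in `[0, s]) drift k r w).
  by apply/funext => w; rewrite !mxE.
apply: measurable_funD; first by apply: measurable_funB => //; exact: measurable_X.
apply: measurable_time_Rintegral.
- exact: measurable_itv.
- exact: drift_jointly_measurable.
- by move=> w; exact: drift_integrable.
Qed.

Lemma X0_ae : {ae P, forall w, X 0 w = x0}.
Proof. by rewrite -XE//; case: hX. Qed.

Section increments.
Variables (u v : R).
Hypotheses (u0 : 0 <= u) (uv : u <= v).

Let v0 : 0 <= v. Proof. exact: le_trans uv. Qed.

Let increment k (w : T) : R := martingale_part v w k 0 - martingale_part u w k 0.

Lemma measurable_increment k : measurable_fun [set: T] (increment k).
Proof. by apply: measurable_funB; exact: measurable_martingale_part. Qed.

Let H s w := (psi' s * Num.sqrt (h / b' s)) *: sigmaMB fs (X' s w).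

Let increments_ito : exists Iu Iv : T -> 'cV[R]_d,
  [/\ is_ito_integral P F B u H Iu, is_ito_integral P F B v H Iv
    & forall k, {ae P, forall w, increment k w = Iv w k 0 - Iu w k 0}].
Proof.
have [Iu [hIu aeu]] := martingale_part_ae u0.
have [Iv [hIv aev]] := martingale_part_ae v0.
exists Iu, Iv; split; [exact: hIu|exact: hIv|move=> k].
by apply: filterS2 aeu aev => w Eu Ev; rewrite /increment Eu Ev.
Qed.

Let msq_increment k Iu Iv :
  is_ito_integral P F B u H Iu -> is_ito_integral P F B v H Iv ->
  {ae P, forall w, increment k w = Iv w k 0 - Iu w k 0} ->
  (msq P (increment k) <= dint P `[u, v] (fun s w => \sum_j H s w k j ^+ 2)%R)%E.
Proof.
move=> hIu hIv ae; apply: le_trans (ito_increment_msq hF hB u0 uv hIu hIv k).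
have [_ _ _ mIu _] := hIu; have [_ _ _ mIv _] := hIv.
rewrite le_eqVlt; apply/orP; left; apply/eqP; apply: ge0_ae_eq_integral => //.
- by apply/measurable_EFinP; apply: measurable_funX; exact: measurable_increment.
- by apply/measurable_EFinP; apply: measurable_funX; exact: measurable_funB.
- by move=> w _; rewrite lee_fin sqr_ge0.
- by move=> w _; rewrite lee_fin sqr_ge0.
- by apply: filterS ae => w E _; rewrite E.
Qed.

Lemma increment_sq_integrable k : sq_integrable P (increment k).
Proof.
have [Iu [Iv [hIu hIv ae]]] := increments_ito.
apply: sq_integrableP; first exact: measurable_increment.
apply: le_lt_trans (msq_increment hIu hIv (ae k)) _.
exact: (ito_energy_fin u0 hIv k).
Qed.

(** Transfer of the property of stochastic integrals, to which the increment is
    almost surely equal. *)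
Lemma increment_orthogonal k (Z : T -> R) : measurable_in (F u) Z ->
  sq_integrable P Z -> \int[P]_w (Z w * increment k w) = 0.
Proof.
move=> mZ sZ; have [Iu [Iv [hIu hIv ae]]] := increments_ito.
rewrite -(ito_increment_orthogonal hF hB u0 uv hIu hIv k mZ sZ) /Rintegral.
have [mZ' _] := sZ.
have [_ _ _ mIu _] := hIu; have [_ _ _ mIv _] := hIv.
congr fine; apply: ae_eq_integral => //.
- by apply/measurable_EFinP; apply: measurable_funM => //; exact: measurable_increment.
- by apply/measurable_EFinP; apply: measurable_funM => //; exact: measurable_funB.
- by apply: filterS (ae k) => w E _; rewrite E.
Qed.

Lemma kappa_ge0 s : 0 <= kappa s.
Proof.
have [sg0 _] := sigmaMB_norm x0 hsigma.
apply: mulr_ge0; first by apply: mulr_ge0; [exact: ltW|exact: mulr_ge0].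
by apply: divr_ge0; [exact: sqr_ge0|rewrite (le_trans ler01)// hb1].
Qed.

Lemma diffusion_norm s w : 0 <= s -> \sum_i \sum_j H s w i j ^+ 2 <= kappa s.
Proof.
move=> s0; have [sg0 hs] := sigmaMB_norm (X s w) hsigma.
have b0 : 0 < b s by rewrite (lt_le_trans ltr01)// hb1.
have -> : \sum_i \sum_j H s w i j ^+ 2 =
    (psi s * Num.sqrt (h / b s)) ^+ 2 * enorm (sigmaMB fs (X s w)) ^+ 2.
  rewrite enorm_sqr mulr_sumr; apply: eq_bigr => i _; rewrite mulr_sumr.
  by apply: eq_bigr => j _; rewrite /H (psiE s0) (bE s0) (XE s0) mxE exprMn.
have hb0 : 0 <= h / b s by apply: divr_ge0; exact: ltW.
rewrite exprMn sqr_sqrtr//.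
apply: (@le_trans _ _ (psi s ^+ 2 * (h / b s) * (d%:R * fine (sigma_star2 fs)))).
  by apply: ler_wpM2l => //; apply: mulr_ge0 => //; exact: sqr_ge0.
by rewrite /kappa le_eqVlt; apply/orP; left; apply/eqP; ring.
Qed.

Lemma continuous_kappa : continuous kappa.
Proof.
move=> s; apply: cvgM; first exact: cvg_cst.
apply: cvgM; first exact: (cvgM (cpsi (x := s)) (cpsi (x := s))).
apply: cvgV; last exact: cb.
by rewrite gt_eqF// (lt_le_trans ltr01)// hb1.
Qed.

Lemma kappa_integrable : lebesgue_measure.-integrable `[u, v] (EFin \o kappa).
Proof. exact: continuous_segment_integrable continuous_kappa. Qed.

(** The isometry, row by row, and the bound on the diffusion coefficient. *)
Lemma increments_msq :
  (\sum_k msq P (increment k) <= (\int[lebesgue_measure]_(s in `[u, v]) kappa s)%:E)%E.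
Proof.
have [Iu [Iv [hIu hIv ae]]] := increments_ito.
apply: (@le_trans _ _ (\sum_k dint P `[u, v] (fun s w => \sum_j H s w k j ^+ 2)%R)%E).
  by apply: lee_sum => k _; exact: (msq_increment hIu hIv).
have mseg : measurable (`[u, v]%classic : set R) by exact: measurable_itv.
have jmH i j : jointly_measurable `[u, v] (fun s w => H s w i j).
  have [mH _ _ _ _] := hIv.
  apply: (@jointly_measurableS _ _ _ _ `[0, v]%classic); [exact: measurable_itv| |exact: mH].
  by move=> s /=; rewrite !in_itv/= => /andP[us ->]; rewrite (le_trans u0).
have jm i : jointly_measurable `[u, v] (fun s w => \sum_j H s w i j ^+ 2).
  by apply: jointly_measurable_sum => j; exact: jointly_measurableX.
rewrite -dint_sum//; last by move=> i s w; apply: sumr_ge0 => j _; exact: sqr_ge0.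
have mk := measurable_int _ kappa_integrable.
rewrite EFin_Rintegral//; last exact: kappa_integrable.
apply: (@le_trans _ _ (\int[P]_w \int[lebesgue_measure]_(s in `[u, v]) (kappa s)%:E)%E); last first.
  rewrite integral_cst// [X in (_ * X)%E]probability_setT mule1//.
apply: ge0_le_integral => //.
- move=> w _; apply: integral_ge0 => s _; rewrite lee_fin.
  by apply: sumr_ge0 => i _; apply: sumr_ge0 => j _; exact: sqr_ge0.
- apply: measurable_time_integral => //; first exact: jointly_measurable_sum.
  by move=> s w; apply: sumr_ge0 => i _; apply: sumr_ge0 => j _; exact: sqr_ge0.
- move=> w _; apply: ge0_le_integral => //.
  + move=> s _; rewrite lee_fin.
    by apply: sumr_ge0 => i _; apply: sumr_ge0 => j _; exact: sqr_ge0.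
  + apply/measurable_EFinP.
    exact: (jointly_measurable_section mseg w (jointly_measurable_sum _ jm)).
  + move=> s /=; rewrite in_itv/= => /andP[us _]; rewrite lee_fin.
    by apply: diffusion_norm; exact: le_trans us.
Qed.

End increments.

End sde_decomposition.

(** * Primitives and Gronwall's lemma *)

Section time_primitive.
Context {R : realType}.
Implicit Types y a : R -> R.
Local Notation mu := lebesgue_measure.

(** The lower bound [c] is to the left of [s] so that the derivative is two-sided. *)
Lemma is_derive_primitive y (s c : R) : continuous y -> c < s ->
  is_derive s 1 (fun x => \int[mu]_(r in `[c, x]) y r) (y s).
Proof.
move=> cy cs.
have s1 : s < s + 1 by rewrite ltrDl.
have [d1 d2] := @continuous_FTC1_closed R y c s (s + 1) s1
  (continuous_segment_integrable _ _ cy) cs (cy s).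
by rewrite -d2 derive1E; split.
Qed.

Lemma Rintegral_segment_chasles y (a b c : R) : continuous y -> a <= b -> b <= c ->
  \int[mu]_(r in `[a, c]) y r = \int[mu]_(r in `[a, b]) y r + \int[mu]_(r in `[b, c]) y r.
Proof.
move=> cy ab bc.
have := @Rintegral_itvB _ y (BLeft a) (BRight c) b (continuous_segment_integrable _ _ cy).
rewrite !bnd_simp => /(_ ab bc).
rewrite Rintegral_itv_obnd_cbnd; last first.
  apply: integrableS (continuous_segment_integrable b c cy) => //.
  exact: subset_itv_oc_cc.
by move=> <-; ring.
Qed.

Lemma continuous_primitive y : continuous y ->
  continuous (fun s : R => \int[mu]_(r in `[0, Num.max s 0]) y r).
Proof.
move=> cy.
have E (s : R) : \int[mu]_(r in `[0, Num.max s 0]) y r =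
    \int[mu]_(r in `[-1, Num.max s 0]) y r - \int[mu]_(r in `[-1, 0]) y r.
  rewrite (@Rintegral_segment_chasles y (-1) 0)//; first by ring.
  by rewrite le_max lexx orbT.
under eq_fun do rewrite E.
move=> s; apply: cvgB; last exact: cvg_cst.
apply: (@cvg_comp _ _ _ (fun s : R => Num.max s 0)
  (fun x => \int[mu]_(r in `[-1, x]) y r)); first exact: continuous_maxr0.
have h : -1 < Num.max s 0 :> R by rewrite lt_max ltrN10 orbT.
have [dF _] := is_derive_primitive cy h.
by move/derivable1_diffP : dF => /differentiable_continuous; exact.
Qed.

Lemma le_segment_integral y a (u v : R) : continuous y -> continuous a ->
  (forall s, u <= s -> s <= v -> y s <= a s) ->
  \int[mu]_(r in `[u, v]) y r <= \int[mu]_(r in `[u, v]) a r.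
Proof.
move=> cy ca h; apply: le_Rintegral.
- exact: measurable_segment.
- exact: continuous_segment_integrable.
- exact: continuous_segment_integrable.
- by move=> s /=; rewrite in_itv/= => /andP[]; exact: h.
Qed.

Lemma Rintegral_segment_cst (c u v : R) : u <= v ->
  \int[mu]_(r in `[u, v]) c = c * (v - u).
Proof.
move=> uv; rewrite Rintegral_cst; last exact: measurable_segment.
congr (_ * _); rewrite /= lebesgue_measure_itv/= lte_fin; case: ifPn => //.
by rewrite -leNgt => vu; rewrite /=; lra.
Qed.

(** With [U] and [A] the primitives of [y] and [a], the function [exp (- k s) U s -
    A s] vanishes at [0] and has a nonpositive derivative.  The bound is on the
    integral of [y] and linear in [a], so that it can be averaged over all outcomes. *)
Lemma gronwall y a (k t : R) : continuous y -> continuous a -> 0 <= k -> 0 < t ->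
  (forall s, 0 <= s -> s <= t -> 0 <= a s) ->
  (forall s, 0 <= s -> s <= t -> y s <= a s + k * \int[mu]_(r in `[0, s]) y r) ->
  \int[mu]_(r in `[0, t]) y r <= expR (k * t) * \int[mu]_(r in `[0, t]) a r.
Proof.
move=> cy ca k0 t0 a0 h.
pose U s := \int[mu]_(r in `[0, s]) y r; pose A s := \int[mu]_(r in `[0, s]) a r.
pose W (s : R) := expR (- k * s) * U s - A s.
pose dW (s : R) : R := - k * expR (- k * s) * U s + expR (- k * s) * y s - a s.
have isd (s : R) : 0 < s -> is_derive s 1 W (dW s).
  move=> s0; have dU := is_derive_primitive cy s0; have dA := is_derive_primitive ca s0.
  have de : is_derive s 1 (fun s : R => expR (- k * s)) (expR (- k * s) * - k).
    have h1 : is_derive s 1 (fun s : R => - k * s) (- k).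
      have := @is_deriveZ R R R id (- k) s 1 1 (is_derive_id s 1).
      by rewrite /GRing.scale/= mulr1.
    exact: (is_derive1_comp (is_derive_expR (- k * s)) h1).
  have -> : W = (fun s : R => expR (- k * s)) * U - A by [].
  have dUA := is_deriveB (is_deriveM de dU) dA.
  by apply: (is_derive_eq dUA); rewrite /dW /GRing.scale /= -/(U s); ring.
have dW0 (s : R) : 0 < s -> s <= t -> dW s <= 0.
  move=> s0 st; have hs := h s (ltW s0) st; have as0 := a0 s (ltW s0) st.
  have e0 : 0 <= expR (- k * s) by exact: expR_ge0.
  have e1 : expR (- k * s) <= 1.
    by rewrite -[leRHS]expR0 ler_expR mulNr oppr_le0 mulr_ge0// ltW.
  have hh : expR (- k * s) * (y s - k * U s) <= expR (- k * s) * a s.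
    by apply: ler_wpM2l => //; rewrite /U; lra.
  have h2 : expR (- k * s) * a s <= a s by rewrite ler_piMl.
  rewrite /dW; lra.
have U0 : U 0 = 0 by rewrite /U set_itv1 Rintegral_set1.
have A0 : A 0 = 0 by rewrite /A set_itv1 Rintegral_set1.
have cW : {within `[0, t], continuous W}.
  pose W' (s : R) := expR (- k * s) * U (Num.max s 0) - A (Num.max s 0).
  apply: (@subspace_eq_continuous _ _ _ W').
    move=> s; rewrite inE /= in_itv/= => /andP[s0 _].
    by rewrite /W /W' max_l.
  apply: continuous_subspaceT => s; apply: cvgB; last exact: continuous_primitive.
  apply: cvgM; last exact: continuous_primitive.
  apply: (@cvg_comp _ _ _ (fun s : R => - k * s) expR); last exact: continuous_expR.
  by apply: cvgM; [exact: cvg_cst|exact: cvg_id].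
have isd' (s : R) : s \in `]0, t[ -> is_derive s 1 W (dW s).
  by rewrite in_itv/= => /andP[s0 _]; exact: isd.
have [c c01 E] := MVT t0 isd' cW.
move: c01; rewrite in_itv/= => /andP[c0 ct].
have : W t - W 0 <= 0 by rewrite E subr0; apply: mulr_le0_ge0; [exact: (dW0 c c0 (ltW ct))|exact: ltW].
rewrite /W U0 A0 mulr0 !subr0 subr_le0 => hW.
by rewrite -ler_pdivrMl ?expR_gt0// -expRN -mulNr.
Qed.

(** Cauchy-Schwarz: integrate [(y - c)^2 >= 0], where [c] is the mean of [y] on [[u,
    v]]. *)
Lemma Rintegral_sqr_le y (u v : R) : continuous y -> u <= v ->
  (\int[mu]_(r in `[u, v]) y r) ^+ 2 <= (v - u) * \int[mu]_(r in `[u, v]) y r ^+ 2.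
Proof.
move=> cy; rewrite le_eqVlt => /predU1P[<-|uv].
  by rewrite set_itv1 !Rintegral_set1 mulr0 expr0n.
have d0 : 0 < v - u by rewrite subr_gt0.
set I := \int[mu]_(r in `[u, v]) y r; pose c := I / (v - u).
have cy2 : continuous (fun r => y r ^+ 2).
  by move=> s; exact: (cvgM (cy s) (cy s)).
have I2 := continuous_segment_integrable u v cy2.
have I1 := continuous_segment_integrable u v cy.
have : \int[mu]_(r in `[u, v]) (2 * c * y r) <= \int[mu]_(r in `[u, v]) (y r ^+ 2 + c ^+ 2).
  apply: le_segment_integral.
  - by move=> s; apply: cvgM; [exact: cvg_cst|exact: (cy s)].
  - by move=> s; apply: cvgD; [exact: (cy2 s)|exact: cvg_cst].
  - by move=> s _ _; have := sqr_ge0 (y s - c); nra.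
have Ic : mu.-integrable `[u, v] (EFin \o (fun=> c ^+ 2)).
  by apply: continuous_segment_integrable => s; exact: cvg_cst.
rewrite (RintegralZl (2 * c) (measurable_segment u v) I1).
rewrite (RintegralD (measurable_segment u v) I2 Ic).
rewrite (Rintegral_segment_cst _ (ltW uv)) -[X in _ * X <= _]/I.
set Q := (X in _ <= X + _); rewrite -[X in _ <= _ * X]/Q.
have -> : 2 * c * I = 2 * (I ^+ 2 / (v - u)) by rewrite /c; ring.
have -> : c ^+ 2 * (v - u) = I ^+ 2 / (v - u) by rewrite /c; field; rewrite gt_eqF.
move=> hq; rewrite -ler_pdivrMl// mulrC; lra.
Qed.

End time_primitive.

(** * Moment bounds for the solution *)

Section nonnegative_expectations.
Context d (T : measurableType d) (R : realType) (P : probability T R).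
Implicit Types f g : T -> R.

(** The expectation of a nonnegative function, with value in the extended reals so
    that no integrability has to be checked beforehand. *)
Definition nnexp f : \bar R := (\int[P]_w (f w)%:E)%E.

Lemma nnexp_le f g : measurable_fun [set: T] f -> measurable_fun [set: T] g ->
  (forall w, 0 <= f w) -> (forall w, f w <= g w) -> (nnexp f <= nnexp g)%E.
Proof.
move=> mf mg f0 fg; apply: ge0_le_integral => //.
- by move=> w _; rewrite lee_fin.
- exact/measurable_EFinP.
- exact/measurable_EFinP.
- by move=> w _; rewrite lee_fin.
Qed.

Lemma nnexp_lin (a b : R) f g : 0 <= a -> 0 <= b ->
  measurable_fun [set: T] f -> measurable_fun [set: T] g ->
  (forall w, 0 <= f w) -> (forall w, 0 <= g w) ->
  (nnexp (fun w => a * f w + b * g w)%R = a%:E * nnexp f + b%:E * nnexp g)%E.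
Proof.
move=> a0 b0 mf mg f0 g0; rewrite /nnexp -!ge0_integralZl_EFin//; do ?[
  by move=> w _; rewrite lee_fin | exact/measurable_EFinP].
rewrite -ge0_integralD//.
- by move=> w _; rewrite -EFinM lee_fin mulr_ge0.
- by apply: measurable_funeM; exact/measurable_EFinP.
- by move=> w _; rewrite -EFinM lee_fin mulr_ge0.
- by apply: measurable_funeM; exact/measurable_EFinP.
Qed.

Lemma nnexp_le_lin (a b x y : R) (h f g : T -> R) : 0 <= a -> 0 <= b ->
  measurable_fun [set: T] h -> measurable_fun [set: T] f -> measurable_fun [set: T] g ->
  (forall w, 0 <= h w) -> (forall w, 0 <= f w) -> (forall w, 0 <= g w) ->
  (forall w, h w <= a * f w + b * g w) ->
  (nnexp f <= x%:E)%E -> (nnexp g <= y%:E)%E ->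
  (nnexp h <= (a * x + b * y)%:E)%E.
Proof.
move=> a0 b0 mh mf mg h0 f0 g0 hfg fx gy.
apply: (@le_trans _ _ (nnexp (fun w => a * f w + b * g w))).
  by apply: nnexp_le => //; apply: measurable_funD; exact: measurable_funM.
rewrite nnexp_lin// EFinD !EFinM.
by apply: leeD; apply: lee_wpmul2l => //; rewrite lee_fin.
Qed.

Lemma nnexp_ge0 f : (forall w, 0 <= f w) -> (0 <= nnexp f)%E.
Proof. by move=> f0; apply: integral_ge0 => w _; rewrite lee_fin. Qed.

Lemma nnexp_ae f g : measurable_fun [set: T] f -> measurable_fun [set: T] g ->
  (forall w, 0 <= f w) -> (forall w, 0 <= g w) ->
  {ae P, forall w, f w = g w} -> nnexp f = nnexp g.
Proof.
move=> mf mg f0 g0 ae; apply: ge0_ae_eq_integral => //.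
- exact/measurable_EFinP.
- exact/measurable_EFinP.
- by move=> w _; rewrite lee_fin.
- by move=> w _; rewrite lee_fin.
- by apply: filterS ae => w E _; rewrite E.
Qed.

Lemma nnexp_cst (c : R) : nnexp (fun=> c) = c%:E.
Proof. by rewrite /nnexp integral_cst// [X in (_ * X)%E]probability_setT mule1. Qed.

Lemma measurable_enorm_sqr n (Z : T -> 'cV[R]_n) :
  (forall k, measurable_fun [set: T] (fun w => Z w k 0)) ->
  measurable_fun [set: T] (fun w => enorm (Z w) ^+ 2).
Proof.
move=> mZ; under eq_fun do rewrite enorm_sqr_col.
by apply: measurable_sum => k; exact: measurable_funX.
Qed.

Lemma nnexp_enorm_sqr n (Z : T -> 'cV[R]_n) :
  (forall k, measurable_fun [set: T] (fun w => Z w k 0)) ->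
  (nnexp (fun w => enorm (Z w) ^+ 2)%R = \sum_k msq P (fun w => Z w k 0)%R)%E.
Proof.
move=> mZ; rewrite /nnexp /msq -ge0_integral_sum//.
- by apply: eq_integral => w _; rewrite enorm_sqr_col sumEFin.
- by move=> k; apply/measurable_EFinP; exact: measurable_funX.
- by move=> k w _; rewrite lee_fin sqr_ge0.
Qed.

End nonnegative_expectations.

(** Path by path, the real integral of a continuous function is finite. *)
Lemma nnexp_time_integral (R : realType) (disp : measure_display)
    (T : measurableType disp) (P : probability T R) (u v : R) (y : R -> T -> R) :
  (forall w, continuous (y ^~ w)) ->
  nnexp P (fun w => \int[lebesgue_measure]_(s in `[u, v]) y s w) = dint P `[u, v] y.
Proof.
move=> cy; apply: eq_integral => w _.
rewrite EFin_Rintegral//.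
exact: (continuous_segment_integrable u v (cy w)).
Qed.

Lemma dint_segment_le (R : realType) (disp : measure_display)
    (T : measurableType disp) (P : probability T R) (u v c : R) (y : R -> T -> R) :
  0 <= u -> u <= v -> 0 <= c ->
  (forall s, 0 <= s -> measurable_fun [set: T] (y s)) ->
  (forall w, continuous (y ^~ w)) -> (forall s w, 0 <= y s w) ->
  (forall s, u <= s -> s <= v -> (nnexp P (y s) <= c%:E)%E) ->
  (dint P `[u, v] y <= (c * (v - u))%:E)%E.
Proof.
move=> u0 uv c0 my cy y0 hy.
have mseg : measurable (`[u, v]%classic : set R) by exact: measurable_itv.
have jm : jointly_measurable `[u, v] y by exact: jointly_measurable_continuous.
apply: (le_trans (dint_le_cst mseg jm y0 c0 _)).
  by move=> s /=; rewrite in_itv/= => /andP[]; exact: hy.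
rewrite EFinM lee_wpmul2l ?lee_fin// lebesgue_measure_itv/= lte_fin.
by case: ifPn => // _; rewrite lee_fin subr_ge0.
Qed.

Lemma measurable_segment_integral (R : realType) (disp : measure_display)
    (T : measurableType disp) (u v : R) (y : R -> T -> R) : 0 <= u ->
  (forall s, 0 <= s -> measurable_fun [set: T] (y s)) ->
  (forall w, continuous (y ^~ w)) ->
  measurable_fun [set: T] (fun w => \int[lebesgue_measure]_(s in `[u, v]) y s w).
Proof.
move=> u0 my cy; apply: measurable_time_Rintegral.
- exact: measurable_itv.
- exact: jointly_measurable_continuous.
- by move=> w; exact: continuous_segment_integrable.
Qed.

Lemma nnexp_segment_integral_le (R : realType) (disp : measure_display)
    (T : measurableType disp) (P : probability T R) (u v c : R) (y : R -> T -> R) :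
  0 <= u -> u <= v -> 0 <= c ->
  (forall s, 0 <= s -> measurable_fun [set: T] (y s)) ->
  (forall w, continuous (y ^~ w)) -> (forall s w, 0 <= y s w) ->
  (forall s, u <= s -> s <= v -> (nnexp P (y s) <= c%:E)%E) ->
  (nnexp P (fun w => \int[lebesgue_measure]_(s in `[u, v]) y s w)%R <= (c * (v - u))%:E)%E.
Proof. by move=> *; rewrite nnexp_time_integral//; exact: dint_segment_le. Qed.

Lemma segment_integral_ge0 (R : realType) (y : R -> R) (u v : R) :
  (forall s, 0 <= y s) -> 0 <= \int[lebesgue_measure]_(s in `[u, v]) y s.
Proof. by move=> y0; apply: Rintegral_ge0 => s _. Qed.

Lemma continuous_sum (R : realType) (U : topologicalType) (I : Type) (s : seq I)
    (F : I -> U -> R) : (forall i, continuous (F i)) ->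
  continuous (fun x => \sum_(i <- s) F i x).
Proof. by move=> cF; apply: continuous_big => [|i _]; [exact: add_continuous|exact: cF]. Qed.

Section moments.
Context (R : realType) (d : nat) (disp : measure_display) (T : measurableType disp)
  (P : probability T R).
Variables (f : 'cV[R]_d -> R) (L : R).
Hypotheses (L0 : 0 <= L)
  (Lip : forall z z', enorm (grad f z - grad f z') ^+ 2 <= L ^+ 2 * enorm (z - z') ^+ 2)
  (cgrad : forall k, continuous (fun x => grad f x k 0)).
Variable psi : R -> R.
Hypotheses (cpsi : continuous psi) (psi01 : forall s, 0 <= s -> 0 <= psi s <= 1).
Variables (X M : R -> T -> 'cV[R]_d) (x0 : 'cV[R]_d) (kc : R).
Hypotheses (cX : forall w, continuous (X ^~ w))
  (mX : forall s k, 0 <= s -> measurable_fun [set: T] (fun w => X s w k 0))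
  (mM : forall s k, 0 <= s -> measurable_fun [set: T] (fun w => M s w k 0))
  (X0 : {ae P, forall w, X 0 w = x0}).

Let drift k s w : R := psi s * grad f (X s w) k 0.

Hypothesis decomp : forall u v w, 0 <= u -> u <= v ->
  X v w = X u w - \col_k (\int[lebesgue_measure]_(r in `[u, v]) drift k r w)
    + (M v w - M u w).
Hypotheses (kc0 : 0 <= kc) (Mmsq : forall u v, 0 <= u -> u <= v ->
  (\sum_k msq P (fun w => M v w k 0 - M u w k 0)%R <= (kc * (v - u))%:E)%E).

Definition gradsq s w : R := enorm (grad f (X s w)) ^+ 2.
Definition distsq u s w : R := enorm (X s w - X u w) ^+ 2.

Let gradsq_ge0 s w : 0 <= gradsq s w. Proof. exact: sqr_ge0. Qed.
Let distsq_ge0 u s w : 0 <= distsq u s w. Proof. exact: sqr_ge0. Qed.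

Lemma measurable_grad_path s k : 0 <= s ->
  measurable_fun [set: T] (fun w => grad f (X s w) k 0).
Proof.
move=> s0; apply: (@measurable_fun_continuous_coords _ _ _ _ (fun x => grad f x k 0)).
  exact: cgrad.
by move=> i; exact: mX.
Qed.

Lemma measurable_gradsq s : 0 <= s -> measurable_fun [set: T] (gradsq s).
Proof. by move=> s0; apply: measurable_enorm_sqr => k; exact: measurable_grad_path. Qed.

Lemma measurable_distsq u s : 0 <= u -> 0 <= s -> measurable_fun [set: T] (distsq u s).
Proof.
move=> u0 s0; apply: measurable_enorm_sqr => k.
under eq_fun do rewrite !mxE.
by apply: measurable_funB; exact: mX.
Qed.

Lemma continuous_grad_path k w : continuous (fun s => grad f (X s w) k 0).
Proof.
by move=> s; apply: (@cvg_comp _ _ _ (X ^~ w) (fun x => grad f x k 0)); [exact: cX|exact: cgrad].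
Qed.

Lemma continuous_enorm_sqr (Z : R -> 'cV[R]_d) :
  (forall k, continuous (fun s => Z s k 0)) -> continuous (fun s => enorm (Z s) ^+ 2).
Proof.
move=> cZ; rewrite (_ : (fun s => _) = (fun s => \sum_k Z s k 0 * Z s k 0)).
  by apply: continuous_sum => k s; exact: (cvgM (cZ k s) (cZ k s)).
by apply/funext => s; rewrite enorm_sqr_col; apply: eq_bigr => k _; rewrite expr2.
Qed.

Lemma continuous_gradsq w : continuous (gradsq ^~ w).
Proof. by apply: continuous_enorm_sqr => k; exact: continuous_grad_path. Qed.

Lemma continuous_coord k w : continuous (fun s => X s w k 0).
Proof.
move=> s; apply: (@cvg_comp _ _ _ (X ^~ w) (fun x : 'cV[R]_d => x k 0)); first exact: cX.
exact: coord_continuous.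
Qed.

Lemma continuous_distsq u w : continuous (distsq u ^~ w).
Proof.
apply: continuous_enorm_sqr => k.
rewrite (_ : (fun s => _) = (fun s => X s w k 0 - X u w k 0)); last first.
  by apply/funext => s; rewrite !mxE.
by move=> s; apply: cvgB; [exact: continuous_coord|exact: cvg_cst].
Qed.

Lemma continuous_drift_path k w : continuous (drift k ^~ w).
Proof. by move=> s; apply: cvgM; [exact: cpsi|exact: continuous_grad_path]. Qed.

(** Cauchy-Schwarz in time, and [psi <= 1]. *)
Lemma drift_integral_sqr_le u v w : 0 <= u -> u <= v ->
  enorm (\col_k (\int[lebesgue_measure]_(r in `[u, v]) drift k r w)) ^+ 2 <=
  (v - u) * \int[lebesgue_measure]_(r in `[u, v]) gradsq r w.
Proof.
move=> u0 uv; rewrite enorm_sqr_col.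
have cd2 k : continuous (fun r => drift k r w ^+ 2).
  by move=> s; exact: (cvgM (continuous_drift_path (w := w) (x := s)) (continuous_drift_path (w := w) (x := s))).
apply: (@le_trans _ _ (\sum_k ((v - u) * \int[lebesgue_measure]_(r in `[u, v]) drift k r w ^+ 2))).
  apply: ler_sum => k _; rewrite mxE.
  exact: (Rintegral_sqr_le (continuous_drift_path (k := k) (w := w)) uv).
rewrite -mulr_sumr ler_wpM2l ?subr_ge0//.
rewrite -Rintegral_bigsum; last 2 first.
- exact: measurable_segment.
- by move=> k; exact: continuous_segment_integrable.
apply: le_segment_integral; last 1 first.
- move=> s us sv; rewrite /gradsq enorm_sqr_col; apply: ler_sum => k _.
  have /andP[p0 p1] := psi01 (le_trans u0 us).
  rewrite /drift exprMn ler_piMl ?sqr_ge0// expr_le1//.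
- exact: continuous_sum.
- exact: continuous_gradsq.
Qed.

Lemma gradsq_le u s w : gradsq s w <= 2 * gradsq u w + 2 * L ^+ 2 * distsq u s w.
Proof.
have := enorm_sqr_add_le (grad f (X u w)) (grad f (X s w) - grad f (X u w)).
rewrite addrC subrK => h; apply: (le_trans h).
by rewrite lerD2l -mulrA ler_wpM2l.
Qed.

Lemma distsq_le u v w : 0 <= u -> u <= v ->
  distsq u v w <= 2 * enorm (M v w - M u w) ^+ 2 +
    2 * (v - u) * \int[lebesgue_measure]_(r in `[u, v]) gradsq r w.
Proof.
move=> u0 uv; rewrite /distsq (decomp w u0 uv).
set D := \col_k _.
have -> : X u w - D + (M v w - M u w) - X u w = (M v w - M u w) + (- D).
  by rewrite addrAC [X u w - D]addrC addrK addrC.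
apply: (le_trans (enorm_sqr_add_le _ _)); rewrite lerD2l -mulrA ler_wpM2l//.
rewrite -scaleN1r enorm_sqr_scale sqrrN expr1n mul1r.
exact: drift_integral_sqr_le.
Qed.

Lemma nnexp_martingale_increment u v : 0 <= u -> u <= v ->
  (nnexp P (fun w => enorm (M v w - M u w) ^+ 2)%R <= (kc * (v - u))%:E)%E.
Proof.
move=> u0 uv; have v0 := le_trans u0 uv.
rewrite nnexp_enorm_sqr; last first.
  move=> k; under eq_fun do rewrite !mxE.
  by apply: measurable_funB; exact: mM.
rewrite (eq_bigr (fun k => msq P (fun w => M v w k 0 - M u w k 0))) ?Mmsq// => k _.
by congr msq; apply/funext => w; rewrite !mxE.
Qed.


Let noise s w : 'cV[R]_d := X s w - X 0 w +
  \col_k (\int[lebesgue_measure]_(r in `[0, Num.max s 0]) drift k r w).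

Let noiseE s w : 0 <= s -> noise s w = M s w - M 0 w.
Proof.
move=> s0; have E := decomp w (lexx 0) s0; rewrite /noise E max_l//.
by rewrite addrAC addrC !addrA -addrA; apply/colP => k; rewrite !mxE; ring.
Qed.

Let continuous_noise w k : continuous (fun s => noise s w k 0).
Proof.
rewrite (_ : (fun s => _) = (fun s => X s w k 0 - X 0 w k 0 +
    \int[lebesgue_measure]_(r in `[0, Num.max s 0]) drift k r w)); last first.
  by apply/funext => s; rewrite !mxE.
move=> s; apply: cvgD; first by apply: cvgB; [exact: continuous_coord|exact: cvg_cst].
exact: continuous_primitive (continuous_drift_path (k := k) (w := w)) s.
Qed.

Let measurable_noise s : 0 <= s -> measurable_fun [set: T] (fun w => enorm (noise s w) ^+ 2).
Proof.
move=> s0; apply: measurable_enorm_sqr => k.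
under eq_fun do rewrite noiseE// !mxE.
by apply: measurable_funB; exact: mM.
Qed.

Lemma nnexp_gradsq0 : nnexp P (gradsq 0) = (enorm (grad f x0) ^+ 2)%:E.
Proof.
rewrite -(nnexp_cst P); apply: nnexp_ae => //.
- exact: measurable_gradsq.
- by move=> w; exact: sqr_ge0.
- by apply: filterS X0 => w E; rewrite /gradsq E.
Qed.

Variable t : R.
Hypothesis t0 : 0 < t.

Let g0 : R := enorm (grad f x0) ^+ 2.
Let k : R := 4 * t * L ^+ 2.
Let source s w : R := 2 * enorm (noise s w) ^+ 2 + 4 * t ^+ 2 * gradsq 0 w.
Let A : R := 2 * (kc * t) + 4 * t ^+ 2 * g0.
Let D : R := expR (k * t) * (A * t).

Let t20 : 0 <= 4 * t ^+ 2. Proof. by apply: mulr_ge0 => //; exact: sqr_ge0. Qed.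
Let k0 : 0 <= k. Proof. by rewrite /k; have := sqr_ge0 L; have := ltW t0; nra. Qed.
Let g00 : 0 <= g0. Proof. exact: sqr_ge0. Qed.
Let A0 : 0 <= A.
Proof.
apply: addr_ge0; last exact: mulr_ge0.
by apply: mulr_ge0 => //; apply: mulr_ge0 => //; exact: ltW.
Qed.

Let source_ge0 s w : 0 <= source s w.
Proof.
apply: addr_ge0; last exact: (mulr_ge0 t20 (gradsq_ge0 0 w)).
by apply: mulr_ge0 => //; exact: sqr_ge0.
Qed.

Let measurable_source s : 0 <= s -> measurable_fun [set: T] (source s).
Proof.
move=> s0; apply: measurable_funD; apply: measurable_funM => //; first exact: measurable_noise.
exact: measurable_gradsq.
Qed.

Let continuous_source w : continuous (source ^~ w).
Proof.
move=> s; apply: cvgD; last exact: cvg_cst.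
apply: cvgM; first exact: cvg_cst.
by apply: continuous_enorm_sqr => i; exact: continuous_noise.
Qed.

Let nnexp_source s : 0 <= s -> s <= t -> (nnexp P (source s) <= A%:E)%E.
Proof.
move=> s0 st; apply: (@nnexp_le_lin _ _ _ P 2 (4 * t ^+ 2) (kc * t) g0 (source s)
    (fun w => enorm (noise s w) ^+ 2) (gradsq 0)).
- exact: ler0n.
- exact: t20.
- exact: measurable_source.
- exact: measurable_noise.
- exact: measurable_gradsq.
- exact: source_ge0.
- by move=> w; exact: sqr_ge0.
- exact: gradsq_ge0.
- by move=> w; exact: lexx.
- have -> : (fun w => enorm (noise s w) ^+ 2) = (fun w => enorm (M s w - M 0 w) ^+ 2).
    by apply/funext => w; rewrite noiseE.
  apply: (le_trans (nnexp_martingale_increment (lexx 0) s0)).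
  by rewrite lee_fin subr0 ler_wpM2l.
- by rewrite nnexp_gradsq0.
Qed.

Let distsq0_le s w : 0 <= s -> s <= t ->
  distsq 0 s w <= source s w + k * \int[lebesgue_measure]_(r in `[0, s]) distsq 0 r w.
Proof.
move=> s0 st; have := distsq_le w (lexx 0) s0; rewrite -noiseE// subr0 => h.
apply: (le_trans h); rewrite /source -addrA lerD2l.
have cG := @continuous_gradsq w; have cD := @continuous_distsq 0 w.
have h1 : \int[lebesgue_measure]_(r in `[0, s]) gradsq r w <=
   \int[lebesgue_measure]_(r in `[0, s]) (2 * gradsq 0 w + 2 * L ^+ 2 * distsq 0 r w).
  apply: le_segment_integral => //.
  - move=> r; apply: cvgD; first exact: cvg_cst.
    by apply: cvgM; [exact: cvg_cst|exact: cD].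
  - by move=> r _ _; exact: gradsq_le.
have Ic : lebesgue_measure.-integrable `[0, s] (EFin \o (fun=> 2 * gradsq 0 w)).
  by apply: continuous_segment_integrable => r; exact: cvg_cst.
have ID : lebesgue_measure.-integrable `[0, s] (EFin \o (fun r => 2 * L ^+ 2 * distsq 0 r w)).
  by apply: continuous_segment_integrable => r; apply: cvgM; [exact: cvg_cst|exact: cD].
rewrite (RintegralD (measurable_segment 0 s) Ic ID) in h1.
rewrite (Rintegral_segment_cst _ s0) subr0 in h1.
rewrite (RintegralZl (2 * L ^+ 2) (measurable_segment 0 s)
  (continuous_segment_integrable 0 s cD)) in h1.
have I0 : 0 <= \int[lebesgue_measure]_(r in `[0, s]) distsq 0 r w.
  by apply: segment_integral_ge0 => r; exact: distsq_ge0.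
set I := (X in 2 * L ^+ 2 * X) in h1.
rewrite -[X in _ <= _ + k * X]/I; rewrite -/I in I0.
have t0' := ltW t0; have G0 := gradsq_ge0 0 w; have L20 := sqr_ge0 L.
apply: (@le_trans _ _ (2 * s * (2 * gradsq 0 w * s + 2 * L ^+ 2 * I))).
  by rewrite ler_wpM2l// mulr_ge0.
have -> : 4 * t ^+ 2 * gradsq 0 w + k * I = 2 * t * (2 * gradsq 0 w * t + 2 * L ^+ 2 * I).
  by rewrite /k; ring.
apply: ler_pM.
- by rewrite mulr_ge0.
- by rewrite addr_ge0// mulr_ge0// mulr_ge0.
- by rewrite ler_wpM2l.
- by rewrite lerD2r ler_wpM2l// mulr_ge0.
Qed.

Let total_distance_le :
  (nnexp P (fun w => \int[lebesgue_measure]_(s in `[0, t]) distsq 0 s w)%R <= D%:E)%E.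
Proof.
have mD : measurable_fun [set: T] (fun w => \int[lebesgue_measure]_(s in `[0, t]) distsq 0 s w).
  apply: measurable_segment_integral => // [s s0|w]; first exact: measurable_distsq.
  exact: continuous_distsq.
have mS : measurable_fun [set: T] (fun w => \int[lebesgue_measure]_(s in `[0, t]) source s w).
  by apply: measurable_segment_integral.
have e0 : 0 <= expR (k * t) by exact: expR_ge0.
have hS : (nnexp P (fun w => \int[lebesgue_measure]_(s in `[0, t]) source s w)%R <= (A * t)%:E)%E.
  rewrite -[X in A * X]subr0; apply: nnexp_segment_integral_le => //.
  exact: ltW.
have := @nnexp_le_lin _ _ _ P (expR (k * t)) 0 (A * t) 0 _ _ (fun=> 0) e0 (lexx 0)
  mD mS (@measurable_cst _ _ _ _ _ _).
rewrite mul0r addr0; apply => //.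
- by move=> w; apply: segment_integral_ge0 => s; exact: distsq_ge0.
- by move=> w; apply: segment_integral_ge0 => s; exact: source_ge0.
- move=> w; rewrite addr0.
  apply: (gronwall (@continuous_distsq 0 w) (@continuous_source w) k0 t0).
  + by move=> s _ _; exact: source_ge0.
  + by move=> s s0 st; exact: distsq0_le.
- by rewrite nnexp_cst.
Qed.

(** Path by path, the squared distance to the starting point is at most a source
    term plus a multiple of its own time integral.  Gronwall's lemma bounds this
    time integral by that of the source, whose expectation is controlled by the
    isometry; inserting the result into the first inequality gives the bounds at
    each time. *)
Lemma moment_bounds : exists C : R, [/\ 0 <= C,
  forall s, 0 <= s -> s <= t -> (nnexp P (gradsq s) <= C%:E)%E,
  forall s, 0 <= s -> s <= t -> (nnexp P (distsq 0 s) <= C%:E)%E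
  & forall u v, 0 <= u -> u <= v -> v <= t ->
      (nnexp P (distsq u v) <= (C * (v - u))%:E)%E].
Proof.
have D0 : 0 <= D by rewrite /D mulr_ge0 ?expR_ge0// mulr_ge0// ltW.
pose C1 := 1 * A + k * D; pose C2 := 2 * g0 + 2 * L ^+ 2 * C1.
pose C3 := 2 * kc + 2 * (C2 * t).
have L20 : 0 <= 2 * L ^+ 2 by rewrite mulr_ge0// sqr_ge0.
have C10 : 0 <= C1 by rewrite /C1 mul1r addr_ge0// mulr_ge0.
have C20 : 0 <= C2 by rewrite /C2 addr_ge0// mulr_ge0.
have C30 : 0 <= C3 by rewrite /C3 addr_ge0// mulr_ge0// mulr_ge0// ltW.
have h1 s : 0 <= s -> s <= t -> (nnexp P (distsq 0 s) <= C1%:E)%E.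
  move=> s0 st; apply: (@nnexp_le_lin _ _ _ P 1 k A D _ (source s)
    (fun w => \int[lebesgue_measure]_(r in `[0, t]) distsq 0 r w)).
  - exact: ler01.
  - exact: k0.
  - by apply: measurable_distsq.
  - exact: measurable_source.
  - apply: measurable_segment_integral => // [r r0|w]; first exact: measurable_distsq.
    exact: continuous_distsq.
  - exact: distsq_ge0.
  - exact: source_ge0.
  - by move=> w; apply: segment_integral_ge0 => r; exact: distsq_ge0.
  - move=> w; rewrite mul1r; apply: (le_trans (distsq0_le w s0 st)).
    rewrite lerD2l ler_wpM2l//.
    rewrite (Rintegral_segment_chasles (@continuous_distsq 0 w) s0 st) lerDl.
    by apply: segment_integral_ge0 => r; exact: distsq_ge0.
  - exact: nnexp_source.
  - exact: total_distance_le.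
have h2 s : 0 <= s -> s <= t -> (nnexp P (gradsq s) <= C2%:E)%E.
  move=> s0 st; apply: (@nnexp_le_lin _ _ _ P 2 (2 * L ^+ 2) g0 C1 _
    (gradsq 0) (distsq 0 s)).
  - exact: ler0n.
  - exact: L20.
  - exact: measurable_gradsq.
  - exact: measurable_gradsq.
  - exact: measurable_distsq.
  - exact: gradsq_ge0.
  - exact: gradsq_ge0.
  - exact: distsq_ge0.
  - by move=> w; exact: gradsq_le.
  - by rewrite nnexp_gradsq0.
  - exact: h1.
have h3 u v : 0 <= u -> u <= v -> v <= t ->
    (nnexp P (distsq u v) <= (C3 * (v - u))%:E)%E.
  move=> u0 uv vt.
  have -> : C3 * (v - u) = 2 * (kc * (v - u)) + (2 * t) * (C2 * (v - u)).
    by rewrite /C3; ring.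
  apply: (@nnexp_le_lin _ _ _ P 2 (2 * t) _ _ _
    (fun w => enorm (M v w - M u w) ^+ 2)
    (fun w => \int[lebesgue_measure]_(r in `[u, v]) gradsq r w)).
  - exact: ler0n.
  - by rewrite mulr_ge0// ltW.
  - by apply: measurable_distsq => //; exact: le_trans uv.
  - apply: measurable_enorm_sqr => i; under eq_fun do rewrite !mxE.
    by apply: measurable_funB; apply: mM => //; exact: le_trans uv.
  - apply: measurable_segment_integral => // [r r0|w]; first exact: measurable_gradsq.
    exact: continuous_gradsq.
  - exact: distsq_ge0.
  - by move=> w; exact: sqr_ge0.
  - by move=> w; apply: segment_integral_ge0 => r; exact: gradsq_ge0.
  - move=> w; apply: (le_trans (distsq_le w u0 uv)); rewrite lerD2l.
    apply: ler_wpM2r; first by apply: segment_integral_ge0 => r; exact: gradsq_ge0.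
    by rewrite ler_wpM2l//; lra.
  - exact: nnexp_martingale_increment.
  - apply: nnexp_segment_integral_le.
    + exact: u0.
    + exact: uv.
    + exact: C20.
    + by move=> s s0; exact: measurable_gradsq.
    + by move=> w; exact: continuous_gradsq.
    + exact: gradsq_ge0.
    + move=> s us sv; apply: h2; first exact: le_trans us.
      exact: le_trans vt.
exists (C1 + C2 + C3); split.
- exact: (addr_ge0 (addr_ge0 C10 C20) C30).
- move=> s s0 st; apply: (le_trans (h2 s s0 st)); rewrite lee_fin.
  by rewrite addrAC lerDr; exact: addr_ge0.
- move=> s s0 st; apply: (le_trans (h1 s s0 st)); rewrite lee_fin.
  by rewrite -addrA lerDl; exact: addr_ge0.
- move=> u v u0 uv vt; apply: (le_trans (h3 u v u0 uv vt)); rewrite lee_fin.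
  by rewrite ler_wpM2r ?subr_ge0// lerDr; exact: addr_ge0.
Qed.

End moments.

(** * Energy dissipation along a grid *)

Section mean_bounds.
Context d (T : measurableType d) (R : realType) (P : probability T R).
Implicit Types f g : T -> R.

(** The three facts about a nonnegative variable that are combined in a chain of
    mean estimates. *)
Definition mean_le f (c : R) : Prop :=
  [/\ measurable_fun [set: T] f, forall w, 0 <= f w & (nnexp P f <= c%:E)%E].

Lemma mean_le_lin (a b x y : R) f g : 0 <= a -> 0 <= b ->
  mean_le f x -> mean_le g y -> mean_le (fun w => a * f w + b * g w) (a * x + b * y).
Proof.
move=> a0 b0 [mf f0 fx] [mg g0 gy].
have mh : measurable_fun [set: T] (fun w => a * f w + b * g w).
  by apply: measurable_funD; exact: measurable_funM.
have h0 w : 0 <= a * f w + b * g w by apply: addr_ge0; apply: mulr_ge0.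
split; [exact: mh|exact: h0|].
exact: (nnexp_le_lin a0 b0 mh mf mg h0 f0 g0 (fun w => lexx _) fx gy).
Qed.

Lemma mean_le_scale (a x : R) f : 0 <= a -> mean_le f x ->
  mean_le (fun w => a * f w) (a * x).
Proof.
move=> a0 hf; have := mean_le_lin a0 (lexx 0) hf hf.
by rewrite mul0r addr0; under eq_fun do rewrite mul0r addr0.
Qed.

Lemma mean_le_add (x y : R) f g : mean_le f x -> mean_le g y ->
  mean_le (fun w => f w + g w) (x + y).
Proof.
move=> hf hg; have := mean_le_lin ler01 ler01 hf hg.
by rewrite !mul1r; under eq_fun do rewrite !mul1r.
Qed.

Lemma mean_le_integrable (x : R) f : mean_le f x ->
  P.-integrable [set: T] (EFin \o f).
Proof.
move=> [mf f0 fx]; apply/integrableP; split; first exact/measurable_EFinP.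
under eq_integral do rewrite /= ger0_norm//.
exact: le_lt_trans fx (ltry _).
Qed.

Lemma mean_leE (x : R) f : mean_le f x -> \int[P]_w f w <= x.
Proof.
move=> hf; have [mf f0 fx] := hf.
by rewrite -lee_fin EFin_Rintegral//; exact: (mean_le_integrable hf).
Qed.

Lemma mean_leP f : measurable_fun [set: T] f -> (forall w, 0 <= f w) ->
  P.-integrable [set: T] (EFin \o f) -> mean_le f (\int[P]_w f w).
Proof. by move=> mf f0 If; split => //; rewrite EFin_Rintegral. Qed.

(** A pathwise inequality with a mean-zero term on the right survives in expectation
    without that term, even though the latter has no sign. *)
Lemma mean_le_perturbed (x : R) (f g Z : T -> R) : mean_le g x ->
  P.-integrable [set: T] (EFin \o Z) -> \int[P]_w Z w = 0 ->
  measurable_fun [set: T] f -> (forall w, 0 <= f w) ->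
  (forall w, f w <= g w + Z w) -> mean_le f x.
Proof.
move=> hg IZ Z0 mf f0 fgZ; have Ig := mean_le_integrable hg.
have IgZ := integrable_add Ig IZ.
have If : P.-integrable [set: T] (EFin \o f).
  by apply: (integrable_le mf IgZ) => w; rewrite ger0_norm.
split; [exact: mf|exact: f0|].
rewrite /nnexp -(EFin_Rintegral measurableT If) lee_fin.
apply: (@le_trans _ _ (\int[P]_w (g w + Z w))).
  by apply: le_Rintegral.
rewrite (RintegralD measurableT Ig IZ) Z0 addr0; exact: mean_leE.
Qed.

End mean_bounds.

Definition uniform_grid (R : realType) (t : R) (n k : nat) : R := k%:R * (t / n%:R).

Section uniform_grid.
Context (R : realType) (t : R) (n : nat).
Hypotheses (t0 : 0 < t) (n0 : (0 < n)%N).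
Local Notation p := (uniform_grid t n).

Lemma uniform_grid_ge0 k : 0 <= p k.
Proof. by apply: mulr_ge0 => //; apply: divr_ge0 => //; exact: ltW. Qed.

Lemma uniform_gridS k : p k.+1 = p k + t / n%:R.
Proof. by rewrite /uniform_grid -natr1 mulrDl mul1r. Qed.

Lemma uniform_grid_leS k : p k <= p k.+1.
Proof. by rewrite uniform_gridS lerDl divr_ge0// ltW. Qed.

Lemma uniform_grid_le k : (k <= n)%N -> p k <= t.
Proof.
move=> kn; rewrite /uniform_grid mulrCA; apply: (ler_piMr (ltW t0)).
by rewrite ler_pdivrMr ?ltr0n// mul1r ler_nat.
Qed.

Lemma uniform_grid0 : p 0 = 0. Proof. exact: mul0r. Qed.

Lemma uniform_grid_last : p n = t.
Proof. by rewrite /uniform_grid mulrC divfK// pnatr_eq0 -lt0n. Qed.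

End uniform_grid.

Section energy.
Context (R : realType) (d : nat) (disp : measure_display) (T : measurableType disp)
  (P : probability T R).
Variables (f : 'cV[R]_d -> R) (L : R) (xstar : 'cV[R]_d).
Hypotheses (L0 : 0 <= L) (df : forall z, differentiable f z)
  (Lip : forall z z', enorm (grad f z - grad f z') ^+ 2 <= L ^+ 2 * enorm (z - z') ^+ 2)
  (cgrad : forall k, continuous (fun x => grad f x k 0))
  (fmin : forall x, f xstar <= f x).
Variable psi : R -> R.
Hypotheses (cpsi : continuous psi) (psi01 : forall s : R, 0 <= s -> 0 <= psi s <= 1).
Variables (X M : R -> T -> 'cV[R]_d) (x0 : 'cV[R]_d).
Variables (kappa : R -> R) (kc : R).
Hypotheses (cX : forall w, continuous (X ^~ w))
  (mX : forall (s : R) k, 0 <= s -> measurable_fun [set: T] (fun w => X s w k 0))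
  (mM : forall (s : R) k, 0 <= s -> measurable_fun [set: T] (fun w => M s w k 0))
  (X0 : {ae P, forall w, X 0 w = x0}).
Hypothesis decomp : forall (u v : R) w, 0 <= u -> u <= v ->
  X v w = X u w - \col_k (\int[lebesgue_measure]_(r in `[u, v]) (psi r * grad f (X r w) k 0))
    + (M v w - M u w).
Hypotheses (ckappa : continuous kappa)
  (kappa_le : forall s : R, 0 <= s -> kappa s <= kc) (kc0 : 0 <= kc).
Hypothesis msqM : forall (u v : R), 0 <= u -> u <= v ->
  (\sum_k msq P (fun w => M v w k 0 - M u w k 0)%R <=
   (\int[lebesgue_measure]_(s in `[u, v]) kappa s)%:E)%E.
Hypothesis orthM : forall (u v : R) k, 0 <= u -> u <= v ->
  sq_integrable P (fun w => grad f (X u w) k 0) ->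
  P.-integrable [set: T] (EFin \o (fun w => grad f (X u w) k 0 * (M v w k 0 - M u w k 0))) /\
  \int[P]_w (grad f (X u w) k 0 * (M v w k 0 - M u w k 0)) = 0.
Variable t : R.
Hypothesis t0 : 0 < t.

Definition gap s w : R := f (X s w) - f xstar.

Let gap_ge0 s w : 0 <= gap s w. Proof. by rewrite subr_ge0. Qed.
Let gradsq_ge0 s w : 0 <= gradsq f X s w. Proof. exact: sqr_ge0. Qed.
Let distsq_ge0 u s w : 0 <= distsq X u s w. Proof. exact: sqr_ge0. Qed.

Lemma measurable_gap s : 0 <= s -> measurable_fun [set: T] (gap s).
Proof.
move=> s0; apply: measurable_funB; last exact: measurable_cst.
apply: (@measurable_fun_continuous_coords _ _ _ _ f) => [x|i]; last exact: mX.
by apply: differentiable_continuous; exact: df.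
Qed.

Let cgradsq w : continuous (gradsq f X ^~ w).
Proof. exact: continuous_gradsq. Qed.

Let cdistsq u w : continuous (distsq X u ^~ w).
Proof. exact: continuous_distsq. Qed.

Let mgradsq s : 0 <= s -> measurable_fun [set: T] (gradsq f X s).
Proof. by move=> s0; exact: measurable_gradsq. Qed.

Let mdistsq u s : 0 <= u -> 0 <= s -> measurable_fun [set: T] (distsq X u s).
Proof. by move=> u0 s0; exact: measurable_distsq. Qed.

Let msqM_kc (u v : R) : 0 <= u -> u <= v ->
  (\sum_k msq P (fun w => M v w k 0 - M u w k 0)%R <= (kc * (v - u))%:E)%E.
Proof.
move=> u0 uv; apply: (le_trans (msqM u0 uv)).
rewrite lee_fin -(Rintegral_segment_cst kc uv); apply: le_segment_integral.
- exact: ckappa.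
- by move=> s; exact: cvg_cst.
- by move=> s us _; apply: kappa_le; exact: le_trans us.
Qed.

Let moments := moment_bounds Lip cgrad cpsi psi01 cX mX mM X0 decomp kc0 msqM_kc t0.

(** [G(X r)] is replaced by [G(X u)], at the price of Young's inequality with
    parameter [e] and the Lipschitz bound. *)
Lemma drift_projection_ge (e u v : R) w : 0 < e -> 0 <= u -> u <= v ->
  (\int[lebesgue_measure]_(r in `[u, v]) psi r) * gradsq f X u w
    - (e / 2 * (v - u) * gradsq f X u w
       + L ^+ 2 / (2 * e) * \int[lebesgue_measure]_(r in `[u, v]) distsq X u r w) <=
  dot (grad f (X u w))
    (\col_k (\int[lebesgue_measure]_(r in `[u, v]) (psi r * grad f (X r w) k 0))).
Proof.
move=> e0 u0 uv; set g := grad f (X u w).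
have cd k : continuous (fun r => psi r * grad f (X r w) k 0).
  exact: (continuous_drift_path cgrad cpsi cX).
have cG : continuous (fun r => psi r * gradsq f X u w).
  by move=> r; apply: cvgM; [exact: cpsi|exact: cvg_cst].
have cY : continuous (fun r => e / 2 * gradsq f X u w + L ^+ 2 / (2 * e) * distsq X u r w).
  move=> r; apply: cvgD; first exact: cvg_cst.
  by apply: cvgM; [exact: cvg_cst|exact: cdistsq].
have cdots : continuous (fun r => \sum_k g k 0 * (psi r * grad f (X r w) k 0)).
  by apply: continuous_sum => k r; apply: cvgM; [exact: cvg_cst|exact: cd].
have -> : dot g (\col_k (\int[lebesgue_measure]_(r in `[u, v]) (psi r * grad f (X r w) k 0))) =
    \int[lebesgue_measure]_(r in `[u, v]) (\sum_k g k 0 * (psi r * grad f (X r w) k 0)).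
  rewrite Rintegral_bigsum; last 2 first.
  - exact: measurable_segment.
  - move=> k; apply: continuous_segment_integrable => r.
    by apply: cvgM; [exact: cvg_cst|exact: cd].
  apply: eq_bigr => k _.
  rewrite (RintegralZl _ (measurable_segment u v) (continuous_segment_integrable u v (cd k))).
  by congr (_ * _); rewrite mxE.
have IG := continuous_segment_integrable u v cG.
have IY := continuous_segment_integrable u v cY.
have Ipsi := continuous_segment_integrable u v cpsi.
have Idist := continuous_segment_integrable u v (@cdistsq u w).
have Ic : lebesgue_measure.-integrable `[u, v] (EFin \o (fun=> e / 2 * gradsq f X u w)).
  by apply: continuous_segment_integrable => r; exact: cvg_cst.
have Id : lebesgue_measure.-integrable `[u, v]
    (EFin \o (fun r => L ^+ 2 / (2 * e) * distsq X u r w)).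
  apply: continuous_segment_integrable => r.
  by apply: cvgM; [exact: cvg_cst|exact: cdistsq].
have : \int[lebesgue_measure]_(r in `[u, v]) (psi r * gradsq f X u w -
    (e / 2 * gradsq f X u w + L ^+ 2 / (2 * e) * distsq X u r w)) <=
    \int[lebesgue_measure]_(r in `[u, v]) (\sum_k g k 0 * (psi r * grad f (X r w) k 0)).
  apply: le_segment_integral => [r|//|r ur rv].
    by apply: cvgB; [exact: cG|exact: cY].
  have /andP[p0 p1] := psi01 (le_trans u0 ur).
  have -> : \sum_k g k 0 * (psi r * grad f (X r w) k 0) =
      psi r * gradsq f X u w - psi r * dot g (g - grad f (X r w)).
    rewrite /gradsq -/g enorm_sqr_col /dot !mulr_sumr -sumrB.
    by apply: eq_bigr => k _; rewrite !mxE; ring.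
  rewrite lerD2l lerN2.
  have hy := young_dot g (g - grad f (X r w)) e0.
  have hL := Lip (X u w) (X r w); rewrite -/g [X in _ <= _ * X]enorm_sqr_sub_sym in hL.
  set Y := (X in _ <= X).
  have Y0 : 0 <= Y.
    rewrite /Y addr_ge0// mulr_ge0// ?divr_ge0 ?sqr_ge0// ltW//.
    by rewrite mulr_gt0.
  have dY : dot g (g - grad f (X r w)) <= Y.
    rewrite -(ler_pM2l (@ltr0n R 2)) (le_trans hy)// /Y /gradsq -/g.
    rewrite mulrDr; apply: lerD.
      by rewrite le_eqVlt; apply/orP; left; apply/eqP; field.
    have -> : 2 * (L ^+ 2 / (2 * e) * distsq X u r w) = e^-1 * (L ^+ 2 * distsq X u r w).
      by field; rewrite gt_eqF.
    have ei : 0 <= e^-1 by rewrite invr_ge0 ltW.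
    exact: (ler_wpM2l ei hL).
  apply: (le_trans (ler_wpM2l p0 dY)); exact: ler_piMl.
rewrite (RintegralB (measurable_segment u v) IG IY).
rewrite (RintegralD (measurable_segment u v) Ic Id).
rewrite (Rintegral_segment_cst _ uv) (RintegralZl _ (measurable_segment u v) Idist).
rewrite (RintegralZr _ (measurable_segment u v) Ipsi).
by rewrite [e / 2 * gradsq f X u w * _]mulrAC.
Qed.

(** The descent lemma between [X u] and [X v], with the increment of [X] decomposed.
    On the right, all terms but the last are nonnegative, and the last one has mean
    zero. *)
Lemma descent_step (e u v : R) w : 0 < e -> 0 <= u -> u <= v ->
  gap v w + (\int[lebesgue_measure]_(r in `[u, v]) psi r) * gradsq f X u w <=
  (gap u w + L / 2 * (1 + e) * enorm (M v w - M u w) ^+ 2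
   + (e / 2 * (v - u) * gradsq f X u w
      + L ^+ 2 / (2 * e) * \int[lebesgue_measure]_(r in `[u, v]) distsq X u r w
      + L / 2 * (1 + e^-1) * (v - u) * \int[lebesgue_measure]_(r in `[u, v]) gradsq f X r w))
  + dot (grad f (X u w)) (M v w - M u w).
Proof.
move=> e0 u0 uv.
have h1 := drift_projection_ge w e0 u0 uv.
have h2 := descent_lemma (X u w) (X v w) L0 df Lip.
have h3 := drift_integral_sqr_le cgrad cpsi psi01 cX w u0 uv.
move: h1 h3; have := decomp w u0 uv.
set I := \col_k _ => E h1 h3.
have E' : X v w - X u w = (M v w - M u w) + (- I).
  by rewrite E addrAC [X u w - I]addrC addrK addrC.
rewrite E' in h2.
have h4 : enorm (M v w - M u w + - I) ^+ 2 <=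
    (1 + e) * enorm (M v w - M u w) ^+ 2 + (1 + e^-1) * enorm I ^+ 2.
  rewrite !enorm_sqr_col !mulr_sumr -big_split /=; apply: ler_sum => k _.
  have -> : (M v w - M u w + - I) k 0 = (M v w - M u w) k 0 + (- (I k 0)) by rewrite !mxE.
  by rewrite -[X in _ + _ * X]sqrrN; exact: young_sqr.
have dE : dot (grad f (X u w)) (M v w - M u w + - I) =
    dot (grad f (X u w)) (M v w - M u w) - dot (grad f (X u w)) I.
  by rewrite /dot -sumrB; apply: eq_bigr => k _; rewrite -mulrBr; congr (_ * _); rewrite !mxE.
rewrite dE in h2.
have L20 : 0 <= L / 2 by rewrite divr_ge0.
have h5 := ler_wpM2l L20 h4.
have e10 : 0 <= L / 2 * (1 + e^-1) by rewrite mulr_ge0// addr_ge0// invr_ge0 ltW.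
have h6 := ler_wpM2l e10 h3.
rewrite /gap.
move: h1 h2 h5 h6.
set GM := dot _ (M v w - M u w); set GI := dot _ I.
set Ip := (\int[lebesgue_measure]_(r in `[u, v]) psi r).
set ID := (\int[lebesgue_measure]_(r in `[u, v]) distsq X u r w).
set IG := (\int[lebesgue_measure]_(r in `[u, v]) gradsq f X r w).
set n1 := enorm (_ + _) ^+ 2; set n2 := enorm (M v w - M u w) ^+ 2; set n3 := enorm I ^+ 2.
set q := gradsq f X u w; move=> h1 h2 h5 h6.
have -> : L / 2 * (1 + e^-1) * (v - u) * IG = L / 2 * (1 + e^-1) * ((v - u) * IG) by rewrite !mulrA.
have -> : L / 2 * (1 + e) * n2 = L / 2 * ((1 + e) * n2) by rewrite !mulrA.
have : L / 2 * ((1 + e) * n2 + (1 + e^-1) * n3) = L / 2 * ((1 + e) * n2) + L / 2 * (1 + e^-1) * n3.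
  by ring.
lra.
Qed.

Local Notation mean g := (\int[P]_w g w).

Let gap0_mean : mean_le P (gap 0) (f x0 - f xstar).
Proof.
split; [exact: measurable_gap|exact: gap_ge0|].
rewrite -(nnexp_cst P) le_eqVlt; apply/orP; left; apply/eqP; apply: nnexp_ae.
- exact: measurable_gap.
- exact: measurable_cst.
- exact: gap_ge0.
- by move=> w; rewrite subr_ge0.
- by apply: filterS X0 => w E; rewrite /gap E.
Qed.

(** This is the descent lemma from [X 0]; it shows that the gap has a finite
    expectation. *)
Lemma gap_le s w : gap s w <= gap 0 w + 2^-1 * gradsq f X 0 w + (2^-1 + L / 2) * distsq X 0 s w.
Proof.
have h1 := descent_lemma (X 0 w) (X s w) L0 df Lip.
have := young_dot (grad f (X 0 w)) (X s w - X 0 w) (@ltr01 R).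
rewrite mul1r invr1 mul1r /gap /gradsq /distsq; lra.
Qed.

Section energy_step.
Variable C : R.
Hypotheses (C0 : 0 <= C)
  (gradsqC : forall s : R, 0 <= s -> s <= t -> (nnexp P (gradsq f X s) <= C%:E)%E)
  (distsq0C : forall s : R, 0 <= s -> s <= t -> (nnexp P (distsq X 0 s) <= C%:E)%E)
  (distsqC : forall u v : R, 0 <= u -> u <= v -> v <= t ->
    (nnexp P (distsq X u v) <= (C * (v - u))%:E)%E).

Let gradsq_mean s : 0 <= s -> s <= t -> mean_le P (gradsq f X s) C.
Proof. by move=> s0 st; split; [exact: mgradsq|exact: gradsq_ge0|exact: gradsqC]. Qed.

Let gap_mean s : 0 <= s -> s <= t -> mean_le P (gap s) (mean (gap s)).
Proof.
move=> s0 st; apply: mean_leP; [exact: measurable_gap|exact: gap_ge0|].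
have h2 : 0 <= 2^-1 :> R by rewrite invr_ge0.
have h3 : 0 <= 2^-1 + L / 2 by rewrite addr_ge0// divr_ge0.
have hD : mean_le P (distsq X 0 s) C.
  by split; [exact: mdistsq|exact: distsq_ge0|exact: distsq0C].
have h := mean_le_add (mean_le_add gap0_mean
  (mean_le_scale h2 (gradsq_mean (lexx 0) (ltW t0)))) (mean_le_scale h3 hD).
apply: (integrable_le (measurable_gap s0) (mean_le_integrable h)) => w.
by rewrite ger0_norm ?gap_ge0//; exact: gap_le.
Qed.

Let grad_sq_integrable s k : 0 <= s -> s <= t ->
  sq_integrable P (fun w => grad f (X s w) k 0).
Proof.
move=> s0 st.
have mg : measurable_fun [set: T] (fun w => grad f (X s w) k 0).
  exact: measurable_grad_path.
apply: (sq_integrableP mg); apply: (@le_lt_trans _ _ (nnexp P (gradsq f X s))).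
  apply: nnexp_le.
  - exact: measurable_funX.
  - exact: mgradsq.
  - by move=> w; exact: sqr_ge0.
  - by move=> w; exact: entry_sqr_le_enorm.
by apply: (le_lt_trans (gradsqC s0 st)); exact: ltry.
Qed.

(** Expectation of [descent_step].  The error terms are collected into a multiple of
    [(v - u) (e + (v - u) / e)]. *)
Lemma energy_step (e u v : R) : 0 < e -> e <= 1 -> 0 <= u -> u <= v -> v <= t ->
  mean (gap v) + (\int[lebesgue_measure]_(r in `[u, v]) psi r) * mean (gradsq f X u) <=
  mean (gap u) + L / 2 * (1 + e) * (\int[lebesgue_measure]_(r in `[u, v]) kappa r)
  + (v - u) * (C * (1 + L + L ^+ 2) * (e + (v - u) / e)).
Proof.
move=> e0 e1 u0 uv vt; have ut := le_trans uv vt; have v0 := le_trans u0 uv.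
pose Ip := \int[lebesgue_measure]_(r in `[u, v]) psi r.
have Ip0 : 0 <= Ip.
  apply: Rintegral_ge0 => r /=; rewrite in_itv/= => /andP[ur _].
  by have /andP[] := psi01 (le_trans u0 ur).
have vu0 : 0 <= v - u by rewrite subr_ge0.
have ei0 : 0 <= e^-1 by rewrite invr_ge0 ltW.
have c1 : 0 <= L / 2 * (1 + e).
  by apply: mulr_ge0; [exact: divr_ge0|rewrite addr_ge0// ltW].
have c2 : 0 <= e / 2 * (v - u) by rewrite mulr_ge0// divr_ge0// ltW.
have c3 : 0 <= L ^+ 2 / (2 * e) by rewrite divr_ge0 ?sqr_ge0// mulr_ge0// ltW.
have c4 : 0 <= L / 2 * (1 + e^-1) * (v - u).
  by apply: mulr_ge0 => //; apply: mulr_ge0; [exact: divr_ge0|exact: addr_ge0].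
have hM : mean_le P (fun w => enorm (M v w - M u w) ^+ 2)
    (\int[lebesgue_measure]_(r in `[u, v]) kappa r).
  have mMk k : measurable_fun [set: T] (fun w => (M v w - M u w) k 0).
    under eq_fun do rewrite !mxE.
    by apply: measurable_funB; exact: mM.
  split; [exact: measurable_enorm_sqr|by move=> w; exact: sqr_ge0|].
  rewrite nnexp_enorm_sqr//.
  rewrite (eq_bigr (fun k => msq P (fun w => M v w k 0 - M u w k 0))) ?msqM// => k _.
  by congr msq; apply/funext => w; rewrite !mxE.
have hD : mean_le P (fun w => \int[lebesgue_measure]_(r in `[u, v]) distsq X u r w)
    (C * (v - u) * (v - u)).
  split.
  - by apply: measurable_segment_integral => [//|r r0|w]; [exact: mdistsq|exact: cdistsq].
  - by move=> w; apply: segment_integral_ge0 => r; exact: distsq_ge0.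
  - apply: (nnexp_segment_integral_le u0 uv).
    + exact: mulr_ge0.
    + by move=> r r0; exact: mdistsq.
    + by move=> w; exact: cdistsq.
    + exact: distsq_ge0.
    + move=> r ur rv; apply: (le_trans (distsqC u0 ur (le_trans rv vt))).
      by rewrite lee_fin ler_wpM2l// lerD2r.
have hG : mean_le P (fun w => \int[lebesgue_measure]_(r in `[u, v]) gradsq f X r w)
    (C * (v - u)).
  split.
  - by apply: measurable_segment_integral => [//|r r0|w]; [exact: mgradsq|exact: cgradsq].
  - by move=> w; apply: segment_integral_ge0 => r; exact: gradsq_ge0.
  - apply: (nnexp_segment_integral_le u0 uv C0).
    + by move=> r r0; exact: mgradsq.
    + by move=> w; exact: cgradsq.
    + exact: gradsq_ge0.
    + by move=> r ur rv; apply: gradsqC; [exact: le_trans ur|exact: le_trans vt].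
have hN := mean_le_add (mean_le_add (gap_mean u0 ut) (mean_le_scale c1 hM))
  (mean_le_add (mean_le_add (mean_le_scale c2 (gradsq_mean u0 ut)) (mean_le_scale c3 hD))
     (mean_le_scale c4 hG)).
have hk k := orthM u0 uv (grad_sq_integrable k u0 ut).
(* each coordinate of the increment of M is orthogonal to that of the gradient *)
have dotE w : dot (grad f (X u w)) (M v w - M u w) =
    \sum_k grad f (X u w) k 0 * (M v w k 0 - M u w k 0).
  by apply: eq_bigr => k _; congr (_ * _); rewrite !mxE.
have Idot : P.-integrable [set: T]
    (EFin \o (fun w => dot (grad f (X u w)) (M v w - M u w))).
  rewrite (_ : (fun w => _) = (fun w => \sum_k grad f (X u w) k 0 * (M v w k 0 - M u w k 0))).
    by apply: integrable_bigsum => // k; case: (hk k).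
  by apply/funext => w; exact: dotE.
have dot0 : \int[P]_w dot (grad f (X u w)) (M v w - M u w) = 0.
  under eq_Rintegral do rewrite dotE.
  rewrite Rintegral_bigsum//; last by move=> k; case: (hk k).
  by rewrite big1// => k _; case: (hk k).
have mA : measurable_fun [set: T] (fun w => gap v w + Ip * gradsq f X u w).
  apply: measurable_funD; first exact: measurable_gap.
  by apply: measurable_funM => //; exact: mgradsq.
have A0 w : 0 <= gap v w + Ip * gradsq f X u w.
  by rewrite addr_ge0// mulr_ge0.
have := mean_leE (mean_le_perturbed hN Idot dot0 mA A0
  (fun w => descent_step w e0 u0 uv)).
have Igap := mean_le_integrable (gap_mean v0 vt).
have Igrad := mean_le_integrable (gradsq_mean u0 ut).
rewrite (RintegralD measurableT Igap (integrable_scale Ip Igrad)).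
rewrite (RintegralZl Ip measurableT Igrad).
move/le_trans; apply; rewrite lerD2l.
have e10 : e^-1 >= 1 by rewrite invf_ge1.
have cd : 0 <= C * (v - u) by exact: mulr_ge0.
have -> : e / 2 * (v - u) * C + L ^+ 2 / (2 * e) * (C * (v - u) * (v - u)) +
    L / 2 * (1 + e^-1) * (v - u) * (C * (v - u)) =
  (C * (v - u)) * (e / 2 + L ^+ 2 * ((v - u) / e) / 2 + L / 2 * ((1 + e^-1) * (v - u))).
  by field; rewrite gt_eqF.
have -> : (v - u) * (C * (1 + L + L ^+ 2) * (e + (v - u) / e)) =
  (C * (v - u)) * ((1 + L + L ^+ 2) * (e + (v - u) / e)) by ring.
apply: ler_wpM2l => //.
have d0 : 0 <= (v - u) / e by exact: mulr_ge0.
(* this is where e <= 1 matters *)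
have h2 : (1 + e^-1) * (v - u) <= 2 * ((v - u) / e).
  have -> : 2 * ((v - u) / e) = (2 * e^-1) * (v - u) by ring.
  by rewrite ler_wpM2r//; lra.
have Lsq := sqr_ge0 L.
have L20 : 0 <= L / 2 by exact: divr_ge0.
have h3 := ler_wpM2l L20 h2.
have h4 : 0 <= L ^+ 2 * ((v - u) / e) by exact: mulr_ge0.
have h5 : 0 <= L ^+ 2 * e by rewrite mulr_ge0// ltW.
have h6 : 0 <= L * e by rewrite mulr_ge0// ltW.
have h7 : 0 <= L * ((v - u) / e) by exact: mulr_ge0.
move: h3 h4 h7 d0; set D := (v - u) / e => h3 h4 h7 d0.
have -> : (1 + L + L ^+ 2) * (e + D) = e + D + L * e + L * D + L ^+ 2 * e + L ^+ 2 * D by ring.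
have h8 : L / 2 * (2 * D) = L * D by field.
lra.
Qed.

Lemma energy_telescope (e : R) (n j : nat) (p := uniform_grid t n) :
  0 < e -> e <= 1 -> (0 < n)%N -> (j <= n)%N ->
  mean (gap (p j)) +
    \sum_(k < j) (\int[lebesgue_measure]_(r in `[p k, p k.+1]) psi r) * mean (gradsq f X (p k)) <=
  f x0 - f xstar + L / 2 * (1 + e) * (\int[lebesgue_measure]_(r in `[0, p j]) kappa r)
  + p j * (C * (1 + L + L ^+ 2) * (e + t / n%:R / e)).
Proof.
move=> e0 e1 n0 jn.
have p0 k : 0 <= p k by exact: uniform_grid_ge0.
elim: j jn => [|j ih] jn.
  rewrite big_ord0 addr0 [p 0]uniform_grid0 mul0r addr0 set_itv1 Rintegral_set1 mulr0 addr0.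
  exact: mean_leE gap0_mean.
have pj : p j <= p j.+1 by exact: uniform_grid_leS.
have h := energy_step e0 e1 (p0 j) pj (uniform_grid_le t0 n0 jn).
have ih' := ih (ltnW jn).
have E : p j.+1 - p j = t / n%:R by rewrite [p j.+1]uniform_gridS addrAC subrr add0r.
rewrite E in h.
rewrite big_ord_recr/= (Rintegral_segment_chasles ckappa (p0 j) pj) mulrDr.
move: h ih'; set Q := C * (1 + L + L ^+ 2) * (e + t / n%:R / e).
have -> : p j.+1 * Q = p j * Q + t / n%:R * Q by rewrite [p j.+1]uniform_gridS mulrDl.
set K1 := L / 2 * (1 + e) * _; set K2 := L / 2 * (1 + e) * _.
set S := \sum_(k < j) _; set G := _ * mean (gradsq f X (p j)).
set Q1 := p j * Q; set Q2 := t / n%:R * Q => h ih'.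
lra.
Qed.

End energy_step.

(** The telescoped inequality at the last grid point, where the expected gap is
    nonnegative. *)
Lemma energy_dissipation : exists C : R, [/\ 0 <= C,
  forall s : R, 0 <= s -> s <= t -> P.-integrable [set: T] (EFin \o gradsq f X s)
  & forall (e : R) (n : nat) (p := uniform_grid t n), 0 < e -> e <= 1 -> (0 < n)%N ->
    \sum_(k < n) (\int[lebesgue_measure]_(r in `[p k, p k.+1]) psi r) *
      (\int[P]_w gradsq f X (p k) w) <=
    f x0 - f xstar + L / 2 * (1 + e) * (\int[lebesgue_measure]_(r in `[0, t]) kappa r)
    + C * (e + t / n%:R / e)].
Proof.
have [C [C0 h1 h2 h3]] := moments.
exists (t * (C * (1 + L + L ^+ 2))); split.
- apply: mulr_ge0; first exact: ltW.
  by apply: mulr_ge0 => //; rewrite addr_ge0 ?sqr_ge0// addr_ge0.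
- by move=> s s0 st; apply: (@mean_le_integrable _ _ _ _ C); split; [exact: mgradsq|exact: gradsq_ge0|exact: h1].
- move=> e n p e0 e1 n0.
  have := energy_telescope C0 h1 h2 h3 e0 e1 n0 (leqnn n).
  rewrite uniform_grid_last// !mulrA; apply: le_trans.
  by rewrite lerDr; apply: Rintegral_ge0 => w _; exact: gap_ge0.
Qed.

End energy.

(** * Evaluation at an independent random time *)

(** Fatou's lemma for a pointwise convergent sequence. *)
Lemma nnexp_limit_le d (T : measurableType d) (R : realType) (P : probability T R)
    (Q : nat -> T -> R) (g : T -> R) (c : nat -> R) (B : R) :
  (forall n, measurable_fun [set: T] (Q n)) -> (forall n w, 0 <= Q n w) ->
  (forall w, Q n w @[n --> \oo] --> g w) ->
  (forall n, (nnexp P (Q n) <= (c n)%:E)%E) -> c n @[n --> \oo] --> B ->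
  (nnexp P g <= B%:E)%E.
Proof.
move=> mQ Q0 Qg hc cB.
have cE (u : nat -> R) (l : R) : u n @[n --> \oo] --> l -> (u n)%:E @[n --> \oo] --> l%:E.
  by move=> ul; apply: cvg_EFin; [exact: nearW|exact: ul].
have := @fatou _ T R P [set: T] measurableT (fun n w => (Q n w)%:E).
move=> /(_ (fun n => (measurable_EFinP _ _).2 (mQ n))).
have Q0' n w : [set: T] w -> (0 <= (Q n w)%:E)%E by rewrite lee_fin.
move=> /(_ Q0').
rewrite (eq_integral (fun w => (g w)%:E)); last first.
  by move=> w _; exact: ((cvg_limn_einf_sup (cE _ _ (Qg w))).1).
move=> h; apply: (le_trans h); rewrite limn_einf_lim.
rewrite -(cvg_lim (@ereal_hausdorff R) (cE _ _ cB)).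
apply: lee_lim; first exact: is_cvg_einfs.
  by apply/cvg_ex; exists B%:E; exact: cE.
apply: nearW => n; apply: (le_trans _ (hc n)).
by apply: ereal_inf_lbound; exists n => /=.
Qed.

Section random_time.
Context (R : realType) (disp : measure_display) (T : measurableType disp)
  (P : probability T R).
Variables (psi : R -> R) (phi t : R).
Hypotheses (cpsi : continuous psi) (phi0 : 0 < phi) (t0 : 0 < t).
Variable tau : T -> R.
Hypotheses (mtau : measurable_fun [set: T] tau)
  (tau_range : forall w, 0 <= tau w <= t)
  (tau_law : forall U : set R, measurable U ->
    P (tau @^-1` U) =
    (\int[lebesgue_measure]_(s in U `&` `[0%R, t]%classic) ((psi s / phi)%R)%:E)%E).
Variable q : R -> T -> R.
Hypotheses (mq : forall s : R, 0 <= s -> measurable_fun [set: T] (q s))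
  (cq : forall w, continuous (q ^~ w)) (q0 : forall s w, 0 <= q s w)
  (Iq : forall s : R, 0 <= s -> s <= t -> P.-integrable [set: T] (EFin \o q s))
  (indep : forall (s : R) (V U : set R), 0 <= s -> measurable V -> measurable U ->
    P (q s @^-1` V `&` tau @^-1` U) = (P (q s @^-1` V) * P (tau @^-1` U))%E).

Let cell n k : set R := `[uniform_grid t n k, uniform_grid t n k.+1[%classic.

Let mcell n k : measurable (cell n k). Proof. exact: measurable_itv. Qed.

Let Q n w : R := \sum_(k < n) \1_(cell n k) (tau w) * q (uniform_grid t n k) w.

Let mtau_cell n k : measurable_fun [set: T] (fun w => \1_(cell n k) (tau w) : R).
Proof. by apply: measurableT_comp => //; exact: measurable_indic. Qed.

Let Q_ge0 n w : 0 <= Q n w.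
Proof. by apply: sumr_ge0 => k _; apply: mulr_ge0. Qed.

Let measurable_Q n : (0 < n)%N -> measurable_fun [set: T] (Q n).
Proof.
move=> n0; apply: measurable_sum => k; apply: measurable_funM; first exact: mtau_cell.
by apply: mq; exact: uniform_grid_ge0.
Qed.

(** The cell is half-open; closing it does not change the Lebesgue integral. *)
Lemma random_time_cell n k : (k < n)%N ->
  \int[P]_w \1_(cell n k) (tau w) =
  (\int[lebesgue_measure]_(s in `[uniform_grid t n k, uniform_grid t n k.+1]) psi s) / phi.
Proof.
move=> kn; have n0 : (0 < n)%N by exact: leq_ltn_trans kn.
have p0 := uniform_grid_ge0 n t0 k.
have pt := uniform_grid_le t0 n0 kn.
have -> : \int[P]_w \1_(cell n k) (tau w) = fine (P (tau @^-1` (cell n k))).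
  rewrite /Rintegral -[in RHS](setIT (tau @^-1` cell n k)) -integral_indic//.
  by rewrite -[X in measurable X]setTI; exact: mtau.
rewrite tau_law//.
have -> : cell n k `&` `[0, t] = cell n k.
  apply/setIidl => s; rewrite /cell /= !in_itv/= => /andP[h1 h2].
  by rewrite (le_trans p0 h1) (ltW (lt_le_trans h2 pt)).
rewrite -[LHS]/(\int[lebesgue_measure]_(s in cell n k) (psi s / phi)).
have Ipsi := continuous_segment_integrable (uniform_grid t n k) (uniform_grid t n k.+1) cpsi.
have Ipsi' : lebesgue_measure.-integrable (cell n k) (EFin \o psi).
  apply: (integrableS (measurable_segment _ _) (mcell n k) _ Ipsi) => s.
  by rewrite /cell /= !in_itv/= => /andP[-> /ltW ->].
have mcell' : @measurable _ (measurableTypeR R) (cell n k) := mcell n k.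
rewrite (RintegralZr _ mcell' Ipsi'); congr (_ / _).
exact: Rintegral_itv_bndo_bndc.
Qed.

Let mean_Q n : (0 < n)%N ->
  (nnexp P (Q n) = (\sum_(k < n) (\int[lebesgue_measure]_(s in `[uniform_grid t n k, uniform_grid t n k.+1]) psi s)
    / phi * \int[P]_w q (uniform_grid t n k) w)%:E)%E.
Proof.
move=> n0.
have hk (k : 'I_n) : P.-integrable [set: T]
      (EFin \o (fun w => \1_(cell n k) (tau w) * q (uniform_grid t n k) w)) /\
    \int[P]_w (\1_(cell n k) (tau w) * q (uniform_grid t n k) w) =
    (\int[P]_w \1_(cell n k) (tau w)) * \int[P]_w q (uniform_grid t n k) w.
  have p0 := uniform_grid_ge0 n t0 k.
  apply: independent_expectation.
  - exact: mtau_cell.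
  - exact: mq.
  - apply: sq_integrable_integrable; apply: (@sq_integrable_bounded _ _ _ _ _ 1).
      exact: mtau_cell.
    by move=> w; rewrite indicE ger0_norm// lern1 leq_b1.
  - by apply: Iq => //; apply: uniform_grid_le => //; exact: ltnW.
  - move=> A V mA mV; rewrite setIC muleC.
    apply: (indep (U := \1_(cell n k) @^-1` A)) => //.
    rewrite -[X in measurable X]setTI.
    exact: (measurable_indic (mcell n k) measurableT mA).
rewrite /nnexp -EFin_Rintegral//; last by apply: integrable_bigsum => // k; case: (hk k).
rewrite Rintegral_bigsum//; last by move=> k; case: (hk k).
congr EFin; apply: eq_bigr => k _.
by have [_ ->] := hk k; rewrite random_time_cell.
Qed.

(** The value [0] at the right end point of [[0, t]], which lies in no cell, makes
    the convergence of [Q] hold everywhere; this event has probability zero. *)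
Let target w : R := if tau w < t then q (tau w) w else 0.

Let cvg_Q w : Q n.+1 w @[n --> \oo] --> target w.
Proof.
rewrite /target; case: ifPn => [ht|]; last first.
  rewrite -leNgt => ht; apply: cvg_near_cst; apply: nearW => n.
  rewrite /Q big1// => k _; rewrite indicE memNset ?mul0r//.
  rewrite /cell /= in_itv/= => /andP[_ h].
  have := lt_le_trans h (uniform_grid_le t0 (ltn0Sn n) (ltn_ord k)).
  by rewrite ltNge ht.
have /andP[tau0 _] := tau_range w.
have E n : Q n.+1 w = q (t * grid_approx n (tau w / t)) w.
  have x0 : 0 <= n.+1%:R * (tau w / t) by rewrite mulr_ge0// divr_ge0// ltW.
  have /andP[h1 h2] := floor_itv (n.+1%:R * (tau w / t)).
  have f0 : 0 <= Num.floor (n.+1%:R * (tau w / t)) by rewrite floor_ge0.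
  have fn : (`|Num.floor (n.+1%:R * (tau w / t))| < n.+1)%N.
    rewrite -ltz_nat gez0_abs// -(ltr_int R) (le_lt_trans h1)//.
    by rewrite gtr_pMr ?ltr0n// ltr_pdivrMr// mul1r.
  pose k0 := Ordinal fn.
  have gE (k : 'I_n.+1) : (\1_(cell n.+1 k) (tau w) : R) = (k == k0)%:R.
    rewrite indicE; congr (_%:R); congr nat_of_bool.
    have nt0 : 0 < n.+1%:R / t by rewrite divr_gt0.
    have pE (j : nat) : uniform_grid t n.+1 j = j%:R / (n.+1%:R / t).
      by rewrite /uniform_grid invf_div.
    have tE : tau w * (n.+1%:R / t) = n.+1%:R * (tau w / t) by rewrite mulrCA.
    have iff_cell : (tau w \in cell n.+1 k) =
        (k%:R <= n.+1%:R * (tau w / t) < k.+1%:R).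
      rewrite /cell -tE; apply/idP/idP; rewrite inE /= in_itv/= !pE.
        by rewrite ler_pdivrMr// ltr_pdivlMr.
      by rewrite ler_pdivrMr// ltr_pdivlMr.
    rewrite iff_cell; apply/idP/eqP => [h|->].
      have fE : Num.floor (n.+1%:R * (tau w / t)) = k%:Z.
        by apply: floor_def; rewrite intrD -pmulrn natr1.
      by apply: val_inj; rewrite /= fE.
    have kE : (k0%:R : R) = (Num.floor (n.+1%:R * (tau w / t)))%:~R.
      by rewrite /= natr_absz ger0_norm.
    rewrite -[k0.+1%:R]natr1 kE h1 /=; move: h2; rewrite intrD; exact.
  rewrite /Q (bigD1 k0)// gE eqxx mul1r big1; last first.
    by move=> k kk0; rewrite gE (negbTE kk0) mul0r.
  rewrite /= addr0; congr (q _ w); rewrite /uniform_grid /grid_approx /=.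
  by rewrite natr_absz ger0_norm// mulrCA.
under eq_cvg do rewrite E.
have lim : t * grid_approx n (tau w / t) @[n --> \oo] --> t * (tau w / t).
  by apply: cvgM; [exact: cvg_cst|exact: cvg_grid_approx].
have tauE : t * (tau w / t) = tau w by rewrite mulrC divfK// gt_eqF.
rewrite tauE in lim.
by apply: (@cvg_comp _ _ _ (fun n => t * grid_approx n (tau w / t)) (q ^~ w)) lim _; exact: cq.
Qed.

Let tau_lt_ae : {ae P, forall w, tau w < t}.
Proof.
have Pt0 : P (tau @^-1` [set t]) = 0%E.
  rewrite tau_law// (_ : [set t] `&` `[0, t] = [set t]) ?integral_set1//.
  by apply/setIidl => s /= ->; rewrite in_itv/= lexx ltW.
exists (tau @^-1` [set t]); split.
- by rewrite -[X in measurable X]setTI; exact: mtau.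
- exact: Pt0.
- move=> w /= h; have /andP[_ ht] := tau_range w.
  by apply/eqP; rewrite eq_le ht/= leNgt; apply/negP.
Qed.

(** Composition of the jointly measurable process with [w |-> (tau w, w)]. *)
Lemma measurable_random_time : measurable_fun [set: T] (fun w => q (tau w) w).
Proof.
have h : measurable_fun [set: R * T] (fun z : R * T => q (Num.max z.1 0) z.2).
  apply: (@measurable_fun_caratheodory _ _ _ (fun s w => q (Num.max s 0) w)).
    by move=> s; apply: mq; rewrite le_max lexx orbT.
  move=> w s; apply: (@cvg_comp _ _ _ (fun s : R => Num.max s 0) (q ^~ w)).
    exact: continuous_maxr0.
  exact: cq.
have -> : (fun w => q (tau w) w) = (fun z : R * T => q (Num.max z.1 0) z.2) \o (fun w => (tau w, w)).
  apply/funext => w /=; have /andP[tau0 _] := tau_range w.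
  by rewrite max_l.
by apply: measurableT_comp h _; apply: measurable_fun_pair.
Qed.

(** The process at the random time is the limit of the process at the random time
    rounded down to the grid.  By independence, the expectation of the latter is the
    sum over the cells of the probability of the cell times the expectation at its
    left end point. *)
Lemma random_time_mean_le (c : nat -> R) (B : R) :
  (forall n, \sum_(k < n.+1) (\int[lebesgue_measure]_(s in
      `[uniform_grid t n.+1 k, uniform_grid t n.+1 k.+1]) psi s) / phi *
      (\int[P]_w q (uniform_grid t n.+1 k) w) <= c n) ->
  c n @[n --> \oo] --> B -> (nnexp P (fun w => q (tau w) w) <= B%:E)%E.
Proof.
move=> hc cB.
have mtarget : measurable_fun [set: T] target.
  apply: measurable_fun_ifT => //; last exact: measurable_random_time.
  exact: measurable_fun_ltr.
have -> : nnexp P (fun w => q (tau w) w) = nnexp P target.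
  apply: nnexp_ae => //.
  - exact: measurable_random_time.
  - by move=> w; rewrite /target; case: ifP.
  - by apply: filterS tau_lt_ae => w h; rewrite /target h.
apply: (nnexp_limit_le (Q := fun n => Q n.+1) (c := c)) => //.
- by move=> n; exact: measurable_Q.
- by move=> n; rewrite mean_Q// lee_fin.
Qed.

End random_time.

(** * The gradient bound *)

(** The Lipschitz inequality between two distinct points. *)
Lemma smoothness_constant_ge0 (R : realType) (d : nat) (L : R) (f : 'cV[R]_d -> R) :
  (0 < d)%N -> L_smooth L f -> 0 <= L.
Proof.
move=> d0 [_ /(_ (const_mx 1) 0) h].
have n0 : 0 < enorm (const_mx 1 - 0 : 'cV[R]_d).
  rewrite lt_neqAle sqrtr_ge0 andbT eq_sym -sqrf_eq0.
  rewrite enorm_sqr_col (eq_bigr (fun=> 1)) => [|k _].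
    by rewrite sumr_const card_ord pnatr_eq0 -lt0n.
  by rewrite !mxE subr0 expr1n.
by rewrite -(pmulr_lge0 _ n0); apply: le_trans h; exact: sqrtr_ge0.
Qed.

(** This puts the squared gradient at a fixed time in the sigma-algebra generated by
    [X], to which the independence assumption applies. *)
Lemma process_measurable_continuous (R : realType) (d : nat) (disp : measure_display)
    (T : measurableType disp) (X : R -> T -> 'cV[R]_d) (g : 'cV[R]_d -> R) (s : R) :
  continuous g -> 0 <= s -> measurable_in (process_sigma_algebra X) (fun w => g (X s w)).
Proof.
move=> cg s0; apply: (@measurable_in_continuous_coords _ _ _ _ _ _ g (X s)) => //.
  exact: smallest_sigma_algebra.
move=> i U mU; apply: sub_sigma_algebra; exists s, i, U; split => //.
Qed.

Lemma continuous_enorm_sqr_grad (R : realType) (d : nat) (f : 'cV[R]_d -> R) :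
  (forall k, continuous (fun x => grad f x k 0)) -> continuous (fun x => enorm (grad f x) ^+ 2).
Proof.
move=> cg.
rewrite (_ : (fun x => _) = (fun x => \sum_k grad f x k 0 * grad f x k 0)).
  by apply: continuous_sum => k x; exact: (cvgM (cg k x) (cg k x)).
by apply/funext => x; rewrite enorm_sqr_col; apply: eq_bigr => k _; rewrite expr2.
Qed.

Theorem theorem1 (R : realType) (d N : nat) (hN : (0 < N)%N)
  (fs : 'I_N -> 'cV[R]_d -> R) (L : R)
  (hC3 : forall i, is_Ck 3 (fs i))
  (hbd3 : forall i, bounded_third_derivative (fs i))
  (hL : forall i, L_smooth L (fs i))
  (hsigma : (sigma_star2 fs < +oo)%E)
  (xstar : 'cV[R]_d) (hxstar : forall x, average fs xstar <= average fs x)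
  (h : R) (hh : 0 < h)
  (psi : R -> R)
  (hpsiC1 : C1_halfline psi)
  (hpsi01 : forall s : R, 0 <= s -> 0 <= psi s <= 1)
  (hpsimono : forall s s' : R, 0 <= s -> s <= s' -> psi s' <= psi s)
  (hpsi0 : psi 0 = 1)
  (b : R -> R)
  (hbC1 : C1_halfline b)
  (hb1 : forall s : R, 0 <= s -> 1 <= b s)
  (disp : measure_display) (T : measurableType disp) (P : probability T R)
  (F : R -> set (set T)) (hF : is_filtration F)
  (B : R -> T -> 'cV[R]_d) (hB : brownian_motion P F B)
  (x0 : 'cV[R]_d) (X : R -> T -> 'cV[R]_d)
  (hX : is_sde_solution P F B
    (fun s x => - (psi s *: grad (average fs) x))
    (fun s x => (psi s * Num.sqrt (h / b s)) *: sigmaMB fs x)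
    x0 X)
  (t : R) (ht : 0 < t)
  (tau : {RV P >-> R})
  (htau_range : forall w, 0 <= tau w <= t)
  (htau_density : forall U : set R, measurable U ->
    distribution P tau U =
    (\int[lebesgue_measure]_(s in U `&` `[0%R, t]%classic)
      ((psi s / time_integral psi t)%R)%:E)%E)
  (htau_indep : independent_of_process P tau X) :
  ('E_P[fun w => (enorm (grad (average fs) (X (tau w) w)) ^+ 2)%R] <=
   (((average fs x0 - average fs xstar) / time_integral psi t
    + h * d%:R * L * fine (sigma_star2 fs) / (2 * time_integral psi t)
      * time_integral (fun s => psi s ^+ 2 / b s) t)%R)%:E)%E.
Proof.
have psi_ge0 s : `[0, t]%classic s -> 0 <= psi s.
  by rewrite /= in_itv/= => /andP[s0 _]; have /andP[] := hpsi01 s s0.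
have phi_ge0 : 0 <= time_integral psi t by apply: Rintegral_ge0.
have gap_ge0 : 0 <= average fs x0 - average fs xstar by rewrite subr_ge0.
(* in dimension 0 the constant L may be negative; the gradient and the noise vanish *)
have [d0|d_gt0] := posnP d.
  rewrite unlock integral0_eq => [|w _]; last first.
    by rewrite enorm_sqr_col big1// => i; have := ltn_ord i; rewrite {2}d0.
  rewrite lee_fin addr_ge0 ?divr_ge0//.
  have d0R : (d%:R : R) = 0 by rewrite d0.
  by rewrite d0R mulr0 !mul0r.
have L0 : 0 <= L by exact: (smoothness_constant_ge0 d_gt0 (hL (Ordinal hN))).
(* otherwise the density, a quotient by zero, would have total mass 0 *)
have phi_gt0 : 0 < time_integral psi t.
  rewrite lt_neqAle phi_ge0 andbT; apply/eqP => phi0.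
  have := htau_density _ measurableT; rewrite probability_setT.
  rewrite integral0_eq => [|s _]; first by move/eqP; rewrite onee_eq0.
  by rewrite -phi0 invr0 mulr0.
pose f := average fs.
(* the data, frozen at negative times, become continuous on the whole line *)
pose ext (U : Type) (g : R -> U) (s : R) : U := g (Num.max s 0).
have max_ge0 (s : R) : 0 <= Num.max s 0 by rewrite le_max lexx orbT.
have extE (U : Type) (g : R -> U) (s : R) : 0 <= s -> g s = ext U g s.
  by move=> s0; rewrite /ext max_l.
have cpsi : continuous (ext _ psi).
  exact: continuous_extend_halfline (C1_halfline_continuous hpsiC1).
have cb : continuous (ext _ b).
  exact: continuous_extend_halfline (C1_halfline_continuous hbC1).
have cX w : continuous ((ext _ X) ^~ w).
  have [_ cX _ _ _] := hX.
  exact: (continuous_extend_halfline (cX w)).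
have psi01 s : 0 <= s -> 0 <= ext _ psi s <= 1 by move=> _; exact: hpsi01.
have b1 s : 1 <= ext _ b s by exact: hb1.
have psiE := @extE _ psi; have bE := @extE _ b; have XE := @extE _ X.
have df z : differentiable f z.
  by apply: differentiable_average => i; have [] := hL i.
have Lip := average_gradient_lipschitz hN L0 hL.
have cgrad := continuous_partial_average hC3.
pose kap := kappa fs h (ext _ psi) (ext _ b).
pose kc := h * (d%:R * fine (sigma_star2 fs)).
have [sg0 _] := sigmaMB_norm x0 hsigma.
have kc0 : 0 <= kc by apply: mulr_ge0; [exact: ltW|exact: mulr_ge0].
have kap_le s : 0 <= s -> kap s <= kc.
  move=> s0; rewrite /kap /kappa -/kc; apply: ler_piMr => //.
  rewrite ler_pdivrMr ?(lt_le_trans ltr01)// mul1r (le_trans _ (b1 s))//.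
  by have /andP[p0 p1] := psi01 s s0; rewrite expr_le1.
have ckap : continuous kap by exact: continuous_kappa.
have mX s k (s0 : 0 <= s) := measurable_X hF hX XE k s0.
have mM s k (s0 : 0 <= s) := measurable_martingale_part hC3 cpsi hF cX hX XE k s0.
have X0 := X0_ae hX XE.
have dec u v w := martingale_part_increment hC3 cpsi x0 cX (u := u) (v := v) w.
have msqM u v := increments_msq hC3 hsigma hh cpsi cb b1 hF hB cX hX psiE bE XE (u := u) (v := v).
have orthM u v k (u0 : 0 <= u) (uv : u <= v)
    (sg : sq_integrable P (fun w => grad f (ext _ X u w) k 0)) :
    P.-integrable [set: T] (EFin \o (fun w => grad f (ext _ X u w) k 0 *
      (martingale_part fs (ext _ psi) x0 (ext _ X) v w k 0 -
       martingale_part fs (ext _ psi) x0 (ext _ X) u w k 0))) /\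
    \int[P]_w (grad f (ext _ X u w) k 0 *
      (martingale_part fs (ext _ psi) x0 (ext _ X) v w k 0 -
       martingale_part fs (ext _ psi) x0 (ext _ X) u w k 0)) = 0.
  split.
    exact: (sq_integrable_mul sg
      (increment_sq_integrable hC3 cpsi hF hB cX hX psiE XE u0 uv k)).
  apply: (increment_orthogonal hC3 cpsi hF hB cX hX psiE XE u0 uv k _ sg).
  apply: (@measurable_in_continuous_coords _ _ _ _ _ _ (fun x => grad f x k 0)).
  - by have [sF _ _] := hF; exact: sF.
  - exact: cgrad.
  - by move=> i; exact: (X_measurable_in hX XE).
have [C [C0 Ig energy]] := energy_dissipation L0 df Lip cgrad hxstar cpsi psi01 cX mX mM X0 dec
  ckap kap_le kc0 msqM orthM ht.
pose q := gradsq f (ext _ X).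
pose phi := time_integral psi t.
have cq := continuous_enorm_sqr_grad cgrad.
have mtau : measurable_fun [set: T] tau by exact: measurable_funP.
have tau_law (U : set R) (mU : measurable U) : P (tau @^-1` U) =
    (\int[lebesgue_measure]_(s in U `&` `[0%R, t]%classic) ((ext _ psi s / phi)%R)%:E)%E.
  rewrite [LHS](htau_density U mU); apply: eq_integral => s.
  by rewrite inE => -[_ /=]; rewrite in_itv/= => /andP[s0 _]; rewrite -psiE.
have q_indep (s : R) (V U : set R) (s0 : 0 <= s) (mV : measurable V) (mU : measurable U) :
    P (q s @^-1` V `&` tau @^-1` U) = (P (q s @^-1` V) * P (tau @^-1` U))%E.
  apply: htau_indep => //.
  have := @process_measurable_continuous _ _ _ _ X _ s cq s0 V mV.
  by rewrite /q /gradsq -XE.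
have q_ge0 s w : 0 <= q s w by exact: sqr_ge0.
have mq s : 0 <= s -> measurable_fun [set: T] (q s).
  by move=> s0; apply: measurable_gradsq => // r k; exact: mX.
have cqpath w : continuous (q ^~ w) by apply: continuous_gradsq.
pose K := \int[lebesgue_measure]_(r in `[0, t]) kap r.
pose bound (e : R) := (f x0 - f xstar + L / 2 * (1 + e) * K + C * e) / phi.
have mean_le (e : R) : 0 < e -> e <= 1 -> (nnexp P (fun w => q (tau w) w) <= (bound e)%:E)%E.
  move=> e0 e1.
  apply: (random_time_mean_le cpsi ht mtau htau_range tau_law mq cqpath q_ge0 Ig q_indep
    (c := fun n => bound e + C * t / (e * phi) * n.+1%:R^-1)).
    move=> n; have := energy e n.+1 e0 e1 (ltn0Sn n).
    move=> hn.
    under eq_bigr do rewrite mulrAC.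
    rewrite -mulr_suml ler_pdivrMr//; apply: (le_trans hn).
    rewrite -/K /bound le_eqVlt; apply/orP; left; apply/eqP.
    have nz := ltr0Sn R n; set n1 := n.+1%:R in nz *.
    by field; rewrite !gt_eqF.
  rewrite -[X in _ --> X]addr0; apply: cvgD; first exact: cvg_cst.
  rewrite -[X in _ --> X](mulr0 (C * t / (e * phi))); apply: cvgM; first exact: cvg_cst.
  exact: cvg_harmonic.
have K_eq : K = h * (d%:R * fine (sigma_star2 fs)) * time_integral (fun s => psi s ^+ 2 / b s) t.
  have -> : time_integral (fun s => psi s ^+ 2 / b s) t =
      \int[lebesgue_measure]_(s in `[0, t]) (ext _ psi s ^+ 2 / ext _ b s).
    apply: eq_Rintegral => s; rewrite inE /= in_itv/= => /andP[s0 _].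
    by rewrite -psiE// -bE.
  have c : continuous (fun s => ext _ psi s ^+ 2 / ext _ b s).
    move=> s; apply: cvgM; first exact: (cvgM (cpsi s) (cpsi s)).
    by apply: cvgV; [rewrite gt_eqF// (lt_le_trans ltr01)|exact: cb].
  by rewrite -(RintegralZl _ (measurable_segment 0 t) (continuous_segment_integrable 0 t c)).
have fin : nnexp P (fun w => q (tau w) w) \is a fin_num.
  rewrite ge0_fin_numE; last by apply: nnexp_ge0 => w.
  exact: le_lt_trans (mean_le 1 ltr01 (lexx 1)) (ltry _).
rewrite unlock.
have -> : (\int[P]_w (enorm (grad (average fs) (X (tau w) w)) ^+ 2)%:E)%E =
    nnexp P (fun w => q (tau w) w).
  apply: eq_integral => w _; have /andP[tau0 _] := htau_range w.
  by rewrite /q /gradsq -XE.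
rewrite -(fineK fin) lee_fin.
have -> : (average fs x0 - average fs xstar) / time_integral psi t
    + h * d%:R * L * fine (sigma_star2 fs) / (2 * time_integral psi t)
      * time_integral (fun s => psi s ^+ 2 / b s) t =
    (f x0 - f xstar + L / 2 * K) / phi.
  by rewrite K_eq /f -/phi; field; rewrite gt_eqF.
(* the bound is affine in e, with this slope *)
apply: (@ler_small_slope _ _ _ ((L / 2 * K + C) / phi)).
  apply: divr_ge0 => //; apply: addr_ge0 => //; apply: mulr_ge0; first exact: divr_ge0.
  by apply: segment_integral_ge0 => s; rewrite /kap; apply: kappa_ge0.
move=> e e0 e1; rewrite -lee_fin fineK//; apply: (le_trans (mean_le e e0 e1)).
rewrite lee_fin /bound le_eqVlt; apply/orP; left; apply/eqP; ring.
Qed.
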